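(* For all $a,b,c\in\mathbb Q$, the function $\tau\mapsto q^cF_{a,b}(q)$ on the upper half-plane is not a weight-zero modular function on any finite-index subgroup of $\mathrm{SL}_2(\mathbb Z)$ with finite-order multiplier, meromorphic at the cusps.
   Context: Here $\tau\in\mathbb H=\{z\in\mathbb C:\operatorname{Im}z>0\}$, $q=e^{2\pi i\tau}$, fractional powers mean $q^c=e^{2\pi ic\tau}$, and $(x;q)_n=\prod_{j=0}^{n-1}(1-xq^j)$. For $a,b\in\mathbb Q$ define $$F_{a,b}(q)=\sum_{r,s\ge 0}\frac{q^{3r^2+31rs+93s^2+ar+bs}}{(q;q)_r\,(q^{31};q^{31})_s},$$ which converges locally uniformly on $\mathbb H$. ''Weight-zero modular function on $\Gamma$ with finite-order multiplier'' means $f(\gamma\tau)=v(\gamma)f(\tau)$ for all $\gamma\in\Gamma$, where $v:\Gamma\to\mathbb C^\times$ is a character of finite order. *)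

(* Defs.v *)
From HB Require Import structures.
From mathcomp Require Import all_boot all_order all_algebra.
From mathcomp Require Import complex.
From mathcomp Require Import all_classical all_reals all_analysis.
Set Implicit Arguments.
Unset Strict Implicit.
Unset Printing Implicit Defensive.
Import Order.TTheory GRing.Theory Num.Theory.
Import numFieldNormedType.Exports.
Local Open Scope classical_set_scope.
Local Open Scope ring_scope.

(* R[i] carries no topology of its own; limits of complex sequences are taken
   in R[i]^o, i.e. for the topology of the complex modulus. *)
Notation complex_seq R := (nat -> R[i]^o).

Definition cexp (R : realType) (z : R[i]) : R[i] :=
  (expR (complex.Re z))%:C%C
    * (cos (complex.Im z) +i* sin (complex.Im z))%C.

(* [qpow c tau] is q^c = exp (2 pi i c tau), where q = exp (2 pi i tau). *)
Definition qpow (R : realType) (c : rat) (tau : R[i]) : R[i] :=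
  cexp (2%:R * pi%:C%C * 'i%C * ratr c * tau).

Definition upper_half_plane (R : realType) : set R[i] :=
  [set tau | 0 < complex.Im tau].

Definition qpochhammer (K : pzRingType) (x q : K) (n : nat) : K :=
  \prod_(j < n) (1 - x * q ^+ j).

Definition F_exponent (a b : rat) (r s : nat) : rat :=
  3%:R * r%:R ^+ 2 + 31%:R * r%:R * s%:R + 93%:R * s%:R ^+ 2
    + a * r%:R + b * s%:R.

Definition F_term (R : realType) (a b : rat) (tau : R[i]) (r s : nat) : R[i] :=
  let q := qpow 1 tau in
  qpow (F_exponent a b r s) tau
    / (qpochhammer q q r * qpochhammer (q ^+ 31) (q ^+ 31) s).

(* On the upper half-plane the double series converges absolutely, so that
   taking the limit of the square partial sums is no restriction. *)
Definition F (R : realType) (a b : rat) (tau : R[i]) : R[i] :=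
  limn ((fun n => \sum_(r < n) \sum_(s < n) F_term a b tau r s)
          : complex_seq R).

Definition SL2Z : set 'M[int]_2 := [set g | \det g = 1].

Definition is_subgroup_SL2Z (G : set 'M[int]_2) : Prop :=
  [/\ G `<=` SL2Z,
      G 1%:M,
      (forall g h, G g -> G h -> G (g *m h)) &
      (forall g, G g -> G (invmx g))].

Definition right_coset (G : set 'M[int]_2) (g : 'M[int]_2) : set 'M[int]_2 :=
  [set h *m g | h in G].

Definition finite_index_subgroup (G : set 'M[int]_2) : Prop :=
  is_subgroup_SL2Z G /\ finite_set (right_coset G @` SL2Z).

Definition mobius (R : realType) (g : 'M[int]_2) (tau : R[i]) : R[i] :=
  ((g 0 0)%:~R * tau + (g 0 1)%:~R) / ((g 1 0)%:~R * tau + (g 1 1)%:~R).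

(* Only the values of [v] on [G] matter. *)
Definition finite_order_character (R : realType) (G : set 'M[int]_2)
    (v : 'M[int]_2 -> R[i]) : Prop :=
  [/\ (forall g, G g -> v g != 0),
      (forall g h, G g -> G h -> v (g *m h) = v g * v h) &
      exists2 n : nat, (0 < n)%N & forall g, G g -> v g ^+ n = 1].

(* Near i oo, f is a Laurent series in q^(1/N) with finitely many terms of
   negative exponent: f(tau) = \sum_(n >= 0) u_n q^((n - m)/N). *)
Definition meromorphic_at_infinity (R : realType) (f : R[i] -> R[i]) : Prop :=
  exists (N m : nat) (u : nat -> R[i]) (Y : R), [/\ (0 < N)%N, 0 <= Y &
    forall tau, Y < complex.Im tau ->
      (series (fun n => u n * qpow ((n%:R - m%:R) / N%:R) tau)
        : complex_seq R) @ \oo --> (f tau : R[i]^o)].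

(* Every cusp is g(oo) for some g in SL_2(Z). *)
Definition meromorphic_at_cusps (R : realType) (f : R[i] -> R[i]) : Prop :=
  forall g, SL2Z g -> meromorphic_at_infinity (fun tau => f (mobius g tau)).

(* Meromorphy inside the upper half-plane is not listed: the functions
   q^c F_{a,b} are holomorphic there. *)
Definition modular_function (R : realType) (G : set 'M[int]_2)
    (f : R[i] -> R[i]) : Prop :=
  (exists2 v : 'M[int]_2 -> R[i], finite_order_character G v &
     forall g tau, G g -> upper_half_plane tau ->
       f (mobius g tau) = v g * f tau)
  /\ meromorphic_at_cusps f.

(* Main.v *)
(* Only the cusp 0 is used. Put q = e^(-t). If q^c F_{a,b} is meromorphic at 0, the
   Puiseux expansion there makes ln F(q) - c t - al/t - C_0 exponentially small as
   t -> 0+ along the imaginary axis. On the other hand, Euler-Maclaurin applied to the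
   q-factorials and a Gaussian lattice sum around the saddle point of the summand,
   which solves Nahm's equations 1 - x = x^6 y and 1 - y = x^31 y^6, give, with t = h^2,
   a full asymptotic expansion of ln F in powers of t. In ln F(t') - ln F(t), t' = 2 t,
   all logarithmic terms cancel, and the comparison of the coefficients of t and t^2
   yields c = g_2 - 4/3 and g_4 = g_2^2 / 2, where 1 + g_2 h^2 + g_4 h^4 + ... is the
   expansion of the Gaussian sum.

   The solution x in (0, 1) is a root of x^3 - 5 x^2 + 2 x + 1, irreducible over Q, and
   g_2 is a quadratic polynomial in (a, b) with coefficients in Q(x). As g_2 is
   rational, its components at x and x^2 vanish, which puts (a, b) on two conics; their
   only common rational point is (19/3, 124/3). There g_4 - g_2^2 / 2 does not vanish,
   as one sees modulo a prime over 11. *)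

Require Import Defs.
From mathcomp Require Import all_boot all_order all_algebra.
From mathcomp Require Import complex.
From mathcomp Require Import all_classical all_reals all_analysis.
From mathcomp Require Import ring lra zify.
Set Implicit Arguments.
Unset Strict Implicit.
Unset Printing Implicit Defensive.
Import Order.TTheory GRing.Theory Num.Theory.
Import numFieldNormedType.Exports.
Local Open Scope ring_scope.

Local Open Scope ring_scope.

(** The choice [t' = 2 t] answers an obstacle: [ln (1 - e^(-v))] is singular at [v = 0], so
    Euler-Maclaurin for [(q; q)_n] started at 0 leaves an unknown function of [t] alone. The
    quotient [(q^2; q^2)_n / (q; q)_n = (-q; q)_n] has a summand smooth at 0, which determines the
    increment of that function from [t] to [2 t] up to [O(t^3)]. The constant 4/3 is
    [(1 + 31) / 24], the contribution of the bases [q] and [q^31] at order [t].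

    Rationality of [g_2] alone cannot finish the argument: at (19/3, 124/3) it does hold, and only
    the coefficient of [t^2] excludes this point. That forces the Gaussian sum to order [h^4], with
    moments of polynomials of degree up to 12. For this reason the coefficient formulas are written
    once over an abstract record of operations: over the reals they are what the analysis produces,
    over the cubic field they give [g_2] exactly, and modulo 11, where the cubic has the root 3,
    they decide whether [g_4 - g_2^2 / 2] vanishes. *)

Ltac nneg :=
  lazymatch goal with
  | |- is_true (0 <= _ + _) => apply: addr_ge0; nneg
  | |- is_true (0 <= _ * _) => apply: mulr_ge0; nneg
  | |- is_true (0 <= _^-1) => rewrite invr_ge0; nneg
  | |- is_true (0 <= _ ^+ _) => first [exact: sqr_ge0 | apply: exprn_ge0; nneg]
  | |- is_true (0 <= expR _) => exact: expR_ge0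
  | |- is_true (0 <= `|_|) => exact: normr_ge0
  | |- is_true (0 <= pi) => exact: pi_ge0
  | |- is_true (0 <= _%:R) => exact: ler0n
  | |- is_true (0 <= \sum_(_ <- _ | _) _) => apply: sumr_ge0 => ? _; nneg
  | |- _ => first [assumption | solve [auto] | by apply: ltW | exact: ler01 | exact: lexx]
  end.

(** * Taylor expansions and Gaussian lattice sums *)

Section Taylor.
Variable R : realType.
Implicit Types (g : nat -> R -> R) (x h M : R) (n : nat).

Lemma is_derive_continuous (f : R -> R) (x d : R) :
  is_derive x 1 f d -> {for x, continuous f}.
Proof. by case=> dfx _; exact/differentiable_continuous/derivable1_diffP. Qed.

Lemma MVT_le (f df : R -> R) (a b : R) : a <= b ->
  (forall v, a <= v <= b -> is_derive v 1 f (df v)) ->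
  exists2 c, a <= c <= b & f b - f a = df c * (b - a).
Proof.
move=> ab fd.
have [||c cab e] := @MVT_segment R f df a b ab.
- by move=> v; rewrite in_itv /= => /andP[av vb]; apply: fd; rewrite !ltW.
- apply: continuous_in_subspaceT => v; rewrite inE /= in_itv /= => vab.
  exact: is_derive_continuous (fd v vab).
by exists c => //; move: cab; rewrite in_itv.
Qed.

Lemma is_derive_sum_ord n (F : 'I_n -> R -> R) (dF : 'I_n -> R) x :
  (forall i, is_derive x 1 (F i) (dF i)) ->
  is_derive x 1 (fun v => \sum_(i < n) F i v) (\sum_(i < n) dF i).
Proof.
move=> H; have -> : (fun v => \sum_(i < n) F i v) = \sum_(i < n) F i.
  by apply/funext => v; rewrite fct_sumE.
exact: is_derive_sum.
Qed.

(* All points considered lie in [[l, r]]; the step [h] may be negative. *)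
Lemma taylor_bound n g (l r M x h : R) :
  (forall k v, (k < n)%N -> l <= v <= r -> is_derive v 1 (g k) (g k.+1 v)) ->
  (forall v, l <= v <= r -> `|g n v| <= M) ->
  l <= x <= r -> l <= x + h <= r ->
  `|g 0 (x + h) - \sum_(k < n) g k x * h ^+ k / k`!%:R| <= M * `|h| ^+ n.
Proof.
elim: n g h => [|n IH] g h gd gM xlr xhlr.
  by rewrite big_ord0 subr0 expr0 mulr1; exact: gM.
have M0 : 0 <= M by apply: le_trans (normr_ge0 _) (gM _ xlr).
(* The remainder as a function of the end point: it vanishes at [x], and its derivative is the
   remainder of the next lower order for the shifted family [g k.+1]. The mean value theorem then
   closes the induction, at the price of the factor [1/n!]. *)
pose F v := g 0 v - \sum_(k < n.+1) g k x * (v - x) ^+ k / k`!%:R.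
pose dF v := g 1 v - \sum_(k < n) g k.+1 x * (v - x) ^+ k / k`!%:R.
have Fd v : l <= v <= r -> is_derive v 1 F (dF v).
  move=> vlr; apply: is_deriveB; first exact: gd.
  pose d (k : 'I_n.+1) := g k x * (k%:R * (v - x) ^+ k.-1) / k`!%:R.
  have -> : \sum_(k < n) g k.+1 x * (v - x) ^+ k / k`!%:R =
            \sum_(k < n.+1) d k.
    rewrite big_ord_recl /d /= mul0r mulr0 mul0r add0r.
    apply: eq_bigr => i _; rewrite /bump /= add1n factS natrM.
    have f0 : (i`!%:R : R) != 0 by rewrite pnatr_eq0 -lt0n fact_gt0.
    have f1 : (i.+1%:R : R) != 0 by rewrite pnatr_eq0.
    rewrite add0n; move: (i`!%:R) (i.+1%:R) f0 f1 => p q f0 f1.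
    by field; rewrite f0 f1.
  apply: is_derive_sum_ord => k.
  rewrite /d.
  have : is_derive v 1 (fun w => (g k x / k`!%:R) *: ((id - cst x) ^+ k) w)
      ((g k x / k`!%:R) *: (k%:R * (v - x) ^+ k.-1)).
    apply: is_deriveZ; apply: is_derive_eq.
    rewrite subr0 /= -[RHS]mulr1 [(id - cst x) v]/(v - x).
    by rewrite -[_ *+ _]mulr_natl.
  rewrite /GRing.scale /=.
  by congr is_derive; [apply/funext => w; rewrite fctE; ring | ring].
have Fx : F x = 0.
  rewrite /F big_ord_recl /= expr0 mulr1 fact0 divr1 big1 ?addr0 ?subrr//.
  by move=> i _; rewrite expr0n /= mulr0 mul0r.
have dFb v : l <= v <= r -> `|dF v| <= M * `|v - x| ^+ n.
  move=> vlr; have := IH (fun k => g k.+1) (v - x) (fun k w kn => gd k.+1 w kn) gM xlr.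
  by rewrite (addrC x) subrK; apply.
have -> : g 0 (x + h) - \sum_(k < n.+1) g k x * h ^+ k / k`!%:R = F (x + h) - F x.
  by rewrite Fx subr0 /F addrAC subrr add0r.
have [h0|h0] := leP 0 h.
  have [|v vlr|c cx ->] := @MVT_le F dF x (x + h).
  - by rewrite lerDl.
  - by apply: Fd; lra.
  rewrite addrAC subrr add0r normrM exprSr mulrA ler_wpM2r//.
  apply: le_trans (dFb c _) _; first by lra.
  by rewrite ler_wpM2l// lerXn2r ?nnegrE ?normr_ge0// !ger0_norm//; lra.
have [|v vlr|c cx] := @MVT_le F dF (x + h) x.
- by lra.
- by apply: Fd; lra.
rewrite -opprB => /(congr1 -%R); rewrite opprK => ->.
rewrite normrN opprD addrA subrr sub0r normrM normrN exprSr mulrA ler_wpM2r//.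
apply: le_trans (dFb c _) _; first by lra.
by rewrite ler_wpM2l// lerXn2r ?nnegrE ?normr_ge0// !ler0_norm//; lra.
Qed.
End Taylor.

Section LatticeSums.
Variable R : realType.
Implicit Types (m h th c : R) (p : {poly R}).

Lemma expr_expRN_bounded (k : R) n : 0 < k ->
  exists2 C, 0 <= C & forall y, 0 <= y -> y ^+ n * expR (- (k * y)) <= C.
Proof.
move=> k0; pose q : R := n.+1`!%:R / k ^+ n.+1.
have q0 : 0 <= q by rewrite divr_ge0 ?exprn_ge0// ltW.
exists (1 + q) => [|y y0]; first by rewrite addr_ge0.
rewrite expRN ler_pdivrMr ?expR_gt0//.
have ky0 : 0 <= k * y by rewrite mulr_ge0// ltW.
have e1 : 1 <= expR (k * y) by rewrite -expR0 ler_expR.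
have e2 : y ^+ n.+1 <= q * expR (k * y).
  have := expR_ge1Dxn n ky0; rewrite exprMn.
  move=> /(le_trans (_ : k ^+ n.+1 * y ^+ n.+1 / n.+1`!%:R <= _)) H.
  rewrite /q mulrAC ler_pdivlMr ?exprn_gt0// mulrC -ler_pdivrMl ?ltr0n ?fact_gt0//.
  by rewrite [X in X <= _]mulrC; apply: H; rewrite lerDr.
suff : y ^+ n <= 1 + y ^+ n.+1.
  by move/le_trans; apply; rewrite mulrDl mul1r lerD.
have [y1|/ltW y1] := leP y 1.
  by rewrite ler_wpDr ?exprn_ge0// exprn_ile1.
by apply: ler_wpDl => //; rewrite exprS ler_peMl// exprn_ge0.
Qed.

Lemma horner_norm_le p : exists2 C, 0 <= C &
  forall x, `|p.[x]| <= C * (1 + x ^+ 2) ^+ size p.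
Proof.
exists (\sum_(i < size p) `|p`_i|) => [|x]; first exact: sumr_ge0.
rewrite horner_coef mulr_suml.
apply: le_trans (ler_norm_sum _ _ _) _; apply: ler_sum => i _.
rewrite normrM ler_wpM2l// normrX.
have x1 : 1 <= 1 + x ^+ 2 by rewrite lerDl sqr_ge0.
apply: le_trans (_ : (1 + x ^+ 2) ^+ i <= _); last first.
  by rewrite ler_weXn2l// ltnW.
rewrite lerXn2r ?nnegrE ?normr_ge0 ?(le_trans ler01)//.
rewrite -(real_normK (num_real x)).
have := sqr_ge0 (`|x| - 1); have := normr_ge0 x; nra.
Qed.

Definition gauss m p x := p.[x] * expR (- (m / 2 * x ^+ 2)).

Definition dgauss m p := p^`() - m *: ('X * p).

Lemma is_derive_gauss m p (x : R) : is_derive x 1 (gauss m p) (gauss m (dgauss m p) x).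
Proof.
rewrite /gauss; apply: is_derive_eq.
rewrite /dgauss !hornerE /GRing.scale /=.
by field.
Qed.

Lemma gauss_decay m p k : 0 < m -> exists2 C, 0 <= C &
  forall x, `|gauss m p x| <= C / (1 + x ^+ 2) ^+ k.
Proof.
move=> m0; have [C C0 HC] := horner_norm_le p.
have m20 : 0 < m / 2 by rewrite divr_gt0.
have [D D0 HD] := expr_expRN_bounded (size p + k) m20.
have C'0 : 0 <= C * D * expR (m / 2) by rewrite !mulr_ge0// expR_ge0.
exists (C * D * expR (m / 2)) => [//|x].
have x1 : 0 < 1 + x ^+ 2 by rewrite ltr_pwDl// sqr_ge0.
rewrite ler_pdivlMr ?exprn_gt0// /gauss normrM (gtr0_norm (expR_gt0 _)).
have -> : - (m / 2 * x ^+ 2) = - (m / 2 * (1 + x ^+ 2)) + m / 2 by ring.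
rewrite expRD; have := HD _ (ltW x1).
have := expR_ge0 (- (m / 2 * (1 + x ^+ 2))); have := expR_ge0 (m / 2).
move: (HC x) (exprn_ge0 k (ltW x1)); rewrite exprD.
move: (_ ^+ size p) (_ ^+ k) `|_| (expR (m / 2)) (expR (- _)) => q r P b a.
move=> Pq r0 b0 a0 qra; rewrite -[P * _ * _]mulrA.
apply: le_trans (ler_wpM2r _ Pq) _; first by rewrite !mulr_ge0.
have -> : C * q * (a * b * r) = C * (q * r * a) * b by ring.
by rewrite ler_wpM2r// ler_wpM2l.
Qed.

(** Telescoping [atan] bounds the lattice sums of [1/(1 + x^2)] uniformly in the length and the
    offset of the lattice. The 3 bounds [(1 + c^2)/(1 + x^2)] for [|c - x| <= 1]. *)
Lemma atan_increment h x : 0 < h <= 1 ->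
  h / (1 + x ^+ 2) <= 3 * (atan (x + h) - atan x).
Proof.
move=> /andP[h0 h1].
have [|c cx ->] := @MVT_le R atan (fun v => (1 + v ^+ 2)^-1) x (x + h).
  by rewrite lerDl ltW.
have x0 : 0 < 1 + x ^+ 2 by rewrite ltr_pwDl// sqr_ge0.
have c0 : 0 < 1 + c ^+ 2 by rewrite ltr_pwDl// sqr_ge0.
rewrite addrAC subrr add0r mulrA mulrC ler_wpM2r ?(ltW h0)//.
rewrite -[_^-1]mul1r ler_pdivrMr// mulrAC ler_pdivlMr// mul1r.
have := sqr_ge0 (2 * x - c); nra.
Qed.

Lemma lattice_sum_le h th N : 0 < h <= 1 ->
  \sum_(j < N) h / (1 + (h * j%:R + th) ^+ 2) <= 3 * pi.
Proof.
move=> h01; apply: le_trans (_ : \sum_(j < N)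
    3 * (atan (h * j.+1%:R + th) - atan (h * j%:R + th)) <= _).
  apply: ler_sum => j _; apply: le_trans (atan_increment _ h01) _.
  by have -> : h * j.+1%:R + th = h * j%:R + th + h by rewrite -natr1; ring.
rewrite -mulr_sumr -(big_mkord xpredT (fun j => atan (h * j.+1%:R + th) -
  atan (h * j%:R + th))) telescope_sumr// ler_pM2l//.
have := atan_ltpi2 (h * N%:R + th); have := atan_gtNpi2 (h * 0%:R + th); lra.
Qed.

Lemma eqW (x y : R) : x = y -> x <= y.
Proof. by move=> ->. Qed.

Lemma ler_inv_shift (x v : R) : x <= v <= x + 1 ->
  (1 + v ^+ 2)^-1 <= 3 / (1 + x ^+ 2).
Proof.
move=> xv; have x0 : 0 < 1 + x ^+ 2 by rewrite ltr_pwDl// sqr_ge0.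
have v0 : 0 < 1 + v ^+ 2 by rewrite ltr_pwDl// sqr_ge0.
rewrite -[_^-1]mul1r ler_pdivrMr// mulrAC ler_pdivlMr// mul1r.
have := sqr_ge0 (2 * v - x); nra.
Qed.

Lemma taylor_decay n (g : nat -> R -> R) (C x h : R) : 0 <= C ->
  (forall k (v : R), is_derive v 1 (g k) (g k.+1 v)) ->
  (forall v, `|g n v| <= C / (1 + v ^+ 2)) -> 0 < h <= 1 ->
  `|g 0 (x + h) - \sum_(k < n) g k x * h ^+ k / k`!%:R|
    <= 3 * C * h ^+ n / (1 + x ^+ 2).
Proof.
move=> C0 gd gC /andP[h0 h1].
have := @taylor_bound R n g x (x + 1) (C * (3 / (1 + x ^+ 2))) x h.
rewrite (gtr0_norm h0) => H.
have -> : 3 * C * h ^+ n / (1 + x ^+ 2) = C * (3 / (1 + x ^+ 2)) * h ^+ n by ring.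
apply: H => [v vx||]; [|lra|lra].
by apply: le_trans (gC v) _; rewrite ler_wpM2l// ler_inv_shift.
Qed.

Lemma lattice_telescope (g : R -> R) h th N :
  \sum_(j < N) (g (h * j%:R + th + h) - g (h * j%:R + th)) =
  g (h * N%:R + th) - g th.
Proof.
pose f j := g (h * j%:R + th).
transitivity (\sum_(j < N) (f j.+1 - f j)).
  apply: eq_bigr => j _; rewrite /f.
  by have -> : h * j.+1%:R + th = h * j%:R + th + h by rewrite -natr1; ring.
rewrite -(big_mkord xpredT (fun j => f j.+1 - f j)) telescope_sumr//.
by rewrite /f mulr0 add0r.
Qed.

(** A form of Euler-Maclaurin without Bernoulli numbers: summing the Taylor expansions of the
    increments of [g 0] gives a triangular relation between the lattice sums of its derivatives, to
    be solved by induction on the order. *)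
Lemma lattice_taylor n (g : nat -> R -> R) (C : R) : 0 <= C ->
  (forall k (v : R), is_derive v 1 (g k) (g k.+1 v)) ->
  (forall v, `|g n.+1 v| <= C / (1 + v ^+ 2)) ->
  forall h th N, 0 < h <= 1 ->
  `|g 0 (h * N%:R + th) - g 0 th -
    \sum_(k < n) h ^+ k / k.+1`!%:R * (h * \sum_(j < N) g k.+1 (h * j%:R + th))|
    <= 9 * pi * C * h ^+ n.
Proof.
move=> C0 gd gC h th N h01; have /andP[h0 h1] := h01.
rewrite -lattice_telescope.
pose rest x := g 0 (x + h) - \sum_(k < n.+1) g k x * h ^+ k / k`!%:R.
have -> : \sum_(j < N) (g 0 (h * j%:R + th + h) - g 0 (h * j%:R + th)) -
  \sum_(k < n) h ^+ k / k.+1`!%:R * (h * \sum_(j < N) g k.+1 (h * j%:R + th)) =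
  \sum_(j < N) rest (h * j%:R + th).
  under [X in _ - X]eq_bigr do rewrite !mulr_sumr.
  rewrite exchange_big /= -sumrB; apply: eq_bigr => j _; rewrite /rest.
  rewrite big_ord_recl /= expr0 mulr1 fact0 divr1 opprD addrA; congr (_ - _).
  by apply: eq_bigr => i _; rewrite /bump /= add1n exprS; ring.
apply: le_trans (ler_norm_sum _ _ _) _.
apply: le_trans (_ : \sum_(j < N) 3 * C * h ^+ n * (h / (1 + (h * j%:R + th) ^+ 2)) <= _).
  apply: ler_sum => j _; apply: le_trans (taylor_decay _ C0 gd gC h01) _.
  by rewrite exprSr; apply/eqW; ring.
rewrite -mulr_sumr; have := lattice_sum_le th N h01 => H.
have -> : 9 * pi * C * h ^+ n = 3 * C * h ^+ n * (3 * pi) by ring.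
by rewrite ler_wpM2l// !mulr_ge0// exprn_ge0// ltW.
Qed.

Lemma choice_bound (T : Type) (Q : T -> R -> Prop) :
  (forall t, exists2 C, 0 <= C & Q t C) ->
  exists2 f : T -> R, (forall t, 0 <= f t) & forall t, Q t (f t).
Proof.
move=> H; have [t|f Hf] := @choice T R (fun t C => 0 <= C /\ Q t C).
  by have [C C0 QC] := H t; exists C.
by exists f => t; have [] := Hf t.
Qed.

Definition lsum m p h th N := h * \sum_(j < N) gauss m p (h * j%:R + th).

Lemma lsum_abs_bounded m p : 0 < m -> exists2 C, 0 <= C &
  forall h th N, 0 < h <= 1 -> h * \sum_(j < N) `|gauss m p (h * j%:R + th)| <= C.
Proof.
move=> m0; have [C C0 HC] := gauss_decay p 1 m0.
exists (C * (3 * pi)) => [|h th N h01].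
  by rewrite !mulr_ge0// ltW// pi_gt0.
apply: le_trans (_ : C * \sum_(j < N) h / (1 + (h * j%:R + th) ^+ 2) <= _); last first.
  by rewrite ler_wpM2l// lattice_sum_le.
rewrite !mulr_sumr; apply: ler_sum => j _.
by rewrite mulrCA ler_wpM2l//; case/andP: h01 => /ltW.
Qed.

Lemma lsum_bounded m p : 0 < m -> exists2 C, 0 <= C &
  forall h th N, 0 < h <= 1 -> `|lsum m p h th N| <= C.
Proof.
move=> m0; have [C C0 HC] := lsum_abs_bounded p m0.
exists C => // h th N h01; apply: le_trans (HC h th N h01).
rewrite /lsum normrM gtr0_norm ?(proj1 (andP h01))//.
by rewrite ler_wpM2l ?ler_norm_sum// ltW// (proj1 (andP h01)).
Qed.

(* The lattice [h j + th], [j < N], covers [-c/h, c/h]. *)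
Definition covers c h th N := [/\ 0 < h <= 1, th <= - (c / h) & c / h <= h * N%:R + th].

Lemma inv_onesqr_le c h x K : 0 < c -> 0 < h <= 1 -> c / h <= `|x| ->
  ((1 + x ^+ 2) ^+ K)^-1 <= h ^+ K / (c ^+ 2) ^+ K.
Proof.
move=> c0 /andP[h0 h1] cx; rewrite -expr_div_n -exprVn.
have x0 : 0 < 1 + x ^+ 2 by rewrite ltr_pwDl// sqr_ge0.
rewrite lerXn2r ?nnegrE ?invr_ge0 ?divr_ge0 ?sqr_ge0 ?(ltW x0) ?(ltW h0)//.
rewrite -[_^-1]mul1r ler_pdivrMr// mulrAC ler_pdivlMr ?exprn_gt0// mul1r.
have : c ^+ 2 <= x ^+ 2 * h ^+ 2.
  rewrite -exprMn -(real_normK (num_real (x * h))) normrM (gtr0_norm h0).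
  rewrite lerXn2r ?nnegrE ?mulr_ge0 ?(ltW c0) ?(ltW h0)//.
  by rewrite -ler_pdivrMr.
move/le_trans; apply; have : h ^+ 2 <= h by rewrite expr2 ler_piMr// ltW.
have := sqr_ge0 x; nra.
Qed.

Lemma gauss_edge m p c K : 0 < m -> 0 < c -> exists2 C, 0 <= C &
  forall h x, 0 < h <= 1 -> c / h <= `|x| -> `|gauss m p x| <= C * h ^+ K.
Proof.
move=> m0 c0; have [C C0 HC] := gauss_decay p K m0.
exists (C / (c ^+ 2) ^+ K) => [|h x h01 cx].
  by rewrite divr_ge0// exprn_ge0// sqr_ge0.
apply: le_trans (HC x) _; rewrite -mulrA ler_wpM2l// mulrC.
exact: inv_onesqr_le.
Qed.

Lemma covers_edges c h th N : 0 < c -> covers c h th N ->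
  c / h <= `|th| /\ c / h <= `|h * N%:R + th|.
Proof.
move=> c0 [/andP[h0 _] H1 H2]; have ch : 0 < c / h by rewrite divr_gt0.
split; first by rewrite ltr0_norm; lra.
by rewrite ger0_norm; lra.
Qed.

Lemma is_derive_iter_gauss m p k (v : R) :
  is_derive v 1 (gauss m (iter k (dgauss m) p)) (gauss m (iter k.+1 (dgauss m) p) v).
Proof. exact: is_derive_gauss. Qed.

(** A derivative has integral zero, so its lattice sum is smaller than every power of [h]. Each
    induction step gains one factor [h]: in [lattice_taylor] the boundary values are tiny because
    the lattice ends at distance at least [c/h] from 0, and the sums of the higher derivatives,
    bounded by induction, carry an extra [h]. *)
Lemma lsum_dgauss m c p K : 0 < m -> 0 < c -> exists2 C, 0 <= C &
  forall h th N, covers c h th N -> `|lsum m (dgauss m p) h th N| <= C * h ^+ K.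
Proof.
move=> m0 c0; elim: K p => [|K IH] p.
  have [C C0 HC] := lsum_bounded (dgauss m p) m0.
  by exists C => // h th N [h01 _ _]; rewrite expr0 mulr1; exact: HC.
have [C2 C20 HC2] := choice_bound IH.
have [D D0 HD] := gauss_edge p K.+1 m0 c0.
have [E E0 HE] := gauss_decay (iter K.+2 (dgauss m) p) 1 m0.
pose S := \sum_(k < K) C2 (iter k.+1 (dgauss m) p).
have S0 : 0 <= S by apply: sumr_ge0.
exists (2 * D + S + 9 * pi * E) => [|h th N cov].
  by rewrite !addr_ge0// !mulr_ge0// ltW// pi_gt0.
have [h01 _ _] := cov; have /andP[h0 h1] := h01.
have [ed1 ed2] := covers_edges c0 cov.
have := @lattice_taylor K.+1 (fun k => gauss m (iter k (dgauss m) p)) E E0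
  (is_derive_iter_gauss m p) _ h th N h01.
move=> /(_ (fun v => ltac:(have := HE v; rewrite expr1; exact))).
rewrite big_ord_recl /= expr0 (_ : 1`! = 1)%N// divr1 mul1r -/(lsum m (dgauss m p) h th N).
set T := \sum_(_ < _) _.
have HT : `|T| <= S * h ^+ K.+1.
  rewrite /S mulr_suml; apply: le_trans (ler_norm_sum _ _ _) _.
  apply: ler_sum => i _; rewrite -/(lsum m _ h th N) normrM /bump /= add1n.
  have := HC2 (iter i.+1 (dgauss m) p) h th N cov.
  rewrite -iterS => Hi.
  rewrite (exprS h K) mulrCA; apply: ler_pM => //.
  rewrite ger0_norm ?divr_ge0 ?exprn_ge0 ?(ltW h0)//.
  rewrite ler_pdivrMr ?ltr0n ?fact_gt0// exprS ler_wpM2l ?(ltW h0)//.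
  apply: le_trans (_ : 1 <= _); first by rewrite exprn_ile1// ltW.
  by rewrite ler1n fact_gt0.
have G1 := HD h _ h01 ed1; have G2 := HD h _ h01 ed2.
move: (lsum _ _ _ _ _) (gauss _ _ _) (gauss _ _ _) G1 G2 HT => L a b.
move: (h ^+ K.+1) => q.
rewrite !ler_norml; lra.
Qed.

Lemma gaussE1 m x : gauss m 1 x = expR (- (m / 2 * x ^+ 2)).
Proof. by rewrite /gauss hornerC mul1r. Qed.

Lemma gauss_antiderivative m : 0 < m ->
  exists Phi : R -> R, forall x : R, is_derive x 1 Phi (gauss m 1 x).
Proof.
move=> m0; pose mu := @lebesgue_measure R.
pose Phi0 (x : R) : R := (\int[mu]_(t in `]-oo, x]) (@gauss_fun R t))%R.
have Phi0d (x : R) : is_derive x 1 Phi0 (gauss_fun x).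
  have x1 : x < x + 1 by rewrite ltrDl.
  have xi : mu.-integrable `]-oo, (x + 1)] (EFin \o @gauss_fun R).
    exact: (integrableS measurableT _ (@subsetT _ _) (@integrableT_gauss R)).
  have [dP eP] := continuous_FTC1 x1 xi (ltNyr x) (@continuous_gauss_fun R x).
  by apply: (DeriveDef dP); rewrite -derive1E.
pose k := Num.sqrt (m / 2).
have k0 : 0 < k by rewrite sqrtr_gt0 divr_gt0.
exists (k^-1 *: (Phi0 \o (fun x => k * x))) => x.
rewrite gaussE1; have -> : m / 2 * x ^+ 2 = (k * x) ^+ 2.
  by rewrite exprMn sqr_sqrtr// divr_ge0// ltW.
apply: is_derive_eq; rewrite /GRing.scale /= mulr1 /gauss_fun.
by field; rewrite gt_eqF.
Qed.

Lemma antiderivative_tail m (Phi : R -> R) (y Y : R) : 0 < m ->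
  (forall x : R, is_derive x 1 Phi (gauss m 1 x)) -> 1 <= y <= Y ->
  Phi Y <= Phi y + m^-1 * gauss m 1 y.
Proof.
move=> m0 Pd /andP[y1 yY].
(* [H] decreases on [[1, oo)]: its derivative is [(1 - v) exp (- m v^2 / 2)]. *)
pose H := Phi + m^-1 *: gauss m 1.
have Hd (v : R) : is_derive v 1 H (gauss m 1 v + m^-1 *: gauss m (dgauss m 1) v).
  by apply: is_deriveD; apply: is_deriveZ; exact: is_derive_gauss.
have [c cy e] := MVT_le yY (fun v _ => Hd v).
have : H Y <= H y.
  rewrite -subr_le0 e mulr_le0_ge0 ?subr_ge0//.
  rewrite /gauss /dgauss !hornerE derivC !hornerE /GRing.scale /=.
  move: (expR _) (expR_ge0 (- (m / 2 * c * c))) => E E0.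
  have -> : E + m^-1 * (- (m * c * 1) * E) = (1 - c) * E by field; rewrite gt_eqF.
  by rewrite mulr_le0_ge0//; lra.
have HE v : H v = Phi v + m^-1 * gauss m 1 v by [].
rewrite !HE => /(le_trans _); apply.
by rewrite lerDl mulr_ge0 ?invr_ge0 ?(ltW m0)// gaussE1 expR_ge0.
Qed.

Lemma antiderivative_homo m (Phi : R -> R) : 
  (forall x : R, is_derive x 1 Phi (gauss m 1 x)) -> {homo Phi : x y / x <= y}.
Proof.
move=> Pd x y xy; have [c _ e] := MVT_le xy (fun v _ => Pd v).
by rewrite -subr_ge0 e mulr_ge0 ?subr_ge0// gaussE1 expR_ge0.
Qed.

Lemma antiderivative_lim m (Phi : R -> R) : 0 < m ->
  (forall x : R, is_derive x 1 Phi (gauss m 1 x)) ->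
  exists2 l, (forall y, Phi y <= l) &
    forall y, 1 <= y -> l <= Phi y + m^-1 * gauss m 1 y.
Proof.
move=> m0 Pd; pose A := [set z : R | exists2 y, 1 <= y & z = Phi y]%classic.
have supA : has_sup A.
  split; first by exists (Phi 1), 1.
  exists (Phi 1 + m^-1 * gauss m 1 1) => _ [y y1 ->].
  by apply: antiderivative_tail; rewrite ?lexx.
exists (sup A) => [y|y y1].
  apply: le_trans (antiderivative_homo Pd (_ : y <= Num.max 1 y)) _.
    by rewrite le_max lexx orbT.
  by apply: ub_le_sup; [exact: supA.2 | exists (Num.max 1 y) => //; rewrite le_max lexx].
apply: ge_sup => [|_ [z z1 ->]]; first exact: supA.1.
have [yz|/ltW zy] := leP y z; first by apply: antiderivative_tail; rewrite ?y1.
apply: le_trans (antiderivative_homo Pd zy) _.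
by rewrite lerDl mulr_ge0 ?invr_ge0 ?(ltW m0)// gaussE1 expR_ge0.
Qed.

Lemma gauss_mass m : 0 < m -> exists2 ga, 0 < ga & exists2 Phi : R -> R,
  (forall x : R, is_derive x 1 Phi (gauss m 1 x)) &
  forall y z, 1 <= - y -> 1 <= z ->
    `|Phi z - Phi y - ga| <= m^-1 * (gauss m 1 y + gauss m 1 z).
Proof.
move=> m0; have [Phi Pd] := gauss_antiderivative m0.
pose Psi := - (Phi \o -%R).
have Psid (x : R) : is_derive x 1 Psi (gauss m 1 x).
  apply: is_derive_eq; rewrite mulrN1 opprK !gaussE1; congr (expR (- (_ * _))).
  by rewrite sqrrN.
have PsiE v : Psi v = - Phi (- v) by [].
have [l lb lt] := antiderivative_lim m0 Pd.
have [l' lb' lt'] := antiderivative_lim m0 Psid.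
exists (l + l').
  have H1 := lb 1; have H2 := lb' 1.
  have [|c _] := @MVT_le R Phi (gauss m 1) (- 1) 1; first by lra.
  have := expR_gt0 (- (m / 2 * c ^+ 2)); rewrite -gaussE1 PsiE in H2 *; lra.
exists Phi => // y z y1 z1.
have := lb z; have := lb' (- y); have := lt z z1; have := lt' (- y) y1.
rewrite !PsiE opprK !gaussE1 sqrrN mulrDr => *.
by rewrite ler_norml; lra.
Qed.

(** [ga] is the integral of the Gaussian, [sqrt (2 pi / m)]. It stays abstract because its logarithm
    cancels between [t] and [2 t]. *)
Definition gauss_mass_spec m ga := 0 < ga /\
  forall c K, 0 < c -> exists2 C, 0 <= C & forall h th N, covers c h th N ->
    `|lsum m 1 h th N - ga| <= C * h ^+ K.

Lemma lsum_mass m : 0 < m -> exists ga, gauss_mass_spec m ga.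
Proof.
move=> m0; have [ga ga0 [Phi Pd HP]] := gauss_mass m0.
exists ga; split=> // c K c0.
(* With the primitive [Phi] in front of the derivatives, the first lattice sum in [lattice_taylor]
   is [lsum m 1] itself, and all others are sums of derivatives, hence negligible. *)
pose g k := if k is k'.+1 then gauss m (iter k' (dgauss m) 1) else Phi.
have gd k (v : R) : is_derive v 1 (g k) (g k.+1 v).
  by case: k => [|k]; [exact: Pd | exact: is_derive_gauss].
have [C C0 HC] := choice_bound (fun q => lsum_dgauss q K m0 c0).
have [D D0 HD] := gauss_edge 1 K.+1 m0 c0.
have [E E0 HE] := gauss_decay (iter K.+1 (dgauss m) 1) 1 m0.
have [B B0 HB] := lsum_bounded 1 m0.
pose S := \sum_(k < K) C (iter k (dgauss m) 1).
have S0 : 0 <= S by apply: sumr_ge0.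
exists (S + 9 * pi * E + 2 * m^-1 * D + (B + ga) / c ^+ K) => [|h th N cov].
  by nneg.
have [h01 _ _] := cov; have /andP[h0 h1] := h01.
have [ed1 ed2] := covers_edges c0 cov.
have hK0 : 0 <= h ^+ K by rewrite exprn_ge0// ltW.
(* For [c < h] the right-hand side is bounded below and the crude bound [B + ga] is enough;
   otherwise both ends of the lattice lie beyond -1 and 1, as [gauss_mass] requires. *)
have [ch|hc] := leP 1 (c / h); last first.
  have H1 : 1 <= h ^+ K / c ^+ K.
    rewrite -expr_div_n exprn_ege1// ler_pdivlMr// mul1r.
    by move: hc; rewrite ltr_pdivrMr// mul1r => /ltW.
  apply: le_trans (_ : B + ga <= _).
    by have := HB h th N h01; rewrite !ler_norml; lra.
  rewrite mulrDl ler_wpDl//.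
    by nneg.
  rewrite -mulrA ler_peMr ?addr_ge0// ?(ltW ga0)//.
  by rewrite mulrC.
have := @lattice_taylor K.+1 g E E0 gd HE h th N h01.
rewrite big_ord_recl /= expr0 (_ : 1`! = 1)%N// divr1 mul1r -/(lsum m 1 h th N).
set T := \sum_(_ < _) _.
have HT : `|T| <= S * h ^+ K.
  rewrite /S mulr_suml; apply: le_trans (ler_norm_sum _ _ _) _.
  apply: ler_sum => i _; rewrite -/(lsum m _ h th N) normrM /bump /= add1n.
  have Hi := HC (iter i (dgauss m) 1) h th N cov.
  rewrite -[X in _ <= X]mul1r; apply: ler_pM => //.
  rewrite ger0_norm ?divr_ge0 ?exprn_ge0 ?(ltW h0)//.
  rewrite ler_pdivrMr ?ltr0n ?fact_gt0// mul1r.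
  by apply: le_trans (exprn_ile1 _ (ltW h0) h1) _; rewrite ler1n fact_gt0.
have G1 := HD h _ h01 ed1; have G2 := HD h _ h01 ed2.
have [_ cov1 cov2] := cov.
have y1 : 1 <= - th by lra.
have z1 : 1 <= h * N%:R + th by lra.
have := HP th (h * N%:R + th) y1 z1.
have hK1 : h ^+ K.+1 <= h ^+ K by rewrite exprS ler_piMl.
have U1 : m^-1 * (gauss m 1 th + gauss m 1 (h * N%:R + th)) <= 2 * m^-1 * D * h ^+ K.
  have -> : 2 * m^-1 * D * h ^+ K = m^-1 * (D * h ^+ K + D * h ^+ K) by ring.
  rewrite ler_wpM2l ?invr_ge0 ?(ltW m0)// lerD//.
    by apply: le_trans (ler_norm _) (le_trans G1 _); rewrite ler_wpM2l.
  by apply: le_trans (ler_norm _) (le_trans G2 _); rewrite ler_wpM2l.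
have U2 : 9 * pi * E * h ^+ K.+1 <= 9 * pi * E * h ^+ K.
  by rewrite ler_wpM2l//; nneg.
have U3 : 0 <= (B + ga) / c ^+ K * h ^+ K.
  by nneg.
move: (lsum _ _ _ _ _) HT U1 U2 U3 => L.
rewrite !mulrDl !ler_norml; lra.
Qed.

(** The moments of the centred Gaussian of variance [v], by the recursion that integration by parts
    gives. *)
Fixpoint gmom (v : R) n : R :=
  match n with 0 => 1 | 1 => 0 | n'.+2 => n'.+1%:R * v * gmom v n' end.

Lemma lsumD m p q h th N : lsum m (p + q) h th N = lsum m p h th N + lsum m q h th N.
Proof.
rewrite /lsum -mulrDr -big_split; congr (_ * _); apply: eq_bigr => j _.
by rewrite /gauss hornerD mulrDl.
Qed.

Lemma lsumZ m a p h th N : lsum m (a *: p) h th N = a * lsum m p h th N.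
Proof.
rewrite [RHS]mulrCA mulr_sumr; congr (_ * _); apply: eq_bigr => j _.
by rewrite /gauss hornerZ; ring.
Qed.

(** Integration by parts on the lattice: [X^(n+2)] is [(n+1)/m X^n] minus [1/m] times
    [dgauss m X^(n+1)], and the sum of the latter is negligible. *)
Lemma lsum_pow m ga n c K : 0 < m -> gauss_mass_spec m ga -> 0 < c ->
  exists2 C, 0 <= C & forall h th N, covers c h th N ->
    `|lsum m 'X^n h th N - ga * gmom m^-1 n| <= C * h ^+ K.
Proof.
move=> m0 [ga0 Hga] c0; have mN0 : m != 0 by rewrite gt_eqF.
pose Q k := exists2 C, 0 <= C & forall h th N, covers c h th N ->
    `|lsum m 'X^k h th N - ga * gmom m^-1 k| <= C * h ^+ K.
suff : forall k, Q k /\ Q k.+1 by move=> /(_ n)[].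
elim=> [|{}n [IH1 IH2]]; split => //.
- by rewrite /Q expr0 /= mulr1; exact: Hga.
- have [C C0 HC] := lsum_dgauss 1 K m0 c0.
  exists (m^-1 * C) => [|h th N cov]; first by rewrite mulr_ge0// invr_ge0 ltW.
  have -> : 'X^1 = (- m^-1) *: dgauss m 1 :> {poly R}.
    by rewrite /dgauss derivC sub0r mulr1 scalerN scaleNr opprK scalerA mulVf// scale1r.
  rewrite lsumZ /= mulr0 subr0 mulNr normrN normrM gtr0_norm ?invr_gt0// -mulrA.
  by rewrite ler_wpM2l ?invr_ge0 ?(ltW m0)//; exact: HC.
have [C C0 HC] := IH1; have [D D0 HD] := lsum_dgauss 'X^(n.+1) K m0 c0.
exists (n.+1%:R * m^-1 * C + m^-1 * D) => [|h th N cov].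
  by rewrite addr_ge0// ?mulr_ge0 ?invr_ge0 ?(ltW m0).
have -> : 'X^(n.+2) = (n.+1%:R * m^-1) *: 'X^n + (- m^-1) *: dgauss m 'X^(n.+1) :> {poly R}.
  rewrite /dgauss derivXn /= -exprS scalerBr -['X^n *+ n.+1]scaler_nat !scalerA.
  by rewrite !mulNr mulVf// !scaleNr scale1r opprK (mulrC m^-1) addrA subrr add0r.
rewrite lsumD !lsumZ /=.
have -> : n.+1%:R * m^-1 * lsum m 'X^n h th N + - m^-1 * lsum m (dgauss m 'X^(n.+1)) h th N -
   ga * (n.+1%:R * m^-1 * gmom m^-1 n) =
   n.+1%:R * m^-1 * (lsum m 'X^n h th N - ga * gmom m^-1 n) -
   m^-1 * lsum m (dgauss m 'X^(n.+1)) h th N by ring.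
apply: le_trans (ler_normB _ _) _; rewrite [X in _ <= X]mulrDl !normrM.
rewrite (gtr0_norm (_ : 0 < m^-1)) ?invr_gt0// normr_nat lerD// -!mulrA.
  by rewrite !ler_wpM2l ?invr_ge0 ?(ltW m0)//; exact: HC.
by rewrite -normrM ler_wpM2l ?invr_ge0 ?(ltW m0)//; exact: HD.
Qed.

(* As [lsum_pow], when the lattice may fail to reach [-u/h] by the amount [y]. *)
Lemma lsum_pow_shift m ga n u K : 0 < m -> gauss_mass_spec m ga -> 0 < u ->
  exists2 C, 0 <= C & forall h th N y, 0 < h <= 1 -> 0 <= y ->
    th <= - (u / h) + y -> u / 2 / h <= h * N%:R + th ->
    `|lsum m 'X^n h th N - ga * gmom m^-1 n| <= C * h ^+ K * (1 + y ^+ 2) ^+ K.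
Proof.
move=> m0 gs u0; have u20 : 0 < u / 2 by lra.
have [C C0 HC] := lsum_pow n K m0 gs u20.
have [B B0 HB] := lsum_bounded 'X^n m0.
pose D := (B + `|ga * gmom m^-1 n|) * (2 / u) ^+ K.
have D0 : 0 <= D by rewrite /D; nneg.
exists (C + D) => [|h th N y h01 y0 thy hN]; first by nneg.
have /andP[h0 h1] := h01.
have y1 : 1 <= (1 + y ^+ 2) ^+ K by rewrite exprn_ege1// lerDl sqr_ge0.
have hK : 0 <= h ^+ K by nneg.
(* For [y <= u/(2h)] the lattice still covers [[-u/(2h), u/(2h)]]. For larger [y] one has
   [1 <= (2/u) h (1 + y^2)], and a trivial bound times the K-th power of this suffices. *)
have [yu|uy] := leP y (u / 2 / h).
  have cov : covers (u / 2) h th N.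
    split => //; apply: le_trans thy _.
    by have -> : u / h = u / 2 / h + u / 2 / h by [field; rewrite gt_eqF]; lra.
  apply: le_trans (HC _ _ _ cov) _; rewrite -[X in X <= _]mulr1 ler_pM//; first by nneg.
  by rewrite ler_wpM2r// lerDl.
apply: le_trans (_ : B + `|ga * gmom m^-1 n| <= _).
  by apply: le_trans (ler_normB _ _) _; rewrite lerD// HB.
rewrite !mulrDl; apply: ler_wpDl; first by nneg.
have H1 : 1 <= 2 / u * h * (1 + y ^+ 2).
  rewrite [leLHS](_ : 1 = 2 / u * (u / 2)); last by field; rewrite gt_eqF.
  rewrite -[2 / u * h * _]mulrA ler_wpM2l//; first by nneg.
  move: uy; rewrite ltr_pdivrMr// => /ltW/le_trans; apply.
  by rewrite mulrC ler_wpM2l ?(ltW h0)//; have := sqr_ge0 (y - 1); nra.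
rewrite /D -[X in X <= _]mulr1 -!mulrA ler_wpM2l//; first by nneg.
by rewrite -!exprMn exprn_ege1// mulrA.
Qed.

(* The moment [E ((X - ka Y)^i Y^j)] of independent centred Gaussians [X], [Y] of
   variances [ka], [v]; with [ka = m1^-1], [v = (m2 - m1^-1)^-1], the pair [(X - ka Y, Y)]
   has density proportional to [exp (- qform m1 m2 / 2)]. *)
Definition gmom2 (ka v : R) i j : R :=
  \sum_(k < i.+1) 'C(i, k)%:R * (- ka) ^+ k * gmom ka (i - k) * gmom v (j + k).

Definition qform m1 m2 (x y : R) := m1 * x ^+ 2 + 2 * x * y + m2 * y ^+ 2.

(** Distances to the saddle point in units of [h]: with [t = h^2], [t r = u + h rho] and
    [l t s = w + h sig]. *)
Definition rho (u h : R) (r : nat) : R := h * r%:R - u / h.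
Definition sig (l w h : R) (s : nat) : R := l * h * s%:R - w / h.

(** Completing the square, [qform m1 m2 x y = m1 z^2 + (m2 - 1/m1) y^2] with [z = x + y/m1], turns
    the inner sum over [r] into a one-dimensional sum over a lattice shifted by an amount depending
    on [s]. A large shift makes that lattice miss part of the Gaussian; the loss is polynomial in
    [y], and the Gaussian in [y] absorbs it, which is the purpose of [P]. *)
Lemma dsum_pow m1 m2 ga1 ga2 u w l i j K : 0 < m1 -> 0 < m2 - m1^-1 ->
  gauss_mass_spec m1 ga1 -> gauss_mass_spec (m2 - m1^-1) ga2 ->
  0 < u -> 0 < w -> 0 < l ->
  exists2 C, 0 <= C & forall h n, 0 < h <= 1 -> l * h <= 1 ->
    2 * u + w / m1 + 2 * w / l <= h ^+ 2 * n%:R ->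
    `|h * (l * h) * (\sum_(r < n) \sum_(s < n) rho u h r ^+ i * sig l w h s ^+ j *
        expR (- (2^-1 * qform m1 m2 (rho u h r) (sig l w h s))))
      - ga1 * ga2 * gmom2 m1^-1 (m2 - m1^-1)^-1 i j| <= C * h ^+ K.
Proof.
move=> m10 mu0 gs1 gs2 u0 w0 l0.
set ka := m1^-1; set mu := m2 - m1^-1; have ka0 : 0 < ka by rewrite invr_gt0.
have [A A0 HA] := choice_bound (fun n => lsum_pow_shift n K m10 gs1 u0).
have wl0 : 0 < w * l by rewrite mulr_gt0.
have [C C0 HC] := choice_bound (fun n => lsum_pow n K mu0 gs2 wl0).
have [D D0 HD] := choice_bound (fun p => lsum_abs_bounded p mu0).
pose P k : {poly R} := 'X^(j + k) * (1 + (ka *: 'X) ^+ 2) ^+ K.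
pose b k := `|'C(i, k)%:R * (- ka) ^+ k|.
exists (\sum_(k < i.+1) b k * (A (i - k)%N * D (P k) +
   `|ga1 * gmom ka (i - k)| * (C (j + k)%N * l ^+ K))) => [|h n h01 lh1 Bn].
  by apply: sumr_ge0 => k _; rewrite /b; nneg.
have /andP[h0 h1] := h01; have lh0 : 0 < l * h by rewrite mulr_gt0.
have lh01 : 0 < l * h <= 1 by rewrite lh0.
pose th s := - (u / h) + ka * sig l w h s.
have E1 : \sum_(r < n) \sum_(s < n) rho u h r ^+ i * sig l w h s ^+ j *
    expR (- (2^-1 * qform m1 m2 (rho u h r) (sig l w h s))) =
  \sum_(k < i.+1) 'C(i, k)%:R * (- ka) ^+ k * \sum_(s < n)
   gauss mu 'X^(j + k) (sig l w h s) * \sum_(r < n) gauss m1 'X^(i - k) (h * r%:R + th s).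
  rewrite exchange_big /=; under [RHS]eq_bigr do rewrite mulr_sumr.
  rewrite [RHS]exchange_big /=; apply: eq_bigr => s _.
  under [RHS]eq_bigr do rewrite mulr_sumr mulr_sumr.
  rewrite [RHS]exchange_big /=; apply: eq_bigr => r _.
  set x := rho u h r; set y := sig l w h s; set z := h * r%:R + th s.
  have xE : x = z - ka * y by rewrite /x /z /rho /th -/y; ring.
  have -> : 2^-1 * qform m1 m2 x y = m1 / 2 * z ^+ 2 + mu / 2 * y ^+ 2.
    by rewrite xE /qform /mu /ka; field; rewrite gt_eqF.
  rewrite opprD expRD [in LHS]xE exprDn mulr_suml mulr_suml.
  apply: eq_bigr => k _; rewrite /gauss !hornerXn -mulr_natl.
  by rewrite -mulNr exprMn exprD; ring.
rewrite E1 /gmom2 -/ka -/mu !mulr_sumr -sumrB mulr_suml.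
apply: le_trans (ler_norm_sum _ _ _) _; apply: ler_sum => k _.
set L := fun s => lsum m1 'X^(i - k) h (th s) n.
set gm1 := gmom ka (i - k); set gm2 := gmom mu^-1 (j + k).
have -> : h * (l * h) * ('C(i, k)%:R * (- ka) ^+ k * \sum_(s < n)
    gauss mu 'X^(j + k) (sig l w h s) * \sum_(r < n) gauss m1 'X^(i - k) (h * r%:R + th s))
  - ga1 * ga2 * ('C(i, k)%:R * (- ka) ^+ k * gm1 * gm2) =
  'C(i, k)%:R * (- ka) ^+ k * (l * h * (\sum_(s < n)
     gauss mu 'X^(j + k) (sig l w h s) * (L s - ga1 * gm1)) +
    ga1 * gm1 * (lsum mu 'X^(j + k) (l * h) (- (w / h)) n - ga2 * gm2)).
  under [\sum_(s < n) _ * (L s - _)]eq_bigr do rewrite mulrBr.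
  rewrite sumrB -mulr_suml /lsum -/(sig l w h).
  have -> : \sum_(s < n) gauss mu 'X^(j + k) (sig l w h s) * L s =
    h * \sum_(s < n) gauss mu 'X^(j + k) (sig l w h s) *
      \sum_(r < n) gauss m1 'X^(i - k) (h * r%:R + th s).
    by rewrite mulr_sumr; apply: eq_bigr => s _; rewrite /L /lsum; ring.
  by rewrite /sig; ring.
rewrite normrM -/(b k) -[b k * _ * _]mulrA ler_wpM2l ?normr_ge0//.
apply: le_trans (ler_normD _ _) _; rewrite mulrDl; apply: lerD; last first.
  rewrite normrM -mulrA ler_wpM2l//.
  have cov : covers (w * l) (l * h) (- (w / h)) n.
    have wlE : w * l / (l * h) = w / h by field; rewrite !gt_eqF.
    split => //; rewrite wlE// -subr_ge0.
    have -> : l * h * n%:R - w / h - w / h = l / h * (h ^+ 2 * n%:R - 2 * w / l).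
      by field; rewrite !gt_eqF.
    rewrite mulr_ge0 ?divr_ge0 ?(ltW l0) ?(ltW h0)// subr_ge0.
    by apply: le_trans Bn; rewrite lerDr; nneg.
  by rewrite (le_trans (HC _ _ _ _ cov))// exprMn mulrA.
rewrite normrM (gtr0_norm lh0).
apply: le_trans (_ : A (i - k)%N * h ^+ K * (l * h * \sum_(s < n)
    `|gauss mu (P k) (l * h * s%:R - w / h)|) <= _); last first.
  by rewrite mulrAC ler_wpM2r ?ler_wpM2l ?HD//; nneg.
rewrite mulrCA ler_wpM2l ?(ltW lh0)// mulr_sumr.
apply: le_trans (ler_norm_sum _ _ _) _; apply: ler_sum => s _.
have -> : gauss mu (P k) (l * h * s%:R - w / h) =
   gauss mu 'X^(j + k) (sig l w h s) * (1 + (ka * sig l w h s) ^+ 2) ^+ K.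
  by rewrite /gauss /P /sig !hornerE; ring.
move: (gauss mu _ _) => G; rewrite !normrM mulrCA ler_wpM2l//.
rewrite [`|_ ^+ K|]ger0_norm; last by nneg.
rewrite -[X in _ * (1 + X) ^+ K](real_normK (num_real _)).
apply: HA => //.
  by rewrite /th lerD2l ler_norm.
rewrite /th /sig -subr_ge0.
have -> : h * n%:R + (- (u / h) + ka * (l * h * s%:R - w / h)) - u / 2 / h =
   h^-1 * (h ^+ 2 * n%:R - (2 * u + w / m1 + 2 * w / l)) + ka * l * h * s%:R +
   h^-1 * (u / 2 + 2 * w / l) by rewrite /ka; field; rewrite !gt_eqF.
rewrite addr_ge0 ?addr_ge0//; [|by nneg|by nneg].
by rewrite mulr_ge0 ?invr_ge0 ?(ltW h0)// subr_ge0.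
Qed.
End LatticeSums.

(** * Euler-Maclaurin expansion of q-factorials *)

Section EulerMaclaurin.
Variable R : realType.
Implicit Types (x h l r M : R).

(** The weights 1/2 and 1/12 make the Taylor expansions at [x] cancel through order [h^3]; two
    corrections reach that far because the next Bernoulli number is 0. The error is a combination of
    three Taylor remainders. *)
Lemma euler_maclaurin_step (g : nat -> R -> R) l r M x h : 0 < h ->
  (forall k (v : R), l <= v <= r -> is_derive v 1 (g k) (g k.+1 v)) ->
  (forall v, l <= v <= r -> `|g 5 v| <= M) ->
  l <= x <= r -> l <= x + h <= r ->
  `|g 1 (x + h) - ((g 0 (x + h) - g 0 x) / h + (g 1 (x + h) - g 1 x) / 2
      + h / 12 * (g 2 (x + h) - g 2 x))| <= 2 * M * h ^+ 4.
Proof.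
move=> h0 gd gM xlr xhlr.
have T0 := taylor_bound (fun k v _ => gd k v) gM xlr xhlr.
have T1 := @taylor_bound R 4 (fun k => g k.+1) l r M x h (fun k v _ => gd k.+1 v) gM xlr xhlr.
have T2 := @taylor_bound R 3 (fun k => g k.+2) l r M x h (fun k v _ => gd k.+2 v) gM xlr xhlr.
move: T0 T1 T2; rewrite !big_ord_recl !big_ord0 /= /bump /= !add1n (gtr0_norm h0).
rewrite (_ : 0`! = 1)%N// (_ : 1`! = 1)%N// (_ : 2`! = 2)%N// (_ : 3`! = 6)%N// (_ : 4`! = 24)%N//.
rewrite !expr0 !expr1 !addr0.
have hN : h != 0 by rewrite gt_eqF.
set e0 := (X in `|X| <= _); set e1 := (X in _ -> `|X| <= _ -> _).
set e2 := (X in _ -> _ -> `|X| <= _ -> _) => T0 T1 T2.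
rewrite [X in `|X| <= _](_ : _ = 2^-1 * e1 - h^-1 * e0 - h / 12 * e2); last first.
  by rewrite /e0 /e1 /e2; field.
have h40 : 0 <= M * h ^+ 4.
  by rewrite mulr_ge0// ?exprn_ge0// ?(ltW h0)// (le_trans (normr_ge0 _) (gM x xlr)).
apply: le_trans (ler_normB _ _) _; apply: le_trans (lerD (ler_normB _ _) (lexx _)) _.
rewrite !normrM (@ger0_norm _ 2^-1)// (@ger0_norm _ h^-1) ?invr_ge0 ?(ltW h0)//.
rewrite (@ger0_norm _ h) ?(ltW h0)// (@ger0_norm _ 12^-1)//.
have U0 : h^-1 * `|e0| <= M * h ^+ 4 by rewrite mulrC ler_pdivrMr// -mulrA -exprSr.
have U2 : h / 12 * `|e2| <= 12^-1 * (M * h ^+ 4).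
  have -> : 12^-1 * (M * h ^+ 4) = h / 12 * (M * h ^+ 3) by ring.
  by rewrite ler_wpM2l// divr_ge0// ltW.
by lra.
Qed.

Lemma euler_maclaurin_sum (g : nat -> R -> R) l r M x h n : 0 < h ->
  (forall k (v : R), l <= v <= r -> is_derive v 1 (g k) (g k.+1 v)) ->
  (forall v, l <= v <= r -> `|g 5 v| <= M) ->
  l <= x -> x + n%:R * h <= r ->
  `|\sum_(j < n) g 1 (x + j.+1%:R * h) - ((g 0 (x + n%:R * h) - g 0 x) / h +
      (g 1 (x + n%:R * h) - g 1 x) / 2 + h / 12 * (g 2 (x + n%:R * h) - g 2 x))|
    <= n%:R * (2 * M * h ^+ 4).
Proof.
move=> h0 gd gM lx; elim: n => [_|n IH xr].
  by rewrite big_ord0 !mul0r !addr0 !subrr !mul0r mulr0 !addr0 subr0 normr0.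
have e : x + n.+1%:R * h = x + n%:R * h + h by rewrite -natr1; ring.
have nh : 0 <= n%:R * h by nneg.
have IHn := IH (ltac:(lra)).
rewrite big_ord_recr /= e.
have S := @euler_maclaurin_step g l r M (x + n%:R * h) h h0 gd gM (ltac:(lra)) (ltac:(lra)).
move: IHn S; set a := \sum_(_ < _) _ => IHn S.
rewrite -[n.+1%:R]natr1 [leRHS]mulrDl mul1r; apply: le_trans (lerD IHn S).
apply: le_trans (ler_normD _ _); apply/eqW; congr `|_|; ring.
Qed.

Lemma antiderivative_gt (f : R -> R) (a : R) :
  (forall x : R, a <= x -> {for x, continuous f}) ->
  exists F : R -> R, forall x : R, a < x -> is_derive x 1 F (f x).
Proof.
move=> fc; pose mu := @lebesgue_measure R.
exists (fun x : R => (\int[mu]_(t in `[a, x]) f t)%R) => x ax.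
have x1 : x < x + 1 by rewrite ltrDl.
have xi : mu.-integrable `[a, (x + 1)] (EFin \o f).
  apply: continuous_compact_integrable; first exact: segment_compact.
  apply: continuous_in_subspaceT => y; rewrite inE /= in_itv /= => /andP[ay _].
  exact: fc.
have [dP eP] := continuous_FTC1_closed x1 xi ax (fc x (ltW ax)).
by apply: (DeriveDef dP); rewrite -derive1E.
Qed.

(* [lnq s v = ln (1 - s e^(-v))], with [s = 1] for the factors of [(q; q)_r] and
   [s = -1] for those of [(-q; q)_r]. *)
Definition lnq (s v : R) := ln (1 - s * expR (- v)).
Definition dlnq (s v : R) := s * expR (- v) / (1 - s * expR (- v)).

(** [A = dlnq s] satisfies [A' = - (A + A^2)], so each of its derivatives is a polynomial in [A],
    the same for both signs of [s]. *)
Fixpoint dlnq_poly n : {poly R} :=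
  if n is n'.+1 then - (('X + 'X^2) * (dlnq_poly n')^`()) else 'X.

Definition lnq_fam (s : R) (D : R -> R) (k : nat) : R -> R :=
  match k with
  | 0 => D | 1 => lnq s | k'.+2 => fun v => (dlnq_poly k').[dlnq s v]
  end.

Lemma is_derive_lnq s (v : R) : 0 < 1 - s * expR (- v) ->
  is_derive v 1 (lnq s) (dlnq s v).
Proof.
move=> p0; have H := is_derive1_ln p0.
have K : is_derive v 1 (fun v : R => 1 - s * expR (- v)) (s * expR (- v)).
  apply: is_derive_eq; rewrite /GRing.scale /=; ring.
have := @is_derive1_comp R (@ln R) (fun v : R => 1 - s * expR (- v)) v _ _ H K.
by rewrite mulrC.
Qed.

Lemma is_derive_dlnq s (v : R) : 0 < 1 - s * expR (- v) ->
  is_derive v 1 (dlnq s) (- (dlnq s v + dlnq s v ^+ 2)).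
Proof.
move=> p0; have pN : 1 - s * expR (- v) != 0 by rewrite gt_eqF.
rewrite /dlnq; apply: is_derive_eq; rewrite /GRing.scale /=.
by field.
Qed.

Lemma is_derive_horner_comp (p : {poly R}) (f : R -> R) (v d : R) :
  is_derive v 1 f d -> is_derive v 1 (fun w => p.[f w]) (p^`().[f v] * d).
Proof.
move=> fd; have := @is_derive1_comp R (horner p) f v _ d (is_derive_poly p (f v)) fd.
by [].
Qed.

Lemma is_derive_lnq_fam s D k (v : R) : 0 < 1 - s * expR (- v) ->
  is_derive v 1 D (lnq s v) -> is_derive v 1 (lnq_fam s D k) (lnq_fam s D k.+1 v).
Proof.
move=> p0 Dd; case: k => [|[|k]]; first exact: Dd.
  by rewrite /lnq_fam /dlnq_poly hornerX; exact: is_derive_lnq.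
have H := is_derive_horner_comp (dlnq_poly k) (is_derive_dlnq p0).
rewrite /lnq_fam -/lnq_fam.
have -> : (dlnq_poly k.+1).[dlnq s v] =
    (dlnq_poly k)^`().[dlnq s v] * - (dlnq s v + dlnq s v ^+ 2).
  by rewrite /= hornerN hornerM hornerD hornerX hornerXn; ring.
exact: H.
Qed.

Lemma lnq_arg_gt0 (v : R) : 0 < v -> 0 < 1 - 1 * expR (- v).
Proof. by move=> v0; rewrite mul1r subr_gt0 expR_lt1; lra. Qed.

Lemma lnqN_arg_gt0 (v : R) : 0 < 1 - (-1) * expR (- v).
Proof. by have := expR_gt0 (- v); lra. Qed.

Lemma horner_bounded (p : {poly R}) B : 0 <= B ->
  exists2 M, 0 <= M & forall y, `|y| <= B -> `|p.[y]| <= M.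
Proof.
move=> B0; have [C C0 HC] := horner_norm_le p.
exists (C * (1 + B ^+ 2) ^+ size p) => [|y yB]; first by nneg.
apply: le_trans (HC y) _; rewrite ler_wpM2l// lerXn2r ?nnegrE; [|by nneg|by nneg|].
  by [].
by rewrite lerD2l -(real_normK (num_real y)) lerXn2r ?nnegrE.
Qed.

Lemma dlnq1_bounded l : 0 < l ->
  exists2 B, 0 <= B & forall v, l <= v -> `|dlnq 1 v| <= B.
Proof.
move=> l0; have el : 0 < 1 - expR (- l) by rewrite subr_gt0 expR_lt1; lra.
exists (1 - expR (- l))^-1 => [|v lv]; first by rewrite invr_ge0 ltW.
have ev : expR (- v) <= expR (- l) by rewrite ler_expR lerN2.
rewrite /dlnq mul1r normrM gtr0_norm ?expR_gt0// normfV.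
rewrite gtr0_norm; last by lra.
rewrite -[leRHS]mul1r ler_pM ?invr_ge0 ?expR_ge0//; first by lra.
  by rewrite -expR0 ler_expR; lra.
by rewrite lef_pV2 ?posrE; lra.
Qed.

Lemma dlnqN1_bounded (v : R) : `|dlnq (-1) v| <= 1.
Proof.
have e0 := expR_gt0 (- v).
rewrite /dlnq normrM normfV !mulN1r opprK normrN !gtr0_norm; [|lra|lra].
by rewrite ler_pdivrMr; lra.
Qed.

Definition ln_qpoch (t : R) (n : nat) : R := \sum_(j < n) lnq 1 (t * j.+1%:R).

Definition euler_maclaurin_main (D : R -> R) (t v : R) : R :=
  D v / t + lnq 1 v / 2 + t / 12 * dlnq 1 v.

Lemma ln_qpochD t n k :
  ln_qpoch t (n + k) = ln_qpoch t n + \sum_(j < k) lnq 1 (t * (n + j).+1%:R).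
Proof. by rewrite /ln_qpoch big_split_ord. Qed.

Lemma ln_qpoch_increment (D : R -> R) l r : 0 < l ->
  (forall v : R, l <= v -> is_derive v 1 D (lnq 1 v)) ->
  exists2 C, 0 <= C & forall t n m, 0 < t -> l <= n%:R * t -> (n <= m)%N ->
    m%:R * t <= r ->
    `|ln_qpoch t m - ln_qpoch t n - (euler_maclaurin_main D t (m%:R * t) - euler_maclaurin_main D t (n%:R * t))| <= C * t ^+ 3.
Proof.
move=> l0 Dd; have [B B0 HB] := dlnq1_bounded l0.
have [M M0 HM] := horner_bounded (dlnq_poly 3) B0.
exists (2 * `|r| * M) => [|t n m t0 ln nm mr]; first by nneg.
have gd k (v : R) : l <= v <= r -> is_derive v 1 (lnq_fam 1 D k) (lnq_fam 1 D k.+1 v).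
  move=> /andP[lv _]; apply: is_derive_lnq_fam; last exact: Dd.
  by apply: lnq_arg_gt0; lra.
have gM v : l <= v <= r -> `|lnq_fam 1 D 5 v| <= M.
  by move=> /andP[lv _]; apply: HM; exact: HB.
have mE : m%:R * t = n%:R * t + (m - n)%:R * t by rewrite -mulrDl -natrD subnKC.
have := @euler_maclaurin_sum (lnq_fam 1 D) l r M (n%:R * t) t (m - n) t0 gd gM ln.
rewrite -mE => /(_ mr) H.
have -> : ln_qpoch t m - ln_qpoch t n = \sum_(j < m - n) lnq_fam 1 D 1 (n%:R * t + j.+1%:R * t).
  rewrite -{1}(subnKC nm) ln_qpochD addrAC subrr add0r.
  by apply: eq_bigr => j _; rewrite -addnS natrD; congr (lnq _ _); ring.
have -> : euler_maclaurin_main D t (m%:R * t) - euler_maclaurin_main D t (n%:R * t) =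
  ((lnq_fam 1 D 0 (m%:R * t) - lnq_fam 1 D 0 (n%:R * t)) / t +
      (lnq_fam 1 D 1 (m%:R * t) - lnq_fam 1 D 1 (n%:R * t)) / 2 +
      t / 12 * (lnq_fam 1 D 2 (m%:R * t) - lnq_fam 1 D 2 (n%:R * t))).
  by rewrite /euler_maclaurin_main /= !hornerX; ring.
apply: le_trans H _.
have -> : (m - n)%:R * (2 * M * t ^+ 4) = 2 * ((m - n)%:R * t) * M * t ^+ 3 by ring.
rewrite !ler_wpM2r// ?exprn_ge0 ?(ltW t0)// ler_wpM2l//.
have := ler_norm r; have : 0 <= n%:R * t by nneg.
by lra.
Qed.

Lemma lnq_double (v : R) : 0 < v -> lnq 1 (2 * v) = lnq 1 v + lnq (-1) v.
Proof.
move=> v0; rewrite /lnq -lnM ?posrE ?lnq_arg_gt0 ?lnqN_arg_gt0//.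
congr ln; have -> : - (2 * v) = - v + - v by ring.
by rewrite expRD; ring.
Qed.

Lemma dlnq_double (v : R) : 0 < v -> 2 * dlnq 1 (2 * v) = dlnq 1 v + dlnq (-1) v.
Proof.
move=> v0; have p1 := lnq_arg_gt0 v0; have p2 := lnqN_arg_gt0 v.
rewrite /dlnq; have -> : - (2 * v) = - v + - v by ring.
have p3 : 0 < 1 - 1 * (expR (- v) * expR (- v)) by nra.
by rewrite expRD; field; rewrite !gt_eqF//; move: p1 p2 p3; rewrite ?mul1r ?mulN1r ?opprK.
Qed.

Lemma is_derive_scale2 (D : R -> R) (v d : R) :
  is_derive (2 * v) 1 D d -> is_derive v 1 (fun w => D (2 * w)) (2 * d).
Proof.
move=> Dd; have K : is_derive v 1 (fun w : R => 2 * w) 2.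
  by apply: is_derive_eq; rewrite /GRing.scale /= mulr1 ?addr0.
by have := @is_derive1_comp R D (fun w => 2 * w) v _ _ Dd K; rewrite mulrC.
Qed.

Lemma is_derive0_cst (H : R -> R) a : (forall v : R, a < v -> is_derive v 1 H 0) ->
  forall x y, a < x -> a < y -> H x = H y.
Proof.
move=> Hd x y; wlog xy : x y / x <= y.
  by move=> W ax ay; case: (leP x y) => [|/ltW] xy; [|symmetry]; apply: W.
move=> ax ay; have [|c _] := @MVT_le R H (fun=> 0) x y xy.
  by move=> v vxy; apply: Hd; lra.
by rewrite mul0r => /eqP; rewrite subr_eq0 => /eqP.
Qed.

(** For [s = -1] the summand is smooth at 0, so the summation can start there and no unknown
    remainder appears. The terms with [ln 2] and [2^-1] are the contributions of the end point 0. *)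
Lemma sum_lnqN1 r : 0 <= r -> exists (I : R -> R),
  (forall v : R, -1 < v -> is_derive v 1 I (lnq (-1) v)) /\
  exists2 C, 0 <= C & forall t n, 0 < t -> n%:R * t <= r ->
    `|\sum_(j < n) lnq (-1) (t * j.+1%:R) - ((I (n%:R * t) - I 0) / t +
      (lnq (-1) (n%:R * t) - ln 2) / 2 + t / 12 * (dlnq (-1) (n%:R * t) + 2^-1))|
    <= C * t ^+ 3.
Proof.
move=> r0; have [|I Id] := @antiderivative_gt (lnq (-1)) (- 1).
  by move=> x _; apply: is_derive_continuous (is_derive_lnq (lnqN_arg_gt0 x)).
exists I; split=> //.
have [M M0 HM] := horner_bounded (dlnq_poly 3) (ler01).
exists (2 * r * M) => [|t n t0 nr]; first by nneg.
have gd k (v : R) : 0 <= v <= r -> is_derive v 1 (lnq_fam (-1) I k) (lnq_fam (-1) I k.+1 v).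
  move=> /andP[lv _]; apply: is_derive_lnq_fam; last by apply: Id; lra.
  exact: lnqN_arg_gt0.
have gM v : 0 <= v <= r -> `|lnq_fam (-1) I 5 v| <= M.
  by move=> _; apply: HM; exact: dlnqN1_bounded.
have := @euler_maclaurin_sum (lnq_fam (-1) I) 0 r M 0 t n t0 gd gM (lexx 0).
rewrite add0r => /(_ nr) H.
have -> : \sum_(j < n) lnq (-1) (t * j.+1%:R) =
    \sum_(j < n) lnq_fam (-1) I 1 (0 + j.+1%:R * t).
  by apply: eq_bigr => j _; rewrite add0r mulrC.
have -> : (I (n%:R * t) - I 0) / t + (lnq (-1) (n%:R * t) - ln 2) / 2 +
   t / 12 * (dlnq (-1) (n%:R * t) + 2^-1) =
  ((lnq_fam (-1) I 0 (n%:R * t) - lnq_fam (-1) I 0 0) / t +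
      (lnq_fam (-1) I 1 (n%:R * t) - lnq_fam (-1) I 1 0) / 2 +
      t / 12 * (lnq_fam (-1) I 2 (n%:R * t) - lnq_fam (-1) I 2 0)).
  rewrite /= !hornerX [lnq (-1) 0]/lnq [dlnq (-1) 0]/dlnq oppr0 expR0.
  have -> : 1 - -1 * 1 = 2 :> R by ring.
  by rewrite mulN1r mulNr mul1r opprK.
apply: le_trans H _.
have -> : n%:R * (2 * M * t ^+ 4) = 2 * (n%:R * t) * M * t ^+ 3 by ring.
by rewrite !ler_wpM2r// ?exprn_ge0 ?(ltW t0)// ler_wpM2l.
Qed.

Lemma truncn_mul_itv r t : 0 < t -> t <= r ->
  r - t <= (Num.truncn (r / t))%:R * t <= r.
Proof.
move=> t0 tr; have /truncn_itv/andP[H1 H2] : 0 <= r / t by rewrite divr_ge0; lra.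
move: H1 H2; rewrite ler_pdivlMr// ltr_pdivrMr// -natr1 mulrDl mul1r => H1 H2.
by rewrite H1 andbT; lra.
Qed.

(** [E t] is what Euler-Maclaurin leaves undetermined because of the singularity at 0; it is defined
    by evaluation at one index near [r/t]. Its increment from [t] to [2 t] follows from
    [(q^2; q^2)_n = (q; q)_n (-q; q)_n], where all factors but the last are expressed through [E]
    and the last has a full expansion. *)
Lemma ln_qpoch_asymptotics l r : 0 < l -> 4 * l <= r -> exists (D E : R -> R) (k C : R),
  [/\ 0 <= C, forall v : R, l <= v -> is_derive v 1 D (lnq 1 v),
      forall t n, 0 < t -> t <= r / 2 -> l <= n%:R * t <= r ->
        `|ln_qpoch t n - euler_maclaurin_main D t (n%:R * t) - E t| <= C * t ^+ 3 &
      forall t, 0 < t -> t <= r / 4 ->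
        `|E (2 * t) - E t - (k / t - ln 2 / 2 + t / 24)| <= C * t ^+ 3].
Proof.
move=> l0 lr; have [|D Dd'] := @antiderivative_gt (lnq 1) (l / 2).
  move=> x lx; apply: is_derive_continuous (is_derive_lnq (lnq_arg_gt0 _)); lra.
have Dd (v : R) : l <= v -> is_derive v 1 D (lnq 1 v) by move=> ?; apply: Dd'; lra.
have [C1 C10 HC1] := ln_qpoch_increment r l0 Dd.
have r0 : 0 <= r by lra.
have [I [Id [C2 C20 HC2]]] := sum_lnqN1 r0.
pose n0 t := Num.truncn (r / t).
pose E t := ln_qpoch t (n0 t) - euler_maclaurin_main D t ((n0 t)%:R * t).
have HE t n : 0 < t -> t <= r / 2 -> l <= n%:R * t <= r ->
    `|ln_qpoch t n - euler_maclaurin_main D t (n%:R * t) - E t| <= C1 * t ^+ 3.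
  move=> t0 tr /andP[ln nr].
  have /andP[H1 H2] : r - t <= (n0 t)%:R * t <= r by apply: truncn_mul_itv => //; lra.
  have nn : (n <= n0 t)%N by rewrite truncn_ge_nat ?divr_ge0 ?(ltW t0)// ler_pdivlMr.
  have := HC1 t n (n0 t) t0 ln nn H2; rewrite distrC => /(le_trans _); apply.
  by apply/eqW; congr `|_|; rewrite /E; ring.
(* The coefficient of [1/t] in the comparison, as a function of the end point. By
   [lnq 1 (2 v) = lnq 1 v + lnq (-1) v] its derivative vanishes, so [k] is a constant. *)
pose H v := I v - D (2 * v) / 2 + D v.
have Hd (v : R) : l / 2 < v -> is_derive v 1 H 0.
  move=> lv; have D2 : is_derive (2 * v) 1 D (lnq 1 (2 * v)) by apply: Dd'; lra.
  have := is_derive_scale2 D2 => D2'.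
  have Iv : is_derive v 1 I (lnq (-1) v) by apply: Id; lra.
  have Dv := Dd' v lv.
  rewrite (_ : H = I - 2^-1 *: (fun w => D (2 * w)) + D); last first.
    by apply/funext => w; rewrite /H !fctE /GRing.scale /= (mulrC 2^-1).
  apply: is_derive_eq; rewrite lnq_double; last by lra.
  by rewrite /GRing.scale /=; field.
have Hc := is_derive0_cst Hd.
exists D, E, (H l - I 0), (4 * C1 + 8 * C1 + 4 * C2 + C2); split => //.
- by nneg.
- move=> t n t0 tr nr; apply: le_trans (HE t n t0 tr nr) _.
  by rewrite ler_wpM2r ?exprn_ge0 ?(ltW t0)//; lra.
(* With [n t] close to [r/2], both [n t] and [2 n t] lie in [[l, r]], so the expansion is available
   for [t] and for [2 t] at the same [n]. *)
move=> t t0 tr; pose n := Num.truncn (r / 2 / t); pose U := n%:R * t.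
have /andP[U1 U2] : r / 2 - t <= U <= r / 2 by apply: truncn_mul_itv; lra.
have lU : l <= U by lra.
have A1 := HE t n t0 (ltac:(lra)) (ltac:(rewrite -/U; lra)).
have t20 : 0 < 2 * t by lra.
have nU : n%:R * (2 * t) = 2 * U by rewrite /U; ring.
have A2 := HE (2 * t) n t20 (ltac:(lra)) (ltac:(rewrite nU; lra)).
have A3 := HC2 t n t0 (ltac:(rewrite -/U; lra)).
rewrite nU in A2; rewrite -/U in A1 A3.
have U0 : 0 < U by lra.
have S1 : ln_qpoch (2 * t) n = ln_qpoch t n + \sum_(j < n) lnq (-1) (t * j.+1%:R).
  rewrite /ln_qpoch -big_split /=; apply: eq_bigr => j _.
  by rewrite -mulrA lnq_double// mulr_gt0// ltr0n.
have HU : H l = H U by apply: Hc; lra.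
have dE := dlnq_double U0; have lE := lnq_double U0.
have -> : E (2 * t) - E t - ((H l - I 0) / t - ln 2 / 2 + t / 24) =
  (ln_qpoch t n - euler_maclaurin_main D t U - E t) - (ln_qpoch (2 * t) n - euler_maclaurin_main D (2 * t) (2 * U) - E (2 * t))
  + (\sum_(j < n) lnq (-1) (t * j.+1%:R) - ((I U - I 0) / t +
      (lnq (-1) U - ln 2) / 2 + t / 12 * (dlnq (-1) U + 2^-1))).
  rewrite S1 HU /H /euler_maclaurin_main lE.
  have -> : dlnq 1 (2 * U) = (dlnq 1 U + dlnq (-1) U) / 2 by rewrite -dE; field.
  by field; rewrite gt_eqF.
have e8 : (2 * t) ^+ 3 = 8 * t ^+ 3 by ring.
have t3 : 0 <= t ^+ 3 by rewrite exprn_ge0// ltW.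
rewrite e8 in A2.
apply: le_trans (ler_normD _ _) _; apply: le_trans (lerD (ler_normB _ _) (lexx _)) _.
move: A1 A2 A3; move: (t ^+ 3) t3 => q q0.
have := mulr_ge0 C10 q0; have := mulr_ge0 C20 q0; lra.
Qed.
End EulerMaclaurin.

(** * Gaussian moments of polynomials *)

(* The same formulas are used over the reals, over the cubic field (exactly) and modulo
   11; [rops] collects the operations they need. *)
Record rops (T : Type) := ROps { oadd : T -> T -> T; omul : T -> T -> T;
  oopp : T -> T; onat : nat -> T; oinv : nat -> T }.

Section BivariatePolynomials.
Variables (T : Type) (o : rops T).
Local Notation "x +' y" := (oadd o x y) (at level 50, left associativity).
Local Notation "x *' y" := (omul o x y) (at level 40, left associativity).

(* [(c, (i, j))] stands for the monomial [c x^i y^j]. *)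
Definition bpoly := seq (T * (nat * nat)).

Definition opow (x : T) n := iter n (omul o x) (onat o 1).

Definition bmul (p q : bpoly) : bpoly :=
  flatten [seq [seq (m.1 *' n.1, (m.2.1 + n.2.1, m.2.2 + n.2.2)%N) | n <- q] | m <- p].

Definition bscale c (p : bpoly) : bpoly := [seq (c *' m.1, m.2) | m <- p].

Fixpoint ogmom (v : T) n : T :=
  match n with
  | 0 => onat o 1 | 1 => onat o 0 | n'.+2 => onat o n'.+1 *' v *' ogmom v n'
  end.

Definition osum (s : seq T) : T := foldr (oadd o) (onat o 0) s.

Definition ogmom2 (ka v : T) i j : T :=
  osum [seq onat o 'C(i, k) *' opow (oopp o ka) k *' ogmom ka (i - k) *' ogmom v (j + k)
       | k <- iota 0 i.+1].

Definition bgauss (ka v : T) (p : bpoly) : T :=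
  osum [seq m.1 *' ogmom2 ka v m.2.1 m.2.2 | m <- p].

(* For [A = 1/(e^v - 1)], the derivatives [D^(k) v], [2 <= k <= 6], where
   [D' v = ln (1 - e^(-v))]. *)
Definition dcoef (A : T) (k : nat) : T :=
  match k with
  | 2 => A
  | 3 => oopp o (A +' opow A 2)
  | 4 => A +' onat o 3 *' opow A 2 +' onat o 2 *' opow A 3
  | 5 => oopp o (A +' onat o 7 *' opow A 2 +' onat o 12 *' opow A 3 +'
                 onat o 6 *' opow A 4)
  | 6 => A +' onat o 15 *' opow A 2 +' onat o 50 *' opow A 3 +'
         onat o 60 *' opow A 4 +' onat o 24 *' opow A 5
  | _ => onat o 0
  end.

(* The coefficient of [h^j] in [- ln (q; q)_n], [q = e^(- l h^2)], at
   [l h^2 n = v + h x]: monomials [(c, i)] in [x]. *)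
Definition theta (A : T) (l j : nat) : seq (T * nat) :=
  [:: (oopp o (dcoef A j.+2 *' oinv o (l * j.+2`!)), j.+2);
      (oopp o (dcoef A j.+1 *' oinv o (2 * j`!)), j)] ++
  (if (1 < j)%N then [:: (oopp o (dcoef A j *' (onat o l *' oinv o (12 * (j - 2)`!))), (j - 2)%N)]
   else [::]).

(** The coefficient of [h^j] in the logarithm of the summand around the saddle point. The parameters
    occur for [j = 1] alone, since [t (a r + b s) = a u + b w / 31 + h (a x + b / 31 y)]. *)
Definition cpoly (A B a b : T) (j : nat) : bpoly :=
  [seq (m.1, (m.2, 0%N)) | m <- theta A 1 j] ++ [seq (m.1, (0%N, m.2)) | m <- theta B 31 j]
  ++ (if j == 1%N then [:: (oopp o a, (1%N, 0%N)); (oopp o (b *' oinv o 31), (0%N, 1%N))]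
      else [::]).

(* The coefficients of [h], ..., [h^4] in [exp (\sum_(1 <= j <= 4) h^j c_j)]. *)
Section Exp4.
Variables c1 c2 c3 c4 : bpoly.
Definition epoly1 := c1.
Definition epoly2 := c2 ++ bscale (oinv o 2) (bmul c1 c1).
Definition epoly3 := c3 ++ bmul c1 c2 ++ bscale (oinv o 6) (bmul c1 (bmul c1 c1)).
Definition epoly4 := c4 ++ bmul c1 c3 ++ bscale (oinv o 2) (bmul c2 c2) ++
  bscale (oinv o 2) (bmul c2 (bmul c1 c1)) ++
  bscale (oinv o 24) (bmul (bmul c1 c1) (bmul c1 c1)).
End Exp4.
End BivariatePolynomials.

Section RealBivariatePolynomials.
Variable R : realType.

Definition Rops : rops R := ROps +%R *%R -%R (fun n => n%:R) (fun n => n%:R^-1).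

Definition beval (p : bpoly R) (x y : R) : R :=
  \sum_(m <- p) m.1 * x ^+ m.2.1 * y ^+ m.2.2.

Lemma beval_cat p q x y : beval (p ++ q) x y = beval p x y + beval q x y.
Proof. by rewrite /beval big_cat. Qed.

Lemma beval_scale c p x y : beval (bscale Rops c p) x y = c * beval p x y.
Proof.
by rewrite /beval /bscale big_map mulr_sumr; apply: eq_bigr => m _; rewrite !mulrA.
Qed.

Lemma beval_mul p q x y : beval (bmul Rops p q) x y = beval p x y * beval q x y.
Proof.
rewrite /beval /bmul big_flatten big_map mulr_suml; apply: eq_bigr => m _.
rewrite big_map mulr_sumr; apply: eq_bigr => n _ /=.
by rewrite !exprD; ring.
Qed.

Lemma epoly_eval (c1 c2 c3 c4 : bpoly R) x y :
  let v p := beval p x y in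
  [/\ v (epoly1 c1) = v c1,
      v (epoly2 Rops c1 c2) = v c2 + 2^-1 * v c1 ^+ 2,
      v (epoly3 Rops c1 c2 c3) = v c3 + v c1 * v c2 + 6^-1 * v c1 ^+ 3 &
      v (epoly4 Rops c1 c2 c3 c4) = v c4 + v c1 * v c3 + 2^-1 * v c2 ^+ 2 +
        2^-1 * v c2 * v c1 ^+ 2 + 24^-1 * v c1 ^+ 4].
Proof.
move=> v; have oinvE n : oinv Rops n = n%:R^-1 by [].
split; [by [] | | |];
  by rewrite /v !beval_cat !beval_scale !beval_mul !oinvE; ring.
Qed.

Lemma beval_bound p : exists2 C, 0 <= C & exists N : nat,
  forall x y, `|beval p x y| <= C * (1 + x ^+ 2 + y ^+ 2) ^+ N.
Proof.
elim: p => [|m p [C C0 [N HN]]].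
  by exists 0 => //; exists 0%N => x y; rewrite /beval big_nil normr0 mul0r.
exists (`|m.1| + C); first by nneg.
exists (m.2.1 + m.2.2 + N)%N => x y; rewrite /beval big_cons mulrDl.
have W1 : 1 <= 1 + x ^+ 2 + y ^+ 2 by rewrite -addrA lerDl; nneg.
set W := 1 + _ + _ in W1 *.
have Wx : `|x| <= W.
  rewrite /W -(real_normK (num_real x)).
  by have := sqr_ge0 (`|x| - 1); have := sqr_ge0 y; have := normr_ge0 x; nra.
have Wy : `|y| <= W.
  rewrite /W -(real_normK (num_real y)).
  by have := sqr_ge0 (`|y| - 1); have := sqr_ge0 x; have := normr_ge0 y; nra.
have W0 : 0 <= W by lra.
apply: le_trans (ler_normD _ _) _; apply: lerD.
  rewrite -mulrA !normrM ler_wpM2l// !normrX.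
  apply: le_trans (_ : W ^+ m.2.1 * W ^+ m.2.2 <= _).
    by rewrite ler_pM ?exprn_ge0// lerXn2r ?nnegrE.
  by rewrite -exprD ler_weXn2l// leq_addr.
by apply: le_trans (HN x y) _; rewrite ler_wpM2l// ler_weXn2l// leq_addl.
Qed.

Lemma ogmomE v n : ogmom Rops v n = gmom v n.
Proof. by []. Qed.

Lemma opowE (v : R) n : opow Rops v n = v ^+ n.
Proof. by elim: n => [|n IH] //; rewrite /opow iterS -/(opow Rops v n) IH exprS. Qed.

Lemma osumE s : osum Rops s = \sum_(x <- s) x.
Proof. by rewrite /osum unlock. Qed.

Lemma ogmom2E ka v i j : ogmom2 Rops ka v i j = gmom2 ka v i j.
Proof.
rewrite /ogmom2 osumE big_map /gmom2 -(big_mkord xpredT (fun k =>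
 'C(i, k)%:R * (- ka) ^+ k * gmom ka (i - k) * gmom v (j + k))).
rewrite /index_iota subn0; apply: eq_bigr => k _.
by rewrite !ogmomE opowE.
Qed.

Lemma bgaussE ka v p :
  bgauss Rops ka v p = \sum_(m <- p) m.1 * gmom2 ka v m.2.1 m.2.2.
Proof.
by rewrite /bgauss osumE big_map; apply: eq_bigr => m _; rewrite ogmom2E.
Qed.

Lemma gmom_odd (v : R) n : odd n -> gmom v n = 0.
Proof.
suff : (odd n -> gmom v n = 0) /\ (odd n.+1 -> gmom v n.+1 = 0) by case.
elim: n => [|n [IH1 IH2]]; split => // /negPn /IH1 e.
by rewrite [LHS]/= e mulr0.
Qed.

Lemma gmom2_odd (ka v : R) i j : odd (i + j) -> gmom2 ka v i j = 0.
Proof.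
move=> oij; rewrite /gmom2 big1// => k _.
have [iko|ike] := boolP (odd (i - k)); first by rewrite (gmom_odd _ iko) mulr0 mul0r.
rewrite (@gmom_odd v (j + k)) ?mulr0//.
have ki : (k <= i)%N by rewrite -ltnS.
by move: oij ike; rewrite -{1}(subnK ki) !oddD; case: odd; case: odd; case: odd.
Qed.

Lemma bgauss_odd ka v p : all (fun m => odd (m.2.1 + m.2.2)) p -> bgauss Rops ka v p = 0.
Proof.
rewrite bgaussE; elim: p => [|m p IH]; first by rewrite big_nil.
by rewrite big_cons /= => /andP[om /IH ->]; rewrite gmom2_odd// mulr0 addr0.
Qed.

Lemma dsum_bpoly m1 m2 ga1 ga2 u w l K p : 0 < m1 -> 0 < m2 - m1^-1 ->
  gauss_mass_spec m1 ga1 -> gauss_mass_spec (m2 - m1^-1) ga2 ->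
  0 < u -> 0 < w -> 0 < l ->
  exists2 C, 0 <= C & forall h n, 0 < h <= 1 -> l * h <= 1 ->
    2 * u + w / m1 + 2 * w / l <= h ^+ 2 * n%:R ->
    `|h * (l * h) * (\sum_(r < n) \sum_(s < n) beval p (rho u h r) (sig l w h s) *
        expR (- (2^-1 * qform m1 m2 (rho u h r) (sig l w h s))))
      - ga1 * ga2 * bgauss Rops m1^-1 (m2 - m1^-1)^-1 p| <= C * h ^+ K.
Proof.
move=> m10 mu0 gs1 gs2 u0 w0 l0.
elim: p => [|[c [i j]] p [C C0 IH]].
  exists 0 => // h n _ _ _; rewrite bgaussE big_nil mulr0 subr0 mul0r.
  rewrite big1 ?mulr0 ?normr0// => r _; rewrite big1// => s _.
  by rewrite /beval big_nil mul0r.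
have [D D0 HD] := dsum_pow i j K m10 mu0 gs1 gs2 u0 w0 l0.
exists (`|c| * D + C) => [|h n h01 lh1 Bn]; first by nneg.
have := IH h n h01 lh1 Bn; have := HD h n h01 lh1 Bn.
rewrite !bgaussE big_cons [_.1]/= [_.2.1]/= [_.2.2]/=.
have -> : \sum_(r < n) \sum_(s < n) beval ((c, (i, j)) :: p) (rho u h r) (sig l w h s) *
     expR (- (2^-1 * qform m1 m2 (rho u h r) (sig l w h s))) =
   c * (\sum_(r < n) \sum_(s < n) rho u h r ^+ i * sig l w h s ^+ j *
     expR (- (2^-1 * qform m1 m2 (rho u h r) (sig l w h s)))) +
   \sum_(r < n) \sum_(s < n) beval p (rho u h r) (sig l w h s) *
     expR (- (2^-1 * qform m1 m2 (rho u h r) (sig l w h s))).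
  rewrite mulr_sumr -big_split; apply: eq_bigr => r _ /=.
  rewrite mulr_sumr -big_split; apply: eq_bigr => s _ /=.
  by rewrite /beval big_cons /= mulrDl !mulrA.
set S1 := (X in c * X); set S2 := \sum_(r < n) \sum_(s < n) beval p _ _ * _.
set g := gmom2 _ _ i j; set G := \sum_(m <- p) _ => H1 H2.
have -> : h * (l * h) * (c * S1 + S2) - ga1 * ga2 * (c * g + G) =
  c * (h * (l * h) * S1 - ga1 * ga2 * g) + (h * (l * h) * S2 - ga1 * ga2 * G).
  by move: S1 S2 g G {H1 H2} => S1 S2 g G; ring.
apply: le_trans (ler_normD _ _) _; rewrite [leRHS]mulrDl; apply: lerD => //.
by rewrite [leLHS]normrM -[leRHS]mulrA; apply: ler_wpM2l.
Qed.
End RealBivariatePolynomials.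

Arguments Rops {R}.

Section LocalExpansion.
Variable R : realType.

Lemma dlnq_polyS n (p : {poly R}) : dlnq_poly R n = p ->
  dlnq_poly R n.+1 = - (('X + 'X^2) * p^`()).
Proof. by move=> <-. Qed.

Lemma dlnq_poly1 : dlnq_poly R 1 = - ('X + 'X^2).
Proof. by rewrite (dlnq_polyS erefl) derivX mulr1. Qed.

Lemma dlnq_poly2 : dlnq_poly R 2 = 'X + 'X^2 *+ 3 + 'X^3 *+ 2.
Proof. by rewrite (dlnq_polyS dlnq_poly1) derivN derivD derivX derivXn; ring. Qed.

Lemma dlnq_poly3 : dlnq_poly R 3 = - ('X + 'X^2 *+ 7 + 'X^3 *+ 12 + 'X^4 *+ 6).
Proof.
by rewrite (dlnq_polyS dlnq_poly2) !(derivMn, derivXn, derivX, derivN, derivD); ring.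
Qed.

Lemma dlnq_poly4 :
  dlnq_poly R 4 = 'X + 'X^2 *+ 15 + 'X^3 *+ 50 + 'X^4 *+ 60 + 'X^5 *+ 24.
Proof.
by rewrite (dlnq_polyS dlnq_poly3) !(derivMn, derivXn, derivX, derivN, derivD); ring.
Qed.

Lemma lnq_fam_dcoef (D : R -> R) v k : (2 <= k <= 6)%N ->
  lnq_fam 1 D k v = dcoef Rops (dlnq 1 v) k.
Proof.
have lE n : lnq_fam 1 D n.+2 v = (dlnq_poly R n).[dlnq 1 v] by [].
case: k => [|[|[|[|[|[|[|k]]]]]]] // _; rewrite lE ?hornerX//.
- by rewrite dlnq_poly1 hornerN hornerD hornerX hornerXn /dcoef !opowE.
- by rewrite dlnq_poly2 !(hornerMn, hornerXn, hornerX, hornerD) /dcoef !opowE /=; ring.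
- by rewrite dlnq_poly3 hornerN !(hornerMn, hornerXn, hornerX, hornerD) /dcoef !opowE /=; ring.
- by rewrite dlnq_poly4 !(hornerMn, hornerXn, hornerX, hornerD) /dcoef !opowE /=; ring.
Qed.

Definition theval (A : R) l j x := \sum_(m <- theta Rops A l j) m.1 * x ^+ m.2.

Lemma theval1 A l x : theval A l 1 x =
  - (dcoef Rops A 3 * x ^+ 3 / (l%:R * 6)) - dcoef Rops A 2 * x / 2.
Proof.
rewrite /theval /theta !big_cons big_nil /= natrM (_ : 3`! = 6)%N// expr1 ?muln1.
by rewrite addr0 !mulNr; congr (- _ - _); rewrite mulrAC.
Qed.

Lemma theval2 A l x : theval A l 2 x =
  - (dcoef Rops A 4 * x ^+ 4 / (l%:R * 24)) - dcoef Rops A 3 * x ^+ 2 / 4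
  - dcoef Rops A 2 * (l%:R / 12).
Proof.
rewrite /theval /theta !big_cons big_nil /= natrM (_ : 4`! = 24)%N// (_ : 2 * 2`! = 4)%N//.
by rewrite subnn expr0 (_ : 12 * 0`! = 12)%N//; ring.
Qed.

Lemma theval3 A l x : theval A l 3 x =
  - (dcoef Rops A 5 * x ^+ 5 / (l%:R * 120)) - dcoef Rops A 4 * x ^+ 3 / 12
  - dcoef Rops A 3 * (l%:R / 12) * x.
Proof.
rewrite /theval /theta !big_cons big_nil /= natrM (_ : 5`! = 120)%N// (_ : 2 * 3`! = 12)%N//.
by rewrite (_ : 3 - 2 = 1)%N// (_ : 12 * 1`! = 12)%N//; ring.
Qed.

Lemma theval4 A l x : theval A l 4 x =
  - (dcoef Rops A 6 * x ^+ 6 / (l%:R * 720)) - dcoef Rops A 5 * x ^+ 4 / 48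
  - dcoef Rops A 4 * (l%:R / 24) * x ^+ 2.
Proof.
rewrite /theval /theta !big_cons big_nil /= natrM (_ : 6`! = 720)%N// (_ : 2 * 4`! = 48)%N//.
by rewrite (_ : 4 - 2 = 2)%N// (_ : 12 * 2`! = 24)%N//; ring.
Qed.

Lemma big_ord3 (F : nat -> R) : \sum_(k < 3) F k = F 0%N + F 1%N + F 2%N.
Proof. by rewrite !big_ord_recr big_ord0 /= add0r. Qed.

Lemma big_ord5 (F : nat -> R) : \sum_(k < 5) F k = F 0%N + F 1%N + F 2%N + F 3%N + F 4%N.
Proof. by rewrite !big_ord_recr big_ord0 /= add0r. Qed.

Lemma big_ord7 (F : nat -> R) :
  \sum_(k < 7) F k = F 0%N + F 1%N + F 2%N + F 3%N + F 4%N + F 5%N + F 6%N.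
Proof. by rewrite !big_ord_recr big_ord0 /= add0r. Qed.

Lemma lnq_fam_bounded lo n : 0 < lo -> exists2 M, 0 <= M &
  forall (D : R -> R) v, lo <= v -> `|lnq_fam 1 D n.+2 v| <= M.
Proof.
move=> lo0; have [B B0 HB] := dlnq1_bounded lo0.
have [M M0 HM] := horner_bounded (dlnq_poly R n) B0.
by exists M => // D v lv; apply: HM; exact: HB.
Qed.

Lemma euler_maclaurin_main_expand (D : R -> R) lo hi v0 (l : nat) : 0 < lo -> (0 < l)%N ->
  (forall v : R, lo <= v -> is_derive v 1 D (lnq 1 v)) -> lo <= v0 <= hi ->
  exists2 C, 0 <= C & forall h x, 0 < h -> lo <= v0 + h * x <= hi ->
    `|euler_maclaurin_main D (l%:R * h ^+ 2) (v0 + h * x) -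
      (D v0 / (l%:R * h ^+ 2) + lnq 1 v0 / 2 + lnq 1 v0 * x / (l%:R * h) +
       dlnq 1 v0 * x ^+ 2 / (2 * l%:R)) +
      (h * theval (dlnq 1 v0) l 1 x + h ^+ 2 * theval (dlnq 1 v0) l 2 x +
       h ^+ 3 * theval (dlnq 1 v0) l 3 x + h ^+ 4 * theval (dlnq 1 v0) l 4 x)|
    <= C * h ^+ 5 * (1 + x ^+ 2) ^+ 7.
Proof.
move=> lo0 l0 Dd v0lr; have lN : l%:R != 0 :> R by rewrite pnatr_eq0 -lt0n.
have gd k (v : R) : lo <= v <= hi ->
    is_derive v 1 (lnq_fam 1 D k) (lnq_fam 1 D k.+1 v).
  move=> /andP[lv _]; apply: is_derive_lnq_fam; last exact: Dd.
  by apply: lnq_arg_gt0; lra.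
have [M7 M70 HM7] := lnq_fam_bounded 5 lo0.
have [M6 M60 HM6] := lnq_fam_bounded 4 lo0.
have [M5 M50 HM5] := lnq_fam_bounded 3 lo0.
exists (M7 / l%:R + M6 / 2 + l%:R / 12 * M5) => [|h x h0 hx]; first by nneg.
have hN : h != 0 by rewrite gt_eqF.
(* Orders 7, 5 and 3 compensate the factors [h^-2], 1 and [h^2] of the three terms, so that every
   error is [O(h^5)] up to a power of [1 + x^2]. *)
have T0 := @taylor_bound R 7 (lnq_fam 1 D) lo hi M7 v0 (h * x) (fun k v _ => gd k v)
  (fun v vlr => HM7 D v (proj1 (andP vlr))) v0lr hx.
have T1 := @taylor_bound R 5 (fun k => lnq_fam 1 D k.+1) lo hi M6 v0 (h * x)
  (fun k v _ => gd k.+1 v) (fun v vlr => HM6 D v (proj1 (andP vlr))) v0lr hx.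
have T2 := @taylor_bound R 3 (fun k => lnq_fam 1 D k.+2) lo hi M5 v0 (h * x)
  (fun k v _ => gd k.+2 v) (fun v vlr => HM5 D v (proj1 (andP vlr))) v0lr hx.
set e0 := (X in `|X| <= _) in T0; set e1 := (X in `|X| <= _) in T1.
set e2 := (X in `|X| <= _) in T2.
rewrite [X in `|X| <= _](_ : _ = e0 / (l%:R * h ^+ 2) + e1 / 2 + l%:R * h ^+ 2 / 12 * e2);
    last first.
  rewrite /e0 /e1 /e2 (big_ord7 (fun k => lnq_fam 1 D k v0 * (h * x) ^+ k / k`!%:R)).
  rewrite (big_ord5 (fun k => lnq_fam 1 D k.+1 v0 * (h * x) ^+ k / k`!%:R)).
  rewrite (big_ord3 (fun k => lnq_fam 1 D k.+2 v0 * (h * x) ^+ k / k`!%:R)).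
  rewrite (_ : lnq_fam 1 D 0 = D)// (_ : lnq_fam 1 D 1 = lnq 1)//.
  rewrite !(@lnq_fam_dcoef D v0) //.
  rewrite (_ : lnq_fam 1 D 2 (v0 + h * x) = dlnq 1 (v0 + h * x)); last first.
    by rewrite /= hornerX.
  rewrite /euler_maclaurin_main theval1 theval2 theval3 theval4.
  rewrite (_ : dlnq 1 v0 = dcoef Rops (dlnq 1 v0) 2)//.
  move: (dcoef Rops _ 2) (dcoef Rops _ 3) (dcoef Rops _ 4) (dcoef Rops _ 5) (dcoef Rops _ 6).
  move=> d2 d3 d4 d5 d6.
  rewrite (_ : 0`! = 1)%N// (_ : 1`! = 1)%N// (_ : 2`! = 2)%N// (_ : 3`! = 6)%N//.
  rewrite (_ : 4`! = 24)%N// (_ : 5`! = 120)%N// (_ : 6`! = 720)%N//.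
  by field; rewrite lN hN.
move: e0 e1 e2 T0 T1 T2 => e0 e1 e2 T0 T1 T2.
have h5 : 0 <= h ^+ 5 by nneg.
have X1 : 1 <= 1 + x ^+ 2 by rewrite lerDl sqr_ge0.
have Xx : `|x| <= 1 + x ^+ 2.
  rewrite -(real_normK (num_real x)).
  by have := sqr_ge0 (`|x| - 1); have := normr_ge0 x; nra.
have Xn k : (k <= 7)%N -> `|x| ^+ k <= (1 + x ^+ 2) ^+ 7.
  move=> k7; apply: le_trans (_ : (1 + x ^+ 2) ^+ k <= _); last exact: ler_weXn2l.
  by rewrite lerXn2r ?nnegrE//; lra.
apply: le_trans (ler_normD _ _) _; apply: le_trans (lerD (ler_normD _ _) (lexx _)) _.
rewrite !mulrDl; apply: lerD; first apply: lerD.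
- rewrite normrM [`|_^-1|]ger0_norm; last by nneg.
  have -> : M7 / l%:R * h ^+ 5 * (1 + x ^+ 2) ^+ 7 =
     (M7 * h ^+ 7 * (1 + x ^+ 2) ^+ 7) / (l%:R * h ^+ 2) by field; rewrite lN hN.
  rewrite ler_wpM2r//; first by nneg.
  apply: le_trans T0 _; rewrite normrM (gtr0_norm h0) exprMn mulrA.
  by rewrite ler_wpM2l ?Xn//; nneg.
- rewrite normrM [`|_^-1|]ger0_norm//.
  have -> : M6 / 2 * h ^+ 5 * (1 + x ^+ 2) ^+ 7 = (M6 * h ^+ 5 * (1 + x ^+ 2) ^+ 7) / 2.
    by field.
  rewrite ler_wpM2r//.
  apply: le_trans T1 _; rewrite normrM (gtr0_norm h0) exprMn mulrA.
  by rewrite ler_wpM2l ?Xn//; nneg.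
rewrite normrM ger0_norm; last by nneg.
have -> : l%:R / 12 * M5 * h ^+ 5 * (1 + x ^+ 2) ^+ 7 =
  l%:R * h ^+ 2 / 12 * (M5 * h ^+ 3 * (1 + x ^+ 2) ^+ 7) by field.
rewrite ler_wpM2l//; first by nneg.
apply: le_trans T2 _; rewrite normrM (gtr0_norm h0) exprMn mulrA.
by rewrite ler_wpM2l ?Xn//; nneg.
Qed.
End LocalExpansion.

(** * The summand near the saddle point *)

Section NahmWeights.
Variable R : realType.
Implicit Types (D E : R -> R) (a b u w lo hi C h t : R).

(* The last two equations are the logarithms of Nahm's equations
   [1 - x = x^6 y], [1 - y = x^31 y^6] at [x = e^(-u)], [y = e^(-w)]. *)
Definition saddle u w := [/\ 0 < u, 0 < w, 6 * u + w + lnq 1 u = 0 &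
  31 * u + 6 * w + lnq 1 w = 0].

Record qp_expansion u w D E lo hi C : Prop := QpExpansion {
  qpe_lo : 0 < lo; qpe_lou : 2 * lo <= u; qpe_low : 2 * lo <= w;
  qpe_hiu : 2 * u <= hi; qpe_hiw : 2 * w <= hi; qpe_C : 0 <= C;
  qpe_D : forall v : R, lo <= v -> is_derive v 1 D (lnq 1 v);
  qpe_E : forall t n, 0 < t -> t <= hi / 2 -> lo <= n%:R * t <= hi ->
    `|ln_qpoch t n - euler_maclaurin_main D t (n%:R * t) - E t| <= C * t ^+ 3 }.

Definition log_coef a b u w := cpoly Rops (dlnq 1 u) (dlnq 1 w) a b.

Definition saddle_form u w := qform (6 + dlnq 1 u) ((6 + dlnq 1 w) / 31).

(* The logarithm of the [(r, s)] term of [F_{a,b}] at [q = e^(-t)]. *)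
Definition log_weight a b (t : R) (r s : nat) : R :=
  - (t * (3 * r%:R ^+ 2 + 31 * r%:R * s%:R + 93 * s%:R ^+ 2 + a * r%:R + b * s%:R))
  - ln_qpoch t r - ln_qpoch (31 * t) s.

(* [log_weight] at the saddle point, up to [O(t)]: [D] is a primitive of
   [ln (1 - e^(-v))] and [E] the remainder of Euler-Maclaurin for [ln (q; q)_n]. *)
Definition log_peak a b u w D E (t : R) : R :=
  - ((3 * u ^+ 2 + u * w + 3 * w ^+ 2 / 31 + D u + D w / 31) / t)
  - (a * u + b * w / 31) - (lnq 1 u + lnq 1 w) / 2 - E t - E (31 * t).

Lemma beval_log_coef a b u w j x y : beval (log_coef a b u w j) x y =
  theval (dlnq 1 u) 1 j x + theval (dlnq 1 w) 31 j y + (if j == 1%N then - (a * x) - b / 31 * y else 0).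
Proof.
rewrite /log_coef /cpoly !beval_cat addrA; congr (_ + _ + _).
- by rewrite /beval big_map /theval; apply: eq_bigr => m _; rewrite expr0 mulr1.
- by rewrite /beval big_map /theval; apply: eq_bigr => m _; rewrite expr0 mulr1.
case: eqP => _; last by rewrite /beval big_nil.
by rewrite /beval !big_cons big_nil /= !expr0 !expr1 !mulr1 addr0 !mulNr.
Qed.

Lemma rhoE u h r : h != 0 -> u + h * rho u h r = r%:R * h ^+ 2.
Proof. by move=> hN; rewrite /rho; field. Qed.

Lemma sigE w h s : h != 0 -> w + h * sig 31 w h s = s%:R * (31 * h ^+ 2).
Proof. by move=> hN; rewrite /sig; field. Qed.

Lemma log_weight_quad a b u w h r s : h != 0 ->
  h ^+ 2 * (3 * r%:R ^+ 2 + 31 * r%:R * s%:R + 93 * s%:R ^+ 2 + a * r%:R + b * s%:R) =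
  (3 * u ^+ 2 + u * w + 3 * w ^+ 2 / 31) / h ^+ 2
  + (6 * u + w) / h * rho u h r + (31 * u + 6 * w) / (31 * h) * sig 31 w h s
  + (3 * rho u h r ^+ 2 + rho u h r * sig 31 w h s + 3 / 31 * sig 31 w h s ^+ 2)
  + (a * u + b * w / 31) + h * (a * rho u h r + b / 31 * sig 31 w h s).
Proof. by move=> hN; rewrite /rho /sig; field. Qed.

Lemma log_weight_expand a b u w D E lo hi C0 : saddle u w -> qp_expansion u w D E lo hi C0 ->
  exists2 C, 0 <= C & forall h r s, 0 < h <= 1 -> 31 * h ^+ 2 <= hi / 2 ->
  lo <= r%:R * h ^+ 2 <= hi -> lo <= s%:R * (31 * h ^+ 2) <= hi ->
  `|log_weight a b (h ^+ 2) r s - log_peak a b u w D E (h ^+ 2) + 2^-1 * saddle_form u w (rho u h r) (sig 31 w h s) -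
    (h * beval (log_coef a b u w 1) (rho u h r) (sig 31 w h s) + h ^+ 2 * beval (log_coef a b u w 2) (rho u h r) (sig 31 w h s)
     + h ^+ 3 * beval (log_coef a b u w 3) (rho u h r) (sig 31 w h s)
     + h ^+ 4 * beval (log_coef a b u w 4) (rho u h r) (sig 31 w h s))|
  <= C * h ^+ 5 * (1 + rho u h r ^+ 2 + sig 31 w h s ^+ 2) ^+ 7.
Proof.
move=> [upos wpos saddle_u saddle_w] [lo0 lou low hiu hiw C00 Dd HE].
have ulh : lo <= u <= hi by lra.
have wlh : lo <= w <= hi by lra.
have [C1 C10 H1] := @euler_maclaurin_main_expand R D lo hi u 1 lo0 isT Dd ulh.
have [C2 C20 H2] := @euler_maclaurin_main_expand R D lo hi w 31 lo0 isT Dd wlh.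
exists (C1 + C2 + C0 + C0 * 31 ^+ 3) => [|h r s h01 hhi rr ss]; first by nneg.
have /andP[h0 h1] := h01; have hN : h != 0 by rewrite gt_eqF.
have h20 : 0 < h ^+ 2 by rewrite exprn_gt0.
have h2hi : h ^+ 2 <= hi / 2 by lra.
have h310 : 0 < 31 * h ^+ 2 by lra.
have E1 := HE _ _ h20 h2hi rr; have E2 := HE _ _ h310 hhi ss.
move: rr ss E1 E2; rewrite -(rhoE u r hN) -(sigE w s hN) => rr ss E1 E2.
set x := rho u h r in rr E1 *; set y := sig 31 w h s in ss E2 *.
have {}H1 := H1 h x h0 rr; have {}H2 := H2 h y h0 ss.
rewrite mul1r in H1.
set e1 := (X in `|X| <= _) in H1; set e2 := (X in `|X| <= _) in H2.
set f1 := (X in `|X| <= _) in E1; set f2 := (X in `|X| <= _) in E2.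
rewrite [X in `|X| <= _](_ : _ = - e1 - e2 - f1 - f2); last first.
  rewrite /log_weight (log_weight_quad a b u w r s hN) -/x -/y /log_peak !beval_log_coef /saddle_form /qform /=.
  (* The saddle equations cancel the terms of order [1/h], which are linear in [x] and [y]. *)
  have su : lnq 1 u = - (6 * u + w) by lra.
  have sw : lnq 1 w = - (31 * u + 6 * w) by lra.
  rewrite /e1 /e2 /f1 /f2 mul1r su sw.
  move: (euler_maclaurin_main _ _ _) (euler_maclaurin_main _ _ _) (ln_qpoch _ _) (ln_qpoch _ _) => h1' h2' q1 q2.
  move: (theval _ _ _ _) (theval _ _ _ _) (theval _ _ _ _) (theval _ _ _ _).
  move=> t11 t12 t13 t14.
  move: (theval _ _ _ _) (theval _ _ _ _) (theval _ _ _ _) (theval _ _ _ _).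
  move=> t21 t22 t23 t24; move: (E _) (E _) (D _) (D _) => E1' E2' Du Dw.
  by field.
move: e1 e2 f1 f2 H1 H2 E1 E2 => e1 e2 f1 f2 H1 H2 E1 E2.
set W := 1 + x ^+ 2 + y ^+ 2.
have x2 := sqr_ge0 x; have y2 := sqr_ge0 y.
have W1 : 1 <= W ^+ 7 by rewrite exprn_ege1// /W; lra.
have Wx : (1 + x ^+ 2) ^+ 7 <= W ^+ 7.
  by rewrite lerXn2r ?nnegrE /W ?addr_ge0// lerDl.
have Wy : (1 + y ^+ 2) ^+ 7 <= W ^+ 7.
  by rewrite lerXn2r ?nnegrE /W ?addr_ge0// addrAC lerDl.
have h50 : 0 <= h ^+ 5 by nneg.
have h6 : h ^+ 6 <= h ^+ 5 by rewrite exprSr ler_piMr.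
have F1 : C0 * (h ^+ 2) ^+ 3 <= C0 * h ^+ 5 * W ^+ 7.
  rewrite -exprM -[leLHS]mulr1 ler_pM//; first by nneg.
  by rewrite ler_wpM2l.
have F2 : C0 * (31 * h ^+ 2) ^+ 3 <= C0 * 31 ^+ 3 * h ^+ 5 * W ^+ 7.
  have -> : C0 * (31 * h ^+ 2) ^+ 3 = 31 ^+ 3 * (C0 * (h ^+ 2) ^+ 3) by ring.
  have -> : C0 * 31 ^+ 3 * h ^+ 5 * W ^+ 7 = 31 ^+ 3 * (C0 * h ^+ 5 * W ^+ 7) by ring.
  by rewrite ler_wpM2l//; nneg.
have G1 : C1 * h ^+ 5 * (1 + x ^+ 2) ^+ 7 <= C1 * h ^+ 5 * W ^+ 7.
  by rewrite ler_wpM2l//; nneg.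
have G2 : C2 * h ^+ 5 * (1 + y ^+ 2) ^+ 7 <= C2 * h ^+ 5 * W ^+ 7.
  by rewrite ler_wpM2l//; nneg.
rewrite !mulrDl; apply: le_trans (ler_normB _ _) _.
apply: lerD; last exact: le_trans E2 F2.
apply: le_trans (ler_normB _ _) _; apply: lerD; last exact: le_trans E1 F1.
apply: le_trans (ler_normB _ _) _; rewrite normrN.
by apply: lerD; [exact: le_trans H1 G1 | exact: le_trans H2 G2].
Qed.
End NahmWeights.

(** * Global upper bound for the summand *)

Section UpperBound.
Variable R : realType.
Implicit Types (D E : R -> R) (a b u w lo hi C h t v : R).

Lemma lnq_homo v v' : 0 < v -> v <= v' -> lnq 1 v <= lnq 1 v'.
Proof.
move=> v0 vv; have v'0 : 0 < v' by lra.
by rewrite ler_ln ?posrE ?lnq_arg_gt0// !mul1r lerD2l lerN2 ler_expR lerN2.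
Qed.

Lemma lnq_le0 v : 0 < v -> lnq 1 v <= 0.
Proof. by move=> v0; rewrite ln_le0// mul1r; have := expR_gt0 (- v); lra. Qed.

Lemma dlnq_gt0 v : 0 < v -> 0 < dlnq 1 v.
Proof. by move=> v0; rewrite divr_gt0 ?lnq_arg_gt0// mul1r expR_gt0. Qed.

(* The increments [lnq 1 (t j)] of [ln_qpoch t] increase with [j]. *)
Lemma ln_qpoch_convex t n n0 v : 0 < t -> 0 < v -> n0%:R * t <= v <= n0.+1%:R * t ->
  ln_qpoch t n0 + (n%:R - n0%:R) * lnq 1 v <= ln_qpoch t n.
Proof.
move=> t0 v0 /andP[nv vn].
have [le|/ltnW le] := leqP n0 n.
  rewrite -(subnKC le) ln_qpochD lerD2l natrD addrAC subrr add0r.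
  rewrite -[X in X%:R * _]card_ord mulr_natl -sumr_const; apply: ler_sum => j _.
  apply: lnq_homo => //; apply: le_trans vn _.
  by rewrite mulrC ler_wpM2l ?(ltW t0)// ler_nat ltnS leq_addr.
rewrite -{1}(subnKC le) ln_qpochD -addrA gerDl -[in n0%:R](subnKC le) natrD opprD addrA subrr sub0r.
rewrite mulNr subr_le0 -[X in X%:R * _]card_ord mulr_natl -sumr_const.
apply: ler_sum => j _; apply: lnq_homo; first by rewrite mulr_gt0.
apply: le_trans nv; rewrite mulrC ler_wpM2r ?(ltW t0)// ler_nat.
by rewrite -ltn_subRL.
Qed.

(** Convexity puts [ln_qpoch t] above its tangent at [n t = v] for all [n] at once, including those
    outside the range of the Euler-Maclaurin estimate, which is used only at the last index [n0]
    with [n0 t <= v]. Rounding [v/t] costs a bounded error. *)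
Lemma ln_qpoch_ge u w D E lo hi C t n v : qp_expansion u w D E lo hi C ->
  0 < t <= 1 -> t <= lo -> 2 * lo <= v -> 2 * v <= hi ->
  D v / t + E t + (n%:R * t - v) * lnq 1 v / t - (C - lnq 1 lo / 2 - lnq 1 v) <= ln_qpoch t n.
Proof.
move=> [lo0 lou low hiu hiw C0 Dd HE] /andP[t0 t1] tlo lov vhi.
have v0 : 0 < v by lra.
pose n0 := Num.truncn (v / t).
have /andP[H1 H2] : v - t <= n0%:R * t <= v by apply: truncn_mul_itv; lra.
have H3 : v <= n0.+1%:R * t by rewrite -natr1 mulrDl mul1r; lra.
have nv : n0%:R * t <= v <= n0.+1%:R * t by rewrite H2.
apply: le_trans (ln_qpoch_convex n t0 v0 nv).
set U := n0%:R * t in H1 H2 H3.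
have thi : t <= hi / 2 by lra.
have UI : lo <= U <= hi by lra.
have := HE t n0 t0 thi UI; rewrite -/U ler_norml => /andP[L1 _].
have DU : D v <= D U.
  have [|c cU] := @MVT_le R D (lnq 1) U v H2; first by move=> z zU; apply: Dd; lra.
  move=> e; rewrite -subr_le0 e mulr_le0_ge0 ?subr_ge0//.
  by apply: lnq_le0; lra.
have DUt : D v / t <= D U / t by rewrite ler_wpM2r// invr_ge0 ltW.
have lU : lnq 1 lo <= lnq 1 U by apply: lnq_homo; lra.
have dU : 0 <= t / 12 * dlnq 1 U.
  have U0 : 0 < U by lra.
  by have dU0 := ltW (dlnq_gt0 U0); nneg.
have t3 : C * t ^+ 3 <= C by rewrite ler_piMr// exprn_ile1// ltW.
have lv := lnq_le0 v0.
have -> : (n%:R - n0%:R) * lnq 1 v =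
    (n%:R * t - v) * lnq 1 v / t + (v - U) / t * lnq 1 v.
  by rewrite /U; field; rewrite gt_eqF.
have l1 : lnq 1 v <= (v - U) / t * lnq 1 v.
  rewrite -[leLHS]mul1r ler_wnM2r//.
  by rewrite ler_pdivrMr// mul1r; lra.
rewrite /euler_maclaurin_main in L1; lra.
Qed.

(** Holds for all [r] and [s], however far from the saddle point. With tangents in place of the
    q-factorials the linear terms cancel and the form [3 x^2 + x y + 3/31 y^2] remains, positive
    definite because [4 * 3 * 3/31 > 1]. It exceeds [2/1000 (x^2 + y^2)]; half of this absorbs the
    terms in [a] and [b]. *)
Lemma log_weight_upper a b u w D E lo hi C0 : saddle u w -> qp_expansion u w D E lo hi C0 ->
  exists C, forall h r s, 0 < h <= 1 -> 31 * h ^+ 2 <= lo -> 31 * h ^+ 2 <= 1 ->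
  log_weight a b (h ^+ 2) r s - log_peak a b u w D E (h ^+ 2) <=
  C - 1000^-1 * (1 + rho u h r ^+ 2 + sig 31 w h s ^+ 2).
Proof.
move=> [upos wpos saddle_u saddle_w] S; have [lo0 lou low hiu hiw C00 Dd HE] := S.
exists (C0 - lnq 1 lo / 2 - lnq 1 u + (C0 - lnq 1 lo / 2 - lnq 1 w) +
  250 * a ^+ 2 + 250 * b ^+ 2 + 1) => h r s h01 hlo h31.
have /andP[h0 h1] := h01; have hN : h != 0 by rewrite gt_eqF.
have t0 : 0 < h ^+ 2 by rewrite exprn_gt0.
have L1 := @ln_qpoch_ge u w D E lo hi C0 (h ^+ 2) r u S (ltac:(lra)) (ltac:(lra)) lou hiu.
have L2 := @ln_qpoch_ge u w D E lo hi C0 (31 * h ^+ 2) s w S (ltac:(lra)) (ltac:(lra)) low hiw.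
rewrite -(rhoE u r hN) in L1; rewrite -(sigE w s hN) in L2.
rewrite /log_weight (log_weight_quad a b u w r s hN) /log_peak.
move: L1 L2; set x := rho u h r; set y := sig 31 w h s.
have -> : (u + h * x - u) * lnq 1 u / h ^+ 2 = - ((6 * u + w) / h * x).
  by rewrite (_ : lnq 1 u = - (6 * u + w)); [field | lra].
have -> : (w + h * y - w) * lnq 1 w / (31 * h ^+ 2) = - ((31 * u + 6 * w) / (31 * h) * y).
  by rewrite (_ : lnq 1 w = - (31 * u + 6 * w)); [field | lra].
have lu := lnq_le0 upos; have lw := lnq_le0 wpos.
have -> : (3 * u ^+ 2 + u * w + 3 * w ^+ 2 / 31 + D u + D w / 31) / h ^+ 2 =
  (3 * u ^+ 2 + u * w + 3 * w ^+ 2 / 31) / h ^+ 2 + D u / h ^+ 2 + D w / (31 * h ^+ 2).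
  by field.
have q1 : - (h * (a * x + b / 31 * y)) <= 1000^-1 * (x ^+ 2 + y ^+ 2) +
   250 * a ^+ 2 + 250 * b ^+ 2.
  have := sqr_ge0 (x / 1000 + h * a / 2); have := sqr_ge0 (y / 1000 + h * b / 62).
  have ha : (h * a) ^+ 2 <= a ^+ 2.
    by rewrite exprMn ler_piMl ?sqr_ge0// exprn_ile1// ltW.
  have hb : (h * b) ^+ 2 <= b ^+ 2.
    by rewrite exprMn ler_piMl ?sqr_ge0// exprn_ile1// ltW.
  have := sqr_ge0 b; clear - ha hb.
  nra.
have q2 : 2 / 1000 * (x ^+ 2 + y ^+ 2) <= 3 * x ^+ 2 + x * y + 3 / 31 * y ^+ 2.
  have := sqr_ge0 (x + y / 6); have := sqr_ge0 x; have := sqr_ge0 y.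
  clear; nra.
move: (_ / h ^+ 2) (_ / h ^+ 2) (_ / (31 * h ^+ 2)) (_ / h * x) (_ / (31 * h) * y) q1 q2.
move=> X1 X2 X3 X4 X5 q1 q2 L1 L2.
lra.
Qed.
End UpperBound.

Section PointwiseExpansion.
Variable R : realType.
Implicit Types (D E : R -> R) (a b u w lo hi C h t v z : R).

Lemma expR_taylor5 z :
  `|expR z - (1 + z + z ^+ 2 / 2 + z ^+ 3 / 6 + z ^+ 4 / 24)| <= (1 + expR z) * `|z| ^+ 5.
Proof.
have e0 := expR_gt0 z.
have := @taylor_bound R 5 (fun=> expR) (Num.min 0 z) (Num.max 0 z) (1 + expR z) 0 z.
rewrite (big_ord5 (fun k => expR 0 * z ^+ k / k`!%:R)) expR0 add0r !mul1r.
rewrite (_ : 0`! = 1)%N// (_ : 1`! = 1)%N// (_ : 2`! = 2)%N// (_ : 3`! = 6)%N//.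
rewrite (_ : 4`! = 24)%N// expr1 invr1 mulr1; apply.
- move=> v /andP[_]; rewrite le_max ger0_norm ?expR_ge0// => /orP[v0|vz].
    by apply: le_trans (_ : 1 <= _); [rewrite -expR0 ler_expR | lra].
  by apply: le_trans (_ : expR z <= _); [rewrite ler_expR | lra].
- by rewrite ge_min le_max lexx.
- by rewrite ge_min le_max lexx !orbT.
Qed.

Lemma normM_le (x y X Y : R) : `|x| <= X -> `|y| <= Y -> `|x * y| <= X * Y.
Proof. by move=> xX yY; rewrite normrM ler_pM. Qed.

Lemma normD_le (x y X Y : R) : `|x| <= X -> `|y| <= Y -> `|x + y| <= X + Y.
Proof. by move=> xX yY; apply: le_trans (ler_normD _ _) (lerD xX yY). Qed.

Lemma exp4_trunc h S c1 c2 c3 c4 : 0 <= h <= 1 -> 1 <= S ->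
  `|c1| <= S -> `|c2| <= S -> `|c3| <= S -> `|c4| <= S ->
  forall Z, Z = h * c1 + h ^+ 2 * c2 + h ^+ 3 * c3 + h ^+ 4 * c4 ->
  `|1 + Z + Z ^+ 2 / 2 + Z ^+ 3 / 6 + Z ^+ 4 / 24 -
    (1 + h * c1 + h ^+ 2 * (c2 + 2^-1 * c1 ^+ 2) +
     h ^+ 3 * (c3 + c1 * c2 + 6^-1 * c1 ^+ 3) +
     h ^+ 4 * (c4 + c1 * c3 + 2^-1 * c2 ^+ 2 + 2^-1 * c2 * c1 ^+ 2 + 24^-1 * c1 ^+ 4))|
  <= 30 * h ^+ 5 * S ^+ 4.
Proof.
move=> /andP[h0 h1] S1 b1 b2 b3 b4 Z ->.
(* Nested form [Z = h y], which shows the error as [h^5] times an explicit polynomial in bounded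
   quantities. *)
pose Y3 := c3 + h * c4; pose Y2 := c2 + h * Y3; pose y := c1 + h * Y2.
have hb : `|h| <= 1 by rewrite ger0_norm.
have B3 : `|Y3| <= S + 1 * S by apply: normD_le => //; exact: normM_le.
have B2 : `|Y2| <= S + 1 * (S + 1 * S) by apply: normD_le => //; exact: normM_le.
have By : `|y| <= S + 1 * (S + 1 * (S + 1 * S)) by apply: normD_le => //; exact: normM_le.
pose q2 := 2 * c1 * c4 + 2 * c2 * Y3 + h * Y3 ^+ 2.
pose q3 := 3 * c1 ^+ 2 * Y3 + 3 * c1 * Y2 ^+ 2 + h * Y2 ^+ 3.
pose q4 := Y2 * (y + c1) * (y ^+ 2 + c1 ^+ 2).
rewrite [X in `|X| <= _](_ : _ = h ^+ 5 * (2^-1 * q2 + 6^-1 * q3 + 24^-1 * q4)); last first.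
  by rewrite /q2 /q3 /q4 /y /Y2 /Y3; field.
have b22 : `|2 : R| <= 2 by rewrite normr_nat.
have b33 : `|3 : R| <= 3 by rewrite normr_nat.
have sq (x X : R) : `|x| <= X -> `|x ^+ 2| <= X * X by move=> ?; rewrite expr2; exact: normM_le.
have cu (x X : R) : `|x| <= X -> `|x ^+ 3| <= X * (X * X).
  by move=> ?; rewrite exprS; apply: normM_le => //; exact: sq.
have Q2 : `|q2| <= 2 * S * S + 2 * S * (S + 1 * S) + 1 * ((S + 1 * S) * (S + 1 * S)).
  by apply: normD_le; [apply: normD_le|]; repeat (apply: normM_le => //); exact: sq.
have Q3 : `|q3| <= 3 * (S * S) * (S + 1 * S) +
   3 * S * ((S + 1 * (S + 1 * S)) * (S + 1 * (S + 1 * S))) +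
   1 * ((S + 1 * (S + 1 * S)) * ((S + 1 * (S + 1 * S)) * (S + 1 * (S + 1 * S)))).
  apply: normD_le; [apply: normD_le|].
  - by apply: normM_le => //; apply: normM_le => //; exact: sq.
  - by apply: normM_le; [exact: normM_le | exact: sq].
  - by apply: normM_le => //; exact: cu.
pose y' := S + 1 * (S + 1 * (S + 1 * S)).
have Q4 : `|q4| <= (S + 1 * (S + 1 * S)) * (y' + S) * (y' * y' + S * S).
  apply: normM_le; first by apply: normM_le => //; exact: normD_le.
  by apply: normD_le; exact: sq.
rewrite [leRHS](_ : _ = h ^+ 5 * (30 * S ^+ 4)); last by ring.
apply: normM_le; first by rewrite ger0_norm// exprn_ge0.
have S2 : S ^+ 2 <= S ^+ 4 by rewrite ler_weXn2l.
have S3 : S ^+ 3 <= S ^+ 4 by rewrite ler_weXn2l.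
have H2 : `|2^-1 * q2| <= 2^-1 * (10 * S ^+ 4).
  rewrite normrM ger0_norm// ler_wpM2l//; apply: le_trans Q2 _; lra.
have H3 : `|6^-1 * q3| <= 6^-1 * (60 * S ^+ 4).
  rewrite normrM ger0_norm// ler_wpM2l//; apply: le_trans Q3 _; lra.
have H4 : `|24^-1 * q4| <= 24^-1 * (255 * S ^+ 4).
  rewrite normrM ger0_norm// ler_wpM2l//; apply: le_trans Q4 _; rewrite /y'; lra.
have S4 : 0 <= S ^+ 4 by rewrite exprn_ge0//; lra.
apply: le_trans (normD_le (normD_le H2 H3) H4) _; lra.
Qed.

Lemma exp4_lipschitz S z Z d : 1 <= S -> `|z| <= 5 * S -> `|Z| <= 5 * S -> `|z - Z| <= d ->
  `|(1 + z + z ^+ 2 / 2 + z ^+ 3 / 6 + z ^+ 4 / 24) -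
    (1 + Z + Z ^+ 2 / 2 + Z ^+ 3 / 6 + Z ^+ 4 / 24)| <= 40 * d * S ^+ 3.
Proof.
move=> S1 zS ZS zd; have d0 : 0 <= d by apply: le_trans zd.
rewrite [X in `|X| <= _](_ : _ = (z - Z) * (1 + (z + Z) / 2 +
  (z * z + z * Z + Z * Z) / 6 + (z + Z) * (z * z + Z * Z) / 24)); last by field.
rewrite [leRHS](_ : _ = d * (40 * S ^+ 3)); last by ring.
apply: normM_le => //.
have q1 : `|z + Z| <= 5 * S + 5 * S by exact: normD_le.
have q2 : `|z * z + Z * Z| <= 5 * S * (5 * S) + 5 * S * (5 * S).
  by apply: normD_le; exact: normM_le.
have q3 : `|z * z + z * Z + Z * Z| <= 5 * S * (5 * S) + 5 * S * (5 * S) + 5 * S * (5 * S).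
  by apply: normD_le; [apply: normD_le|]; exact: normM_le.
have b2 : `|2^-1 : R| <= 2^-1 by rewrite ger0_norm.
have b6 : `|6^-1 : R| <= 6^-1 by rewrite ger0_norm.
have b24 : `|24^-1 : R| <= 24^-1 by rewrite ger0_norm.
have b1 : `|1 : R| <= 1 by rewrite normr1.
apply: le_trans (normD_le (normD_le (normD_le b1 (normM_le q1 b2)) (normM_le q3 b6))
  (normM_le (normM_le q1 q2) b24)) _.
have S2 : S <= S ^+ 2 by rewrite expr2 ler_peMr//; lra.
have S3 : S ^+ 2 <= S ^+ 3 by rewrite ler_weXn2l.
lra.
Qed.

(** The factor [1 + expR z] allows large [z]: multiplied by the Gaussian it becomes the Gaussian
    plus the summand itself, and both decay exponentially. *)
Lemma expR_expand h S c1 c2 c3 c4 z : 0 <= h <= 1 -> 1 <= S ->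
  `|c1| <= S -> `|c2| <= S -> `|c3| <= S -> `|c4| <= S ->
  `|z - (h * c1 + h ^+ 2 * c2 + h ^+ 3 * c3 + h ^+ 4 * c4)| <= h ^+ 5 * S ->
  `|expR z - (1 + h * c1 + h ^+ 2 * (c2 + 2^-1 * c1 ^+ 2) +
     h ^+ 3 * (c3 + c1 * c2 + 6^-1 * c1 ^+ 3) +
     h ^+ 4 * (c4 + c1 * c3 + 2^-1 * c2 ^+ 2 + 2^-1 * c2 * c1 ^+ 2 + 24^-1 * c1 ^+ 4))|
  <= 3200 * h ^+ 5 * S ^+ 5 * (1 + expR z).
Proof.
move=> h01 S1 b1 b2 b3 b4; have /andP[h0 h1] := h01.
have T := exp4_trunc h01 S1 b1 b2 b3 b4 erefl.
move: T; set Z := h * c1 + _ + _ + _ => T zZ.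
have hn n : h ^+ n.+1 <= h by rewrite exprS ler_piMr// exprn_ile1.
have hnb n (c : R) : `|c| <= S -> `|h ^+ n.+1 * c| <= h * S.
  by move=> cS; apply: normM_le => //; rewrite ger0_norm ?exprn_ge0.
have ZS : `|Z| <= h * S + h * S + h * S + h * S.
  by apply: normD_le; [apply: normD_le; [apply: normD_le|]|];
    [exact: (hnb 0%N)|exact: hnb|exact: hnb|exact: hnb].
have S0 : 0 <= S by lra.
have hS : h * S <= S by rewrite ler_piMl.
have h5S : h ^+ 5 * S <= h * S by rewrite ler_wpM2r.
have zS : `|z| <= 5 * (h * S).
  rewrite -[z](subrK Z); apply: le_trans (normD_le zZ ZS) _; lra.
have L := @exp4_lipschitz S z Z (h ^+ 5 * S) S1 (ltac:(lra)) (ltac:(lra)) zZ.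
have X := expR_taylor5 z; have e0 := expR_gt0 z.
have h50 : 0 <= h ^+ 5 by nneg.
(* [3125 = 5^5]; the three errors 3125, 40 and 30 add up to less than 3200. *)
have X' : (1 + expR z) * `|z| ^+ 5 <= 3125 * h ^+ 5 * S ^+ 5 * (1 + expR z).
  rewrite [leRHS]mulrC; apply: ler_wpM2l; first by rewrite addr_ge0 ?expR_ge0.
  have -> : 3125 * h ^+ 5 * S ^+ 5 = (5 * (h * S)) ^+ 5 by ring.
  by rewrite lerXn2r ?nnegrE//; nneg.
have S45 : S ^+ 4 <= S ^+ 5 by rewrite ler_weXn2l.
have h5S5 : 0 <= h ^+ 5 * S ^+ 5 by nneg.
have L' : 40 * (h ^+ 5 * S) * S ^+ 3 <= 40 * (h ^+ 5 * S ^+ 5).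
  have -> : 40 * (h ^+ 5 * S) * S ^+ 3 = 40 * (h ^+ 5 * S ^+ 4) by ring.
  by rewrite ler_wpM2l// ler_wpM2l.
have T' : 30 * h ^+ 5 * S ^+ 4 <= 30 * (h ^+ 5 * S ^+ 5).
  by rewrite -mulrA ler_wpM2l// ler_wpM2l.
set P := (X in `|_ - X| <= _) in T *.
have -> : expR z - P = (expR z - (1 + z + z ^+ 2 / 2 + z ^+ 3 / 6 + z ^+ 4 / 24)) +
  ((1 + z + z ^+ 2 / 2 + z ^+ 3 / 6 + z ^+ 4 / 24) -
    (1 + Z + Z ^+ 2 / 2 + Z ^+ 3 / 6 + Z ^+ 4 / 24)) +
  ((1 + Z + Z ^+ 2 / 2 + Z ^+ 3 / 6 + Z ^+ 4 / 24) - P) by ring.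
apply: le_trans (normD_le (normD_le (le_trans X X') (le_trans L L')) (le_trans T T')) _.
have : 0 <= h ^+ 5 * S ^+ 5 * expR z by nneg.
by move: h5S5; clear; lra.
Qed.
End PointwiseExpansion.

Section Pointwise.
Variable R : realType.
Implicit Types (D E : R -> R) (a b u w lo hi C h t v x y : R).

Definition exp_coef a b u w k : bpoly R :=
  let c := log_coef a b u w in
  match k with
  | 1 => epoly1 (c 1%N)
  | 2 => epoly2 Rops (c 1%N) (c 2%N)
  | 3 => epoly3 Rops (c 1%N) (c 2%N) (c 3%N)
  | _ => epoly4 Rops (c 1%N) (c 2%N) (c 3%N) (c 4%N)
  end.

Definition exp_series a b u w h x y : R :=
  1 + h * beval (exp_coef a b u w 1) x y + h ^+ 2 * beval (exp_coef a b u w 2) x y +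
  h ^+ 3 * beval (exp_coef a b u w 3) x y + h ^+ 4 * beval (exp_coef a b u w 4) x y.

Lemma exp_seriesE a b u w h x y :
  let c1 := beval (log_coef a b u w 1) x y in let c2 := beval (log_coef a b u w 2) x y in
  let c3 := beval (log_coef a b u w 3) x y in let c4 := beval (log_coef a b u w 4) x y in
  exp_series a b u w h x y = 1 + h * c1 + h ^+ 2 * (c2 + 2^-1 * c1 ^+ 2) +
     h ^+ 3 * (c3 + c1 * c2 + 6^-1 * c1 ^+ 3) +
     h ^+ 4 * (c4 + c1 * c3 + 2^-1 * c2 ^+ 2 + 2^-1 * c2 * c1 ^+ 2 + 24^-1 * c1 ^+ 4).
Proof.
rewrite /exp_series /exp_coef; have [-> -> -> ->] := epoly_eval (log_coef a b u w 1) (log_coef a b u w 2)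
  (log_coef a b u w 3) (log_coef a b u w 4) x y.
by [].
Qed.

Lemma weight_bound N : exists2 C, 0 <= C & forall x y,
  (1 + x ^+ 2 + y ^+ 2) ^+ N * expR (- (1000^-1 * (1 + x ^+ 2 + y ^+ 2))) <=
  C / ((1 + x ^+ 2) * (1 + y ^+ 2)).
Proof.
have k0 : 0 < 1000^-1 :> R by rewrite invr_gt0 ltr0n.
have [C C0 HC] := expr_expRN_bounded N.+2 k0.
exists C => // x y; set W := 1 + _ + _.
have x2 := sqr_ge0 x; have y2 := sqr_ge0 y.
have x1 : 0 < 1 + x ^+ 2 by lra.
have y1 : 0 < 1 + y ^+ 2 by lra.
have W0 : 0 <= W by rewrite /W; lra.
rewrite ler_pdivlMr ?mulr_gt0//; apply: le_trans (HC W W0).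
have q : (1 + x ^+ 2) * (1 + y ^+ 2) <= W ^+ 2.
  by rewrite /W; move: (x ^+ 2) (y ^+ 2) x2 y2 => X Y X0 Y0; nra.
rewrite -[N.+2]addn2 exprD -!mulrA ler_wpM2l ?exprn_ge0//.
by rewrite [leRHS]mulrA -expr2 mulrC ler_wpM2r ?expR_ge0.
Qed.

Lemma saddle_form_ge u w x y : 0 < u -> 0 < w ->
  2 / 1000 * (x ^+ 2 + y ^+ 2) <= 2^-1 * saddle_form u w x y.
Proof.
move=> u0 w0; have A0 := dlnq_gt0 u0; have B0 := dlnq_gt0 w0.
rewrite /saddle_form /qform.
have := sqr_ge0 (x + 100 / 598 * y); have := sqr_ge0 x; have := sqr_ge0 y.
move: (dlnq 1 u) (dlnq 1 w) A0 B0 => A B A0 B0 Y X XY.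
have AX : 0 <= A * x ^+ 2 by rewrite mulr_ge0// ltW.
have BY : 0 <= B * y ^+ 2 by rewrite mulr_ge0// ltW.
lra.
Qed.

(** Uniform in [r] and [s]. If [h |x|] and [h |y|] are at most [lo], the expansion of the logarithm
    is exponentiated. Otherwise [W = 1 + x^2 + y^2] is at least [(lo/h)^2], so a factor [h^5] can be
    bought with [W^3], and the exponential bounds on the summand and on the Gaussian pay for all
    powers of [W]. The denominator on the right makes the error summable over the lattice. *)
Lemma pointwise a b u w D E lo hi C0 : saddle u w -> qp_expansion u w D E lo hi C0 ->
  exists2 C, 0 <= C & exists2 h0, 0 < h0 & forall h r s, 0 < h <= h0 ->
  forall x y, x = rho u h r -> y = sig 31 w h s ->
  `|expR (log_weight a b (h ^+ 2) r s - log_peak a b u w D E (h ^+ 2)) -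
    expR (- (2^-1 * saddle_form u w x y)) * exp_series a b u w h x y|
  <= C * h ^+ 5 / ((1 + x ^+ 2) * (1 + y ^+ 2)).
Proof.
move=> sad qpe; have [upos wpos _ _] := sad; have [lo0 lou low hiu hiw _ _ _] := qpe.
have [Ce Ce0 HCe] := log_weight_expand a b sad qpe.
have [Cu HCu] := log_weight_upper a b sad qpe.
have [C1 C10 [N1 HC1]] := beval_bound (log_coef a b u w 1).
have [C2 C20 [N2 HC2]] := beval_bound (log_coef a b u w 2).
have [C3 C30 [N3 HC3]] := beval_bound (log_coef a b u w 3).
have [C4 C40 [N4 HC4]] := beval_bound (log_coef a b u w 4).
have [D1 D10 [M1 HD1]] := beval_bound (exp_coef a b u w 1).
have [D2 D20 [M2 HD2]] := beval_bound (exp_coef a b u w 2).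
have [D3 D30 [M3 HD3]] := beval_bound (exp_coef a b u w 3).
have [D4 D40 [M4 HD4]] := beval_bound (exp_coef a b u w 4).
pose K := 1 + C1 + C2 + C3 + C4 + Ce; pose N := (N1 + N2 + N3 + N4 + 7)%N.
pose Kp := 1 + D1 + D2 + D3 + D4; pose Np := (M1 + M2 + M3 + M4)%N.
have [Cw Cw0 HCw] := weight_bound (N * 5); have [Cv Cv0 HCv] := weight_bound (Np + 3).
have [K1 KC1 KC2 KC3 KC4] : [/\ 1 <= K, C1 <= K, C2 <= K, C3 <= K & C4 <= K].
  by rewrite /K; move: C10 C20 C30 C40 Ce0; clear; split; lra.
have KCe : Ce <= K by rewrite /K; move: C10 C20 C30 C40; clear; lra.
have Kp1 : 1 <= Kp by rewrite /Kp; move: D10 D20 D30 D40; clear; lra.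
have K0 : 0 <= K by apply: le_trans K1.
have Kp0 : 0 <= Kp by apply: le_trans Kp1.
have [NN1 NN2 NN3 NN4] : [/\ N1 <= N, N2 <= N, N3 <= N & N4 <= N]%N.
  by rewrite /N; clear; split; lia.
have [MM1 MM2 MM3 MM4] : [/\ M1 <= Np, M2 <= Np, M3 <= Np & M4 <= Np]%N.
  by rewrite /Np; clear; split; lia.
pose G := expR 1 + expR Cu.
have G0 : 0 <= G by rewrite /G; nneg.
exists (3200 * K ^+ 5 * G * Cw + (lo ^- 6) * (G * Kp) * Cv); first by nneg.
exists (Num.min 31^-1 lo); first by rewrite lt_min lo0 invr_gt0 ltr0n.
move=> h r s /andP[h0]; rewrite le_min => /andP[h31 hlo] _ _ -> ->.
set x := rho u h r; set y := sig 31 w h s.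
have h1 : h <= 1 by apply: le_trans h31 _; rewrite invf_le1 ?ltr0n// ler1n.
have h01 : 0 < h <= 1 by rewrite h0.
have hh : 31 * h ^+ 2 <= h.
  have -> : 31 * h ^+ 2 = h * (31 * h) by ring.
  by rewrite ler_piMr ?(ltW h0)// mulrC -ler_pdivlMr ?ltr0n// mul1r.
have tlo : 31 * h ^+ 2 <= lo by apply: le_trans hh hlo.
have t1 : 31 * h ^+ 2 <= 1 by apply: le_trans hh h1.
have thi : 31 * h ^+ 2 <= hi / 2 by move: tlo lou hiu lo0; clear; lra.
have hN : h != 0 by rewrite gt_eqF.
pose W := 1 + x ^+ 2 + y ^+ 2.
have x2 := sqr_ge0 x; have y2 := sqr_ge0 y.
have W1 : 1 <= W by rewrite /W -addrA lerDl addr_ge0.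
have W0 : 0 <= W by apply: le_trans W1.
have Wn m n : (m <= n)%N -> W ^+ m <= W ^+ n by exact: ler_weXn2l.
pose g := expR (- (2^-1 * saddle_form u w x y)).
pose ew := expR (- (1000^-1 * W)).
have ew0 : 0 <= ew by exact: expR_ge0.
have g0 : 0 <= g by exact: expR_ge0.
have gew : g <= expR 1 * ew.
  rewrite /g /ew -expRD ler_expR; have := saddle_form_ge x y upos wpos; rewrite /W.
  by move: (2^-1 * _) (x ^+ 2) (y ^+ 2) x2 y2; clear => q X Y X0 Y0; lra.
pose l := log_weight a b (h ^+ 2) r s - log_peak a b u w D E (h ^+ 2).
have lew : expR l <= expR Cu * ew.
  by rewrite -expRD ler_expR; exact: HCu.
have P0 : 0 < (1 + x ^+ 2) * (1 + y ^+ 2) by rewrite mulr_gt0// ltr_pwDl.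
have h50 : 0 <= h ^+ 5 by nneg.
have [/andP[hx hy]|out] := boolP ((h * `|x| <= lo) && (h * `|y| <= lo)).
  have hxI : - lo <= h * x <= lo.
    by rewrite -ler_norml normrM (gtr0_norm h0).
  have hyI : - lo <= h * y <= lo.
    by rewrite -ler_norml normrM (gtr0_norm h0).
  have rr : lo <= r%:R * h ^+ 2 <= hi by rewrite -(rhoE u r hN) -/x; move: hxI lou hiu lo0; clear; lra.
  have ss : lo <= s%:R * (31 * h ^+ 2) <= hi by rewrite -(sigE w s hN) -/y; move: hyI low hiw lo0; clear; lra.
  have := HCe h r s h01 thi rr ss; rewrite -/x -/y -/l -/W.
  pose S := K * W ^+ N; pose z := l + 2^-1 * saddle_form u w x y.
  have S1 : 1 <= S by rewrite -[leLHS]mulr1 ler_pM// exprn_ege1.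
  have cS Ci Ni (ci : R) : 0 <= Ci -> Ci <= K -> (Ni <= N)%N -> `|ci| <= Ci * W ^+ Ni -> `|ci| <= S.
    by move=> ? ? ? /le_trans; apply; rewrite /S ler_pM ?exprn_ge0// Wn.
  have hz : Ce * h ^+ 5 * W ^+ 7 <= h ^+ 5 * S.
    rewrite -mulrA mulrCA ler_wpM2l// /S ler_pM ?exprn_ge0//.
    by rewrite Wn// /N leq_addl.
  move=> /le_trans/(_ hz) => Hz.
  have h01' : 0 <= h <= 1 by rewrite ltW.
  have := @expR_expand R h S _ _ _ _ z h01' S1 (cS _ _ _ C10 KC1 NN1 (HC1 x y))
    (cS _ _ _ C20 KC2 NN2 (HC2 x y)) (cS _ _ _ C30 KC3 NN3 (HC3 x y))
    (cS _ _ _ C40 KC4 NN4 (HC4 x y)) Hz.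
  rewrite -exp_seriesE => Hexp.
  have lE : expR l = g * expR z by rewrite /g -expRD /z addrC addrK.
  rewrite -/l -/g lE -mulrBr normrM ger0_norm//.
  apply: le_trans (ler_wpM2l g0 Hexp) _.
  have -> : g * (3200 * h ^+ 5 * S ^+ 5 * (1 + expR z)) =
     3200 * h ^+ 5 * S ^+ 5 * (g + expR l) by rewrite lE; ring.
  apply: le_trans (_ : 3200 * h ^+ 5 * S ^+ 5 * (G * ew) <= _).
    apply: ler_wpM2l; first by rewrite /S; nneg.
    by rewrite /G mulrDl; apply: lerD.
  have -> : 3200 * h ^+ 5 * S ^+ 5 * (G * ew) =
     3200 * K ^+ 5 * G * h ^+ 5 * (W ^+ (N * 5) * ew) by rewrite /S exprM; ring.
  apply: le_trans (ler_wpM2l _ (HCw x y)) _; first by nneg.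
  rewrite mulrA; apply: ler_wpM2r; first by rewrite invr_ge0 ltW.
  rewrite [leRHS]mulrDl mulrAC lerDl; nneg.
have out1 : 1 <= lo ^- 6 * h ^+ 5 * W ^+ 3.
  have hW : lo ^+ 2 <= h ^+ 2 * W.
    move: out; rewrite negb_and -!ltNge => /orP[]/ltW H.
      apply: le_trans (_ : (h * `|x|) ^+ 2 <= _).
        by rewrite lerXn2r ?nnegrE ?mulr_ge0 ?(ltW h0) ?(ltW lo0).
      by rewrite exprMn real_normK ?num_real// ler_wpM2l ?sqr_ge0// /W addrAC lerDr addr_ge0.
    apply: le_trans (_ : (h * `|y|) ^+ 2 <= _).
      by rewrite lerXn2r ?nnegrE ?mulr_ge0 ?(ltW h0) ?(ltW lo0).
    by rewrite exprMn real_normK ?num_real// ler_wpM2l ?sqr_ge0// /W lerDr addr_ge0.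
  have H6 : lo ^+ 6 <= h ^+ 6 * W ^+ 3.
    have -> : h ^+ 6 * W ^+ 3 = (h ^+ 2 * W) ^+ 3 by ring.
    have -> : lo ^+ 6 = (lo ^+ 2) ^+ 3 by ring.
    by rewrite lerXn2r ?nnegrE//; nneg.
  rewrite -mulrA mulrC ler_pdivlMr ?exprn_gt0// mul1r.
  apply: le_trans H6 _; rewrite ler_wpM2r ?exprn_ge0//.
  by rewrite exprS ler_piMl.
have Pb : `|exp_series a b u w h x y| <= Kp * W ^+ Np.
  have hn n : `|h ^+ n| <= 1 by rewrite ger0_norm ?exprn_ge0 ?exprn_ile1 ?(ltW h0).
  have bnd Di Mi n (ci : R) : 0 <= Di -> (Mi <= Np)%N -> `|ci| <= Di * W ^+ Mi ->
      `|h ^+ n * ci| <= Di * W ^+ Np.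
    move=> Di0 MN ciD; rewrite -[leRHS]mul1r; apply: normM_le => //.
    by apply: le_trans ciD _; rewrite ler_wpM2l ?Wn.
  rewrite /Kp !mulrDl mul1r; apply: normD_le; [apply: normD_le; [apply: normD_le; [apply: normD_le|]|]|].
  - by rewrite normr1 exprn_ege1.
  - exact: (bnd _ _ 1%N _ D10 MM1 (HD1 x y)).
  - exact: (bnd _ _ 2%N _ D20 MM2 (HD2 x y)).
  - exact: (bnd _ _ 3%N _ D30 MM3 (HD3 x y)).
  - exact: (bnd _ _ 4%N _ D40 MM4 (HD4 x y)).
rewrite -/l -/g.
have WN : 1 <= W ^+ Np by rewrite exprn_ege1.
apply: le_trans (_ : G * Kp * (W ^+ Np * ew) <= _).
  apply: le_trans (ler_normB _ _) _; rewrite ger0_norm ?expR_ge0// normrM (ger0_norm g0).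
  rewrite /G mulrDl mulrDl addrC; apply: lerD.
    apply: le_trans (ler_pM _ _ gew Pb) _ => //.
    by apply/eqW; ring.
  apply: le_trans lew _; rewrite -mulrA ler_wpM2l ?expR_ge0//.
  rewrite mulrA -[leLHS]mul1r ler_wpM2r//.
  by rewrite -[leLHS]mulr1 ler_pM.
apply: le_trans (_ : lo ^- 6 * (G * Kp) * h ^+ 5 * (W ^+ (Np + 3) * ew) <= _).
  have -> : lo ^- 6 * (G * Kp) * h ^+ 5 * (W ^+ (Np + 3) * ew) =
    (lo ^- 6 * h ^+ 5 * W ^+ 3) * (G * Kp * (W ^+ Np * ew)) by rewrite exprD; ring.
  by rewrite ler_peMl//; nneg.
apply: le_trans (ler_wpM2l _ (HCv x y)) _; first by nneg.
rewrite mulrA; apply: ler_wpM2r; first by rewrite invr_ge0 ltW.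
by rewrite [leRHS]mulrDl mulrAC lerDr; nneg.
Qed.
End Pointwise.

(** * Asymptotics of the sum *)

Section SumAsymptotics.
Variable R : realType.
Implicit Types (D E : R -> R) (a b u w lo hi C h t v x y : R).

Definition Zsum a b t n : R := \sum_(r < n) \sum_(s < n) expR (log_weight a b t r s).

Definition gcoef a b u w k : R :=
  let m1 := 6 + dlnq 1 u in let m2 := (6 + dlnq 1 w) / 31 in
  bgauss Rops m1^-1 (m2 - m1^-1)^-1 (exp_coef a b u w k).

Lemma hessian_gt0 u w : 0 < u -> 0 < w -> 0 < (6 + dlnq 1 w) / 31 - (6 + dlnq 1 u)^-1.
Proof.
move=> /dlnq_gt0 A0 /dlnq_gt0 B0; rewrite subr_gt0.
apply: lt_trans (_ : 6^-1 < _); first by rewrite ltf_pV2 ?posrE; lra.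
by rewrite ltr_pdivlMr ?ltr0n//; lra.
Qed.

Lemma double_lattice_sum_le u w h n : 0 < h -> 31 * h <= 1 ->
  h * (31 * h) * (\sum_(r < n) \sum_(s < n)
     ((1 + rho u h r ^+ 2) * (1 + sig 31 w h s ^+ 2))^-1) <= (3 * pi) ^+ 2.
Proof.
move=> h0 h31; have h1 : 0 < h <= 1 by lra.
have h31' : 0 < 31 * h <= 1 by lra.
have S1 := lattice_sum_le (- (u / h)) n h1.
have S2 := lattice_sum_le (- (w / h)) n h31'.
apply: le_trans (_ : (\sum_(r < n) h / (1 + rho u h r ^+ 2)) *
   (\sum_(s < n) 31 * h / (1 + sig 31 w h s ^+ 2)) <= _).
  rewrite mulr_suml mulr_sumr; apply: ler_sum => r _.
  rewrite mulr_sumr mulr_sumr; apply: ler_sum => s _.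
  by rewrite invfM; apply/eqW; ring.
rewrite expr2; apply: ler_pM => //.
  by apply: sumr_ge0 => r _; rewrite divr_ge0 ?(ltW h0)// addr_ge0// sqr_ge0.
by apply: sumr_ge0 => r _; rewrite divr_ge0 ?mulr_ge0 ?(ltW h0)// addr_ge0// sqr_ge0.
Qed.

Lemma epoly_odd a b u w k : (k == 1%N) || (k == 3%N) -> gcoef a b u w k = 0.
Proof. by case/orP => /eqP ->; rewrite /gcoef; apply: bgauss_odd. Qed.

(** [31 h^2] is the area of a lattice cell in the coordinates [rho], [sig]. The coefficients of [h]
    and [h^3] are polynomials with monomials of odd degree only, whose Gaussian means vanish. *)
Lemma Zsum_asymptotics a b u w D E lo hi C0 : saddle u w ->
  qp_expansion u w D E lo hi C0 ->
  exists2 ga, 0 < ga & exists2 C, 0 <= C & exists2 h0, 0 < h0 &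
  forall h, 0 < h <= h0 -> exists n0 : nat, forall n, (n0 <= n)%N ->
  `|31 * h ^+ 2 * (Zsum a b (h ^+ 2) n * expR (- log_peak a b u w D E (h ^+ 2))) -
    ga * (1 + gcoef a b u w 2 * h ^+ 2 + gcoef a b u w 4 * h ^+ 4)| <= C * h ^+ 5.
Proof.
move=> sad qpe; have [upos wpos _ _] := sad.
have A0 := dlnq_gt0 upos; have mu0 := hessian_gt0 upos wpos.
have m10 : 0 < 6 + dlnq 1 u by lra.
have [g1 gs1] := lsum_mass m10; have [g2 gs2] := lsum_mass mu0.
have g10 := gs1.1; have g20 := gs2.1.
have l0 : 0 < 31 :> R by rewrite ltr0n.
have [Cp Cp0 [hp hp0 HCp]] := pointwise a b sad qpe.
have H p := dsum_bpoly 5 p m10 mu0 gs1 gs2 upos wpos l0.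
have [B0 B00 HB0] := H [:: (1%R, (0%N, 0%N))].
have [B1 B10 HB1] := H (exp_coef a b u w 1).
have [B2 B20 HB2] := H (exp_coef a b u w 2).
have [B3 B30 HB3] := H (exp_coef a b u w 3).
have [B4 B40 HB4] := H (exp_coef a b u w 4).
exists (g1 * g2); first by rewrite mulr_gt0.
exists (Cp * (3 * pi) ^+ 2 + (B0 + B1 + B2 + B3 + B4)); first by nneg.
exists (Num.min 31^-1 hp); first by rewrite lt_min hp0 invr_gt0 ltr0n.
move=> h /andP[h0]; rewrite le_min => /andP[h31 hhp].
have h311 : 31 * h <= 1 by rewrite mulrC -ler_pdivlMr// mul1r.
have h1 : h <= 1 by lra.
have h01 : 0 < h <= 1 by rewrite h0.
pose bd := 2 * u + w / (6 + dlnq 1 u) + 2 * w / 31.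
(* From this size on the square of summation contains the saddle point with the margin that
   [dsum_bpoly] asks for. *)
exists (Num.truncn (bd / h ^+ 2)).+1 => n nbig.
have nn : bd <= h ^+ 2 * n%:R.
  have bd0 : 0 <= bd / h ^+ 2 by rewrite /bd; nneg.
  rewrite mulrC -ler_pdivrMr ?exprn_gt0//.
  have /andP[_ /ltW/le_trans] := truncn_itv bd0; apply.
  by rewrite ler_nat.
have {}HB0 := HB0 h n h01 h311 nn; have {}HB1 := HB1 h n h01 h311 nn.
have {}HB2 := HB2 h n h01 h311 nn; have {}HB3 := HB3 h n h01 h311 nn.
have {}HB4 := HB4 h n h01 h311 nn.
move: HB0 HB1 HB2 HB3 HB4; set Sg := fun p => \sum_(r < n) \sum_(s < n)
  beval p (rho u h r) (sig 31 w h s) *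
  expR (- (2^-1 * qform (6 + dlnq 1 u) ((6 + dlnq 1 w) / 31) (rho u h r) (sig 31 w h s))).
rewrite -!/(Sg _) -/(gcoef a b u w 1) -/(gcoef a b u w 2) -/(gcoef a b u w 3)
  -/(gcoef a b u w 4) (@epoly_odd a b u w 1)// (@epoly_odd a b u w 3)//.
have -> : bgauss Rops (6 + dlnq 1 u)^-1 ((6 + dlnq 1 w) / 31 - (6 + dlnq 1 u)^-1)^-1
  [:: (1%R, (0%N, 0%N))] = 1 :> R.
  rewrite bgaussE big_cons big_nil /= addr0 mul1r /gmom2 big_ord_recl big_ord0 addr0.
  by rewrite bin0 expr0 !mul1r.
rewrite !mulr0 !subr0 mulr1 => HB0 HB1 HB2 HB3 HB4.
pose Se := \sum_(r < n) \sum_(s < n) (expR (log_weight a b (h ^+ 2) r s - log_peak a b u w D E (h ^+ 2)) -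
    expR (- (2^-1 * saddle_form u w (rho u h r) (sig 31 w h s))) *
      exp_series a b u w h (rho u h r) (sig 31 w h s)).
have SeB : `|h * (31 * h) * Se| <= Cp * (3 * pi) ^+ 2 * h ^+ 5.
  rewrite normrM ger0_norm; last by nneg.
  apply: le_trans (_ : h * (31 * h) * (\sum_(r < n) \sum_(s < n)
     Cp * h ^+ 5 * ((1 + rho u h r ^+ 2) * (1 + sig 31 w h s ^+ 2))^-1) <= _).
    apply: ler_wpM2l; first by nneg.
    apply: le_trans (ler_norm_sum _ _ _) _; apply: ler_sum => r _.
    apply: le_trans (ler_norm_sum _ _ _) _; apply: ler_sum => s _.
    by apply: (HCp h r s _ _ _ erefl erefl); rewrite h0.
  under eq_bigr do rewrite -mulr_sumr.
  rewrite -mulr_sumr [leLHS]mulrCA [leRHS]mulrAC ler_wpM2l//; first by nneg.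
  exact: double_lattice_sum_le.
have ZE : Zsum a b (h ^+ 2) n * expR (- log_peak a b u w D E (h ^+ 2)) =
   Se + (Sg [:: (1%R, (0%N, 0%N))] + h * Sg (exp_coef a b u w 1) + h ^+ 2 * Sg (exp_coef a b u w 2) +
    h ^+ 3 * Sg (exp_coef a b u w 3) + h ^+ 4 * Sg (exp_coef a b u w 4)).
  rewrite /Zsum /Se /Sg mulr_suml !mulr_sumr -!big_split; apply: eq_bigr => r _ /=.
  rewrite mulr_suml !mulr_sumr -!big_split; apply: eq_bigr => s _ /=.
  rewrite -expRD /exp_series -/(saddle_form u w (rho u h r) (sig 31 w h s)).
  have -> : beval [:: (1%R, (0%N, 0%N))] (rho u h r) (sig 31 w h s) = 1.
    by rewrite /beval big_cons big_nil /= !mulr1 addr0.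
  ring.
rewrite ZE.
have hk k : h ^+ k <= 1 by rewrite exprn_ile1// ltW.
have hB k B (X : R) : 0 <= B -> `|X| <= B * h ^+ 5 -> `|h ^+ k * X| <= B * h ^+ 5.
  move=> B0' HX; rewrite normrM ger0_norm; last by nneg.
  by apply: le_trans HX; rewrite ler_piMl.
have {}HB1 := hB 1%N _ _ B10 HB1; have {}HB2 := hB 2%N _ _ B20 HB2.
have {}HB3 := hB 3%N _ _ B30 HB3; have {}HB4 := hB 4%N _ _ B40 HB4.
move: (gcoef _ _ _ _ _) (gcoef _ _ _ _ _) HB2 HB4 => G4 G2 HB2 HB4.
move: Se SeB (Sg _) (Sg _) (Sg _) (Sg _) (Sg _) HB0 HB1 HB2 HB3 HB4 {ZE}.
move=> Se SeB T4 T3 T2 T1 T0 HB0 HB1 HB2 HB3 HB4.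
rewrite [leRHS]mulrDl ![in leRHS](mulrDl _ _ (h ^+ 5)).
rewrite [X in `|X|](_ : _ = h * (31 * h) * Se + ((h * (31 * h) * T0 - g1 * g2) + 
  h ^+ 1 * (h * (31 * h) * T1) + h ^+ 2 * (h * (31 * h) * T2 - g1 * g2 * G2) +
  h ^+ 3 * (h * (31 * h) * T3) + h ^+ 4 * (h * (31 * h) * T4 - g1 * g2 * G4))); last by ring.
by apply: normD_le => //; do !apply: normD_le.
Qed.
End SumAsymptotics.

Section LogAsymptotics.
Variable R : realType.
Implicit Types (D E : R -> R) (a b u w lo hi C h t v x y : R).
Local Open Scope classical_set_scope.

Lemma ln_taylor2 (p : R) : `|p| <= 2^-1 -> `|ln (1 + p) - (p - p ^+ 2 / 2)| <= 2 * `|p| ^+ 3.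
Proof.
move=> p2; have /andP[pl pr] : - 2^-1 <= p <= 2^-1 by rewrite -ler_norml.
pose f v : R := ln (1 + v) - (v - v ^+ 2 / 2).
have fd v : - 2^-1 <= v -> is_derive v 1 f (v ^+ 2 / (1 + v)).
  move=> v2; have v0 : 0 < 1 + v by lra.
  have l1 : is_derive v 1 (fun z : R => ln (1 + z)) (1 * (1 + v)^-1).
    have K : is_derive v 1 (fun z : R => 1 + z) 1.
      by have := is_deriveD (is_derive_cst (1 : R) v 1) (is_derive_id v 1); rewrite add0r.
    have := @is_derive1_comp R (@ln R) (fun z : R => 1 + z) v _ _ (is_derive1_ln v0) K.
    by rewrite mulrC.
  have l2 : is_derive v 1 (fun z : R => z - z ^+ 2 / 2) (1 - v).
    apply: is_derive_eq; rewrite /GRing.scale /=; lra.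
  have := is_deriveB l1 l2; rewrite (_ : 1 * _ - _ = v ^+ 2 / (1 + v))//.
  by field; rewrite gt_eqF.
have fb v : `|v| <= `|p| -> `|v ^+ 2 / (1 + v)| <= 2 * `|p| ^+ 2.
  move=> vp; have /andP[vl _] : - 2^-1 <= v <= 2^-1.
    by rewrite -ler_norml (le_trans vp).
  have v0 : 0 < 1 + v by lra.
  rewrite normrM (mulrC 2) normrX ler_pM ?normr_ge0//.
    by rewrite lerXn2r ?nnegrE.
  by rewrite normfV ger0_norm ?(ltW v0)// invf_ple ?posrE//; lra.
have f0 : f 0 = 0 by rewrite /f addr0 ln1; lra.
have [p0|p0] := leP 0 p.
  have [v /andP[v0 _]|c cx] := @MVT_le R f (fun v => v ^+ 2 / (1 + v)) 0 p p0.
    by apply: fd; lra.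
  rewrite f0 subr0 subr0 -/(f p) => ->; rewrite normrM [`|p| ^+ 3]exprSr mulrA ler_wpM2r//.
  by apply: fb; rewrite !ger0_norm//; lra.
have [v /andP[v0 _]|c cx] := @MVT_le R f (fun v => v ^+ 2 / (1 + v)) p 0 (ltW p0).
  by apply: fd; lra.
rewrite f0 !sub0r => /(congr1 -%R); rewrite opprK -/(f p) => ->.
rewrite normrN normrM normrN [`|p| ^+ 3]exprSr mulrA ler_wpM2r//.
by apply: fb; rewrite !ler0_norm//; lra.
Qed.

Lemma ln_expansion (ga g2 g4 C : R) : 0 < ga -> 0 <= C ->
  exists2 C', 0 <= C' & exists2 h0, 0 < h0 & forall h X, 0 < h <= h0 ->
    `|X - ga * (1 + g2 * h ^+ 2 + g4 * h ^+ 4)| <= C * h ^+ 5 ->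
    0 < X /\ `|ln X - (ln ga + g2 * h ^+ 2 + (g4 - g2 ^+ 2 / 2) * h ^+ 4)| <= C' * h ^+ 5.
Proof.
move=> ga0 C0; pose M := `|g2| + (`|g4| + C / ga).
have Cga0 : 0 <= C / ga by rewrite divr_ge0// ltW.
have M0 : 0 <= M by rewrite /M; nneg.
exists (2 * M ^+ 3 + C / ga + M ^+ 2); first by nneg.
exists (1 + 2 * M)^-1; first by rewrite invr_gt0; lra.
move=> h X /andP[h0 hh0].
have h1 : h * (1 + 2 * M) <= 1 by rewrite -ler_pdivlMr ?div1r//; lra.
have hle1 : h <= 1 by nra.
have Mh : M * h ^+ 2 <= 2^-1.
  rewrite expr2 mulrA; apply: le_trans (_ : M * h * 1 <= _); last by lra.
  by rewrite ler_wpM2l//; nneg.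
have h2 : 0 <= h ^+ 2 by nneg.
have h4 : 0 <= h ^+ 4 by nneg.
have h5 : 0 <= h ^+ 5 by nneg.
have h42 : h ^+ 4 <= h ^+ 2 by rewrite (exprD h 2 2) ler_piMr// exprn_ile1// ltW.
have h54 : h ^+ 5 <= h ^+ 4 by rewrite exprSr ler_piMr.
have h65 : h ^+ 6 <= h ^+ 5 by rewrite exprSr ler_piMr.
set P := g2 * h ^+ 2 + g4 * h ^+ 4 => HX.
pose e := X / ga - (1 + P).
have He : `|e| <= C / ga * h ^+ 5.
  rewrite mulrAC ler_pdivlMr// -[X in _ * X](ger0_norm (ltW ga0)) -normrM.
  by apply: le_trans HX; apply/eqW; congr `|_|; rewrite /e /P; field; rewrite gt_eqF.
pose q := g4 * h ^+ 4 + e; pose p := g2 * h ^+ 2 + q.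
have Hq : `|q| <= (`|g4| + C / ga) * h ^+ 4.
  rewrite mulrDl; apply: normD_le; first by rewrite normrM (ger0_norm h4).
  by apply: le_trans He _; rewrite ler_wpM2l.
have Hp : `|p| <= M * h ^+ 2.
  rewrite /M mulrDl; apply: normD_le; first by rewrite normrM (ger0_norm h2).
  by apply: le_trans Hq _; rewrite ler_wpM2l//; nneg.
have p2 : `|p| <= 2^-1 by exact: le_trans Hp Mh.
have XE : X = ga * (1 + p) by rewrite /p /q /e /P; field; rewrite gt_eqF.
have p10 : 0 < 1 + p by move: p2; rewrite ler_norml; lra.
split; first by rewrite XE mulr_gt0.
have lnE : ln X = ln ga + ln (1 + p) by rewrite XE lnM ?posrE.
pose d := ln (1 + p) - (p - p ^+ 2 / 2).
rewrite [X in `|X|](_ : _ = d + e - (p + g2 * h ^+ 2) / 2 * q); last first.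
  by rewrite lnE /d /p /q; move: (ln _) (ln _) => l1 l2; field.
rewrite ![in leRHS](mulrDl _ _ (h ^+ 5)); apply: normD_le; first apply: normD_le => //.
  apply: le_trans (ln_taylor2 p2) _; rewrite -mulrA ler_wpM2l//.
  apply: le_trans (_ : (M * h ^+ 2) ^+ 3 <= _); first by rewrite lerXn2r ?nnegrE//; nneg.
  by rewrite exprMn -exprM ler_wpM2l//; nneg.
rewrite normrN; apply: le_trans (_ : M * h ^+ 2 * (M * h ^+ 4) <= _).
  apply: normM_le.
    have Hg : `|g2 * h ^+ 2| <= M * h ^+ 2.
      by rewrite normrM (ger0_norm h2) ler_wpM2r// /M lerDl; nneg.
    rewrite normrM [X in _ * X]ger0_norm//.
    by have := normD_le Hp Hg; move: `|_| => z; lra.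
  by apply: le_trans Hq _; rewrite ler_wpM2r// /M lerDr.
rewrite (_ : M * _ * _ = M ^+ 2 * h ^+ 6); last by ring.
by rewrite ler_wpM2l//; nneg.
Qed.

Definition Zlim a b t : R := limn (Zsum a b t).

Lemma Zsum_homo a b t : {homo Zsum a b t : n m / (n <= m)%N >-> n <= m}.
Proof.
apply/nondecreasing_seqP => n; rewrite /Zsum big_ord_recr /=.
rewrite -[leLHS]addr0 lerD//; last by apply: sumr_ge0 => s _; exact: expR_ge0.
by apply: ler_sum => r _; rewrite big_ord_recr /= lerDl expR_ge0.
Qed.

Lemma Zlim_asymptotics a b u w D E lo hi C0 : saddle u w ->
  qp_expansion u w D E lo hi C0 ->
  exists c0, exists2 C, 0 <= C & exists2 h0, 0 < h0 &
  forall h, 0 < h <= h0 ->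
  [/\ Zsum a b (h ^+ 2) @ \oo --> Zlim a b (h ^+ 2), 0 < Zlim a b (h ^+ 2) &
   `|ln (Zlim a b (h ^+ 2)) - (log_peak a b u w D E (h ^+ 2) + c0 - 2 * ln h +
       gcoef a b u w 2 * h ^+ 2 +
       (gcoef a b u w 4 - gcoef a b u w 2 ^+ 2 / 2) * h ^+ 4)| <= C * h ^+ 5].
Proof.
move=> sad qpe; have [ga ga0 [C C_ge0 [h0 h00 H]]] := Zsum_asymptotics a b sad qpe.
have [C' C'0 [h1 h10 H']] := ln_expansion (gcoef a b u w 2) (gcoef a b u w 4) ga0 C_ge0.
exists (ln ga - ln 31), C' => //; exists (Num.min h0 h1); first by rewrite lt_min h00.
move=> h /andP[hp]; rewrite le_min => /andP[hh0 hh1].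
have /H[n0 Hn] : 0 < h <= h0 by rewrite hp.
set k := log_peak a b u w D E (h ^+ 2) in Hn *.
pose m := 31 * h ^+ 2 * expR (- k).
have m0 : 0 < m by rewrite !mulr_gt0 ?expR_gt0 ?exprn_gt0.
set c := ga * _ in Hn.
have {}Hn n : (n0 <= n)%N -> `|m * Zsum a b (h ^+ 2) n - c| <= C * h ^+ 5.
  by move=> /Hn; apply: le_trans; apply/eqW; congr `|_|; rewrite /m; ring.
(* The partial sums increase with [n], and the asymptotic estimate bounds them for large [n];
   convergence follows from it. *)
have cv : Zsum a b (h ^+ 2) @ \oo --> Zlim a b (h ^+ 2).
  apply: (@near_nondecreasing_is_cvgn _ _ ((c + C * h ^+ 5) / m)).
    by apply: nearW => n; exact: Zsum_homo.
  exists n0 => // n /= /Hn; rewrite ler_norml => /andP[_].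
  by rewrite ler_pdivlMr// [_ * m]mulrC lerBlDl.
have HZ : `|m * Zlim a b (h ^+ 2) - c| <= C * h ^+ 5.
  apply: (@ler_cvg_to _ \oo _ _ (fun n => `|m * Zsum a b (h ^+ 2) n - c|) (fun=> C * h ^+ 5)).
  - by apply: cvg_norm; apply: cvgB; [apply: cvgMr | exact: cvg_cst].
  - exact: cvg_cst.
  - by exists n0 => // n /= /Hn.
have hh : 0 < h <= h1 by rewrite hp.
have [X0 HX] := H' h _ hh HZ.
have Z0 : 0 < Zlim a b (h ^+ 2) by move: X0; rewrite pmulr_rgt0.
split => //; apply: le_trans HX; apply/eqW; congr `|_|.
have lnm : ln m = ln 31 + 2 * ln h - k.
  have h20 : 0 < h ^+ 2 by rewrite exprn_gt0.
  rewrite /m lnM ?posrE ?mulr_gt0 ?expR_gt0// expRK; congr (_ - _).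
  by rewrite lnM ?posrE// lnXn// mulr_natl.
by rewrite lnM ?posrE// lnm; ring.
Qed.

(** [4 / 3 = (1 + 31) / 24] collects the two terms [t/24], and [3 = 4 - 1] comes from [t^2] at [2 t]
    and at [t]. The [- ln 2] from the cell area cancels against the [ln 2 / 2] of each
    q-factorial. *)
Lemma double_combine (t h4 l1 l2 e1 e2 e3 e4 ka k ab lq lh ln2 c0 g2 c2 B1 B2 B3 B4 : R) :
  t != 0 ->
  `|l1 - (- (ka / t) - ab - lq / 2 - e1 - e3 + c0 - 2 * lh + g2 * t + c2 * h4)| <= B1 ->
  `|l2 - (- (ka / (2 * t)) - ab - lq / 2 - e2 - e4 + c0 - (ln2 + 2 * lh) + g2 * (2 * t) +
     c2 * (4 * h4))| <= B2 ->
  `|e2 - e1 - (k / t - ln2 / 2 + t / 24)| <= B3 ->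
  `|e4 - e3 - (k / (31 * t) - ln2 / 2 + 31 * t / 24)| <= B4 ->
  `|l2 - l1 - ((ka / 2 - k - k / 31) / t + (g2 - 4 / 3) * t + 3 * c2 * h4)| <= B2 + B1 + B3 + B4.
Proof.
move=> tN; set f1 := (X in `|X| <= B1); set f2 := (X in `|X| <= B2).
set f3 := (X in `|X| <= B3); set f4 := (X in `|X| <= B4) => L1 L2 E1 E2.
rewrite [X in `|X|](_ : _ = f2 - f1 - f3 - f4); last by rewrite /f1 /f2 /f3 /f4; field.
by do 3 ! (apply: normD_le; rewrite ?normrN//).
Qed.

Lemma ln_Zlim_double a b u w : saddle u w ->
  exists be : R, exists2 C, 0 <= C & exists2 h0, 0 < h0 & forall h, 0 < h <= h0 ->
  [/\ Zsum a b (h ^+ 2) @ \oo --> Zlim a b (h ^+ 2), 0 < Zlim a b (h ^+ 2) &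
   `|ln (Zlim a b (2 * h ^+ 2)) - ln (Zlim a b (h ^+ 2)) -
     (be / h ^+ 2 + (gcoef a b u w 2 - 4 / 3) * h ^+ 2 +
       3 * (gcoef a b u w 4 - gcoef a b u w 2 ^+ 2 / 2) * h ^+ 4)| <= C * h ^+ 5].
Proof.
move=> sad; have [u0 w0 _ _] := sad.
pose lo := Num.min u w / 2; pose hi := 2 * (u + w).
have m0 : 0 < Num.min u w by rewrite lt_min u0.
have mu : Num.min u w <= u by rewrite ge_min lexx.
have mw : Num.min u w <= w by rewrite ge_min lexx orbT.
have lo0 : 0 < lo by rewrite /lo; lra.
have lohi : 4 * lo <= hi by rewrite /lo /hi; lra.
have [D [E [k [C1 [C10 Dd HE HE2]]]]] := ln_qpoch_asymptotics lo0 lohi.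
have qpe : qp_expansion u w D E lo hi C1 by split => //; rewrite /lo /hi; lra.
have [c0 [C C_ge0 [h0 h00 H]]] := Zlim_asymptotics a b sad qpe.
(* Scaling [h] by the square root of 2 doubles [t = h^2]. *)
pose s2 : R := Num.sqrt 2; have s20 : 0 < s2 by rewrite sqrtr_gt0.
have s2E : s2 ^+ 2 = 2 by rewrite sqr_sqrtr.
have s22 : s2 <= 2 by rewrite -s2E expr2 ler_peMl ?(ltW s20)// -[1]sqrtr1 ler_wsqrtr// ler1n.
set ka := 3 * u ^+ 2 + u * w + 3 * w ^+ 2 / 31 + D u + D w / 31.
exists (ka / 2 - k - k / 31).
exists (C * 32 + C + C1 + C1 * 31 ^+ 3); first by nneg.
pose h1 := Num.min 1 (Num.min (h0 / 2) (hi / (4 * 31))).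
exists h1; first by rewrite !lt_min ltr01 /hi; apply/andP; split; [|apply/andP; split]; lra.
move=> h /andP[hp]; rewrite !le_min => /and3P[h1' hh0 hhi].
have /H[cv Z0 L1] : 0 < h <= h0 by lra.
split=> //; have hN : h != 0 by rewrite gt_eqF.
have h2hi : h ^+ 2 <= hi / (4 * 31).
  by apply: le_trans hhi; rewrite expr2 ler_piMr// ltW.
have h20 : 0 < h ^+ 2 by rewrite exprn_gt0.
have /H[_ _ L2] : 0 < s2 * h <= h0 by rewrite mulr_gt0//=; nra.
have E1 : `|E (2 * h ^+ 2) - E (h ^+ 2) - (k / h ^+ 2 - ln 2 / 2 + h ^+ 2 / 24)| <= C1 * (h ^+ 2) ^+ 3.
  by apply: HE2 => //; lra.
have E2 : `|E (2 * (31 * h ^+ 2)) - E (31 * h ^+ 2) -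
    (k / (31 * h ^+ 2) - ln 2 / 2 + 31 * h ^+ 2 / 24)| <= C1 * (31 * h ^+ 2) ^+ 3.
  by apply: HE2; lra.
have ls2 : 2 * ln (s2 * h) = ln 2 + 2 * ln h.
  have -> : ln 2 = 2 * ln s2 by rewrite -[X in ln X]s2E lnXn// mulr_natl.
  by rewrite lnM ?posrE// mulrDr.
have s4 : (s2 * h) ^+ 4 = 4 * h ^+ 4.
  by rewrite exprMn (exprM s2 2 2) s2E; congr (_ * _); ring.
have L2b : C * (s2 * h) ^+ 5 <= C * 32 * h ^+ 5.
  rewrite exprMn mulrA ler_wpM2r//; first by nneg.
  rewrite ler_wpM2l//; apply: le_trans (_ : 2 ^+ 5 <= _); last by rewrite -natrX ler_nat.
  by rewrite lerXn2r ?nnegrE// ltW.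
have {}L2 := le_trans L2 L2b.
have h65 : h ^+ 6 <= h ^+ 5 by rewrite exprSr ler_piMr//; nneg.
have {}E1 : `|E (2 * h ^+ 2) - E (h ^+ 2) - (k / h ^+ 2 - ln 2 / 2 + h ^+ 2 / 24)| <= C1 * h ^+ 5.
  by apply: le_trans E1 _; rewrite -exprM ler_wpM2l.
have {}E2 : `|E (2 * (31 * h ^+ 2)) - E (31 * h ^+ 2) -
    (k / (31 * h ^+ 2) - ln 2 / 2 + 31 * h ^+ 2 / 24)| <= C1 * 31 ^+ 3 * h ^+ 5.
  by apply: le_trans E2 _; rewrite exprMn -exprM mulrA ler_wpM2l//; nneg.
move: L2; rewrite ls2 s4 exprMn s2E => L2.
rewrite /log_peak -/ka in L1 L2; rewrite (mulrCA 31 2) in L2.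
rewrite ![in leRHS](mulrDl _ _ (h ^+ 5)); apply: double_combine L1 L2 E1 E2.
by rewrite gt_eqF.
Qed.
End LogAsymptotics.

(** * The expansion at the cusp 0 *)

Section PuiseuxLogarithm.
Variable R : realType.
Implicit Types (v : nat -> R) (a b c h t x y C p q r : R) (N m n k : nat).
Local Open Scope classical_set_scope.

Lemma eq0_of_linear_bound p C h0 : 0 < h0 -> 0 <= C ->
  (forall h, 0 < h <= h0 -> `|p| <= C * h) -> p = 0.
Proof.
move=> h00 C0 H; apply/eqP/contraT; rewrite -normr_gt0 => p0.
have C1 : 0 < 2 * (C + 1) by lra.
pose h := Num.min h0 (`|p| / (2 * (C + 1))).
have hp : 0 < h by rewrite lt_min h00 divr_gt0.
have /H : 0 < h <= h0 by rewrite hp ge_min lexx.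
have : h * (2 * (C + 1)) <= `|p| by rewrite -ler_pdivlMr// ge_min lexx orbT.
by move: p0 C0 hp; clear; nra.
Qed.

Lemma coefficients_eq0 p q r C h0 : 0 < h0 -> 0 <= C ->
  (forall h, 0 < h <= h0 -> `|p / h ^+ 2 + q * h ^+ 2 + r * h ^+ 4| <= C * h ^+ 5) ->
  q = 0 /\ r = 0.
Proof.
move=> h00 C0 H; pose h1 := Num.min 1 h0.
have h10 : 0 < h1 by rewrite lt_min ltr01.
have {}H h : 0 < h <= h1 -> [/\ 0 < h, h <= 1 &
    `|p + q * h ^+ 4 + r * h ^+ 6| <= C * h ^+ 7].
  rewrite le_min => /and3P[hp hle hh0]; split => //.
  have /H : 0 < h <= h0 by rewrite hp.
  rewrite -(ler_pM2r (exprn_gt0 2 hp)) -[X in `|_| * X](ger0_norm (exprn_ge0 2 (ltW hp))).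
  rewrite -normrM -mulrA -exprD; apply: le_trans.
  by apply/eqW; congr `|_|; field; rewrite gt_eqF.
have hk h n : 0 < h -> h <= 1 -> 0 <= h ^+ n <= 1.
  by move=> hp h1'; rewrite exprn_ge0 ?exprn_ile1 ?(ltW hp).
have p0 : p = 0.
  apply: (@eq0_of_linear_bound _ (C + `|q| + `|r|) h1) => //; first by nneg.
  move=> h /H[hp hle Hh].
  rewrite (_ : p = (p + q * h ^+ 4 + r * h ^+ 6) - q * h ^+ 4 - r * h ^+ 6); last by ring.
  have /andP[k3 k3'] := hk h 3%N hp hle; have /andP[k5 k5'] := hk h 5%N hp hle.
  have /andP[k6 k6'] := hk h 6%N hp hle.
  rewrite ![in leRHS](mulrDl _ _ h); apply: normD_le; [apply: normD_le|]; rewrite ?normrN.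
  - apply: le_trans Hh _; rewrite ler_wpM2l// exprS ler_piMr// ltW//.
  - rewrite normrM ler_wpM2l// ger0_norm; last by nneg.
    by rewrite exprS ler_piMr// ltW.
  - rewrite normrM ler_wpM2l// ger0_norm; last by nneg.
    by rewrite exprS ler_piMr// ltW.
have q0 : q = 0.
  apply: (@eq0_of_linear_bound _ (C + `|r|) h1) => //; first by nneg.
  move=> h /H[hp hle]; rewrite p0 add0r => Hh.
  have {Hh} : `|q + r * h ^+ 2| <= C * h ^+ 3.
    rewrite -(ler_pM2r (exprn_gt0 4 hp)) -[X in `|_| * X](ger0_norm (exprn_ge0 4 (ltW hp))).
    by rewrite -normrM -mulrA -exprD; apply: le_trans Hh; apply/eqW; congr `|_|; ring.
  move=> Hh; have /andP[k2 k2'] := hk h 2%N hp hle.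
  rewrite (_ : q = (q + r * h ^+ 2) - r * h ^+ 2); last by ring.
  rewrite ![in leRHS](mulrDl _ _ h); apply: normD_le; rewrite ?normrN.
  - by apply: le_trans Hh _; rewrite ler_wpM2l// exprS ler_piMr// ltW.
  - rewrite normrM ler_wpM2l// ger0_norm; last by nneg.
    by rewrite expr2 ler_piMr// ltW.
split=> //; apply: (@eq0_of_linear_bound _ C h1) => //.
move=> h /H[hp hle]; rewrite p0 q0 mul0r !add0r => Hh.
rewrite -(ler_pM2r (exprn_gt0 6 hp)) -mulrA -exprS.
by apply: le_trans Hh; rewrite normrM (ger0_norm (exprn_ge0 6 (ltW hp))).
Qed.

Lemma power_series_leading v y1 n0 : 0 < y1 ->
  cvgn (series (fun n => v n * y1 ^+ n)) -> (forall n, (n < n0)%N -> v n = 0) ->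
  exists2 C, 0 <= C & forall y l, 0 < y <= y1 / 2 ->
    series (fun n => v n * y ^+ n) @ \oo --> l ->
    `|l - v n0 * y ^+ n0| <= C * y ^+ n0.+1.
Proof.
move=> y10 /cvg_series_cvg_0 c0 v0.
have [M M0 HM] : exists2 M, 0 <= M & forall n, `|v n * y1 ^+ n| <= M.
  have [M [_ HM]] : bounded_fun (fun n => v n * y1 ^+ n).
    by apply: cvg_seq_bounded; apply/cvg_ex; exists 0.
  exists (`|M| + 1) => [|n]; first by nneg.
  by apply: (HM (`|M| + 1)) => //; have := ler_norm M; lra.
exists (2 * M / y1 ^+ n0.+1) => [|y l /andP[yp yy1] cl]; first by rewrite divr_ge0 ?exprn_ge0; nneg.
have z0 : 0 <= y / y1 by rewrite divr_ge0// ltW.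
have z2 : y / y1 <= 2^-1 by rewrite ler_pdivrMr// mulrC.
pose z := y / y1; have zE k : y ^+ k = y1 ^+ k * z ^+ k.
  by rewrite -exprMn /z mulrCA divff ?mulr1// gt_eqF.
(* As [z <= 1/2], [z^k <= 2 (z^k - z^(k+1))], so the geometric tail telescopes. *)
have tail n : `|series (fun n => v n * y ^+ n) (n0.+1 + n)%N - v n0 * y ^+ n0| <=
    M * (2 * (z ^+ n0.+1 - z ^+ (n0.+1 + n))).
  elim: n => [|n IH].
    rewrite addn0 subrr !mulr0 /series /= big_nat_recr//= big_nat big1 ?add0r ?subrr ?normr0//.
    by move=> k /andP[_ kn]; rewrite v0// mul0r.
  rewrite addnS -[series _ _](subrK (series (fun n => v n * y ^+ n) (n0.+1 + n)%N)) seriesSB.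
  rewrite -addrA; apply: le_trans (ler_normD _ _) _.
  have Hk : `|v (n0.+1 + n)%N * y ^+ (n0.+1 + n)| <= M * z ^+ (n0.+1 + n).
    rewrite zE mulrA normrM (ger0_norm (exprn_ge0 _ z0)) ler_wpM2r//.
    exact: exprn_ge0.
  apply: le_trans (lerD Hk IH) _.
  rewrite -mulrDr ler_wpM2l// [z ^+ (_ + n).+1]exprS.
  have := exprn_ge0 (n0.+1 + n) z0; rewrite -/z.
  move: (z ^+ (n0.+1 + n)) (z ^+ n0.+1) z2 => k s; rewrite -/z.
  by clear; nra.
apply: (@ler_cvg_to _ \oo _ _ (fun n => `|series (fun n => v n * y ^+ n) n - v n0 * y ^+ n0|)
    (fun=> 2 * M / y1 ^+ n0.+1 * y ^+ n0.+1)).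
- by apply: cvg_norm; apply: cvgB => //; exact: cvg_cst.
- exact: cvg_cst.
exists n0.+1 => // n /= n0n; rewrite -(subnKC n0n); apply: le_trans (tail _) _.
rewrite -(mulrA (2 * M)) (mulrC _ (y ^+ n0.+1)) -exprVn -exprMn -/z mulrCA mulrA.
rewrite ler_wpM2l//; first by nneg.
by rewrite lerBlDr lerDl exprn_ge0.
Qed.

Lemma ln_power_series v (n0 : nat) y1 : 0 < y1 ->
  cvgn (series (fun n => v n * y1 ^+ n)) -> (forall n, (n < n0)%N -> v n = 0) -> v n0 != 0 ->
  exists2 C, 0 <= C & exists2 y2, 0 < y2 & forall y (l : R), 0 < y <= y2 -> 0 < l ->
    series (fun n => v n * y ^+ n) @ \oo --> l ->
    `|ln l - (ln `|v n0| + n0%:R * ln y)| <= C * y.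
Proof.
move=> y10 cv v0 vN; have [C C0 H] := power_series_leading y10 cv v0.
have V0 : 0 < `|v n0| by rewrite normr_gt0.
pose C' := C / `|v n0|; have C'0 : 0 <= C' by rewrite divr_ge0.
exists (2 * C'); first by nneg.
exists (Num.min (y1 / 2) (1 + 2 * C')^-1).
  by rewrite lt_min divr_gt0//= invr_gt0; lra.
move=> y l /andP[yp]; rewrite le_min => /andP[yy1 yC] l0 cl.
have {}H : `|l - `|v n0| * y ^+ n0| <= C * y ^+ n0.+1.
  have /H/(_ cl) : 0 < y <= y1 / 2 by rewrite yp.
  apply: le_trans; rewrite -[X in `|X - _ * _|](ger0_norm (ltW l0)).
  by rewrite -[X in `|_ - _ * X|](ger0_norm (exprn_ge0 n0 (ltW yp))) -normrM ler_dist_dist.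
have yn : 0 < y ^+ n0 by rewrite exprn_gt0.
pose p := l / (`|v n0| * y ^+ n0) - 1.
have pE : l = `|v n0| * y ^+ n0 * (1 + p).
  by rewrite /p addrC subrK mulrCA divff ?mulr1// mulf_neq0 ?gt_eqF.
have pb : `|p| <= C' * y.
  rewrite -(ler_pM2r (mulr_gt0 V0 yn)) -[X in `|_| * X](ger0_norm (ltW (mulr_gt0 V0 yn))) -normrM.
  rewrite (_ : p * _ = l - `|v n0| * y ^+ n0).
    apply: le_trans H _; rewrite exprS; apply/eqW; rewrite /C'; field; exact: lt0r_neq0.
  by rewrite [X in _ = X - _]pE; ring.
have y1' : y * (1 + 2 * C') <= 1 by rewrite -ler_pdivlMr ?div1r//; lra.
have p2 : `|p| <= 2^-1 by apply: le_trans pb _; lra.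
have p10 : 0 < 1 + p by move: p2; rewrite ler_norml; lra.
have := ln_taylor2 p2; rewrite pE lnM ?posrE ?mulr_gt0// lnM ?posrE// lnXn//.
move: (ln _) (ln _) (ln (1 + p)) => L1 L2 L HL.
rewrite (_ : L2 + L1 *+ n0 + L - (L2 + n0%:R * L1) = L); last by rewrite -mulr_natl; ring.
have : `|L| <= `|p| + `|p| ^+ 2 / 2 + 2 * `|p| ^+ 3.
  rewrite -[L](subrK (p - p ^+ 2 / 2)) addrC; apply: normD_le => //.
  apply: normD_le => //; rewrite normrN normrM normrX [X in _ * X]ger0_norm//.
move: (normr_ge0 p) p2 pb; move: `|p| `|L| => P Q P0 P2 Pb HQ.
have : P ^+ 2 <= P / 2 by rewrite expr2 ler_wpM2l.
have : P ^+ 3 <= P / 4 by move: P0 P2; clear; nra.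
by move: HQ Pb P0; clear; lra.
Qed.

(** [y] is [q^(1/N)] at [tau = 2 pi i / t], so [ln y] is a multiple of [1/t]: the lowest power of
    [y] yields the terms [al/t + c0], and the rest of the series is [O(y)], smaller than any power
    of [t]. *)
Lemma puiseux_asymptotics (N : nat) m v c (Z : R -> R) t1 : (0 < N)%N -> 0 < t1 ->
  (forall t, 0 < t <= t1 -> 0 < Z t) ->
  (forall t y, 0 < t <= t1 -> y = expR (- (4 * pi ^+ 2 / N%:R / t)) ->
    series (fun n => v n * y ^+ n) @ \oo --> expR (- (c * t)) * Z t * y ^+ m) ->
  exists al c0 : R, exists2 C, 0 <= C & exists2 t0, 0 < t0 & forall t, 0 < t <= t0 ->
    `|ln (Z t) - (al / t + c0 + c * t)| <= C * t ^+ 3.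
Proof.
move=> N0 t10 Zp H; pose K := 4 * pi ^+ 2 / N%:R : R.
have K0 : 0 < K by rewrite divr_gt0 ?ltr0n// mulr_gt0// exprn_gt0// pi_gt0.
pose yy t := expR (- (K / t)).
have y0 t : 0 < yy t by exact: expR_gt0.
have {}H t : 0 < t -> t <= t1 ->
    0 < expR (- (c * t)) * Z t * yy t ^+ m /\
    series (fun n => v n * yy t ^+ n) @ \oo --> expR (- (c * t)) * Z t * yy t ^+ m.
  move=> tp tt1; split; last by apply: H => //; rewrite tp.
  by rewrite !mulr_gt0 ?expR_gt0 ?exprn_gt0// Zp// tp.
(* Some coefficient is nonzero because the sum of the series is positive. *)
have [n0 [vN v0]] : exists n0, v n0 != 0 /\ forall n, (n < n0)%N -> v n = 0.
  have [n vn] : exists n, v n != 0.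
    apply: contrapT => /forallNP v0.
    have [l0 cl] := H t1 t10 (lexx _).
    have z n : v n = 0 by apply/eqP; move: (v0 n) => /negP; rewrite negbK.
    have : series (fun n => v n * yy t1 ^+ n) @ \oo --> 0.
      rewrite (_ : series _ = fun=> 0); first exact: cvg_cst.
      by apply/funext => n; rewrite /series /= big1// => i _; rewrite z mul0r.
    by move=> /cvg_lim e0; move: l0; rewrite -(cvg_lim _ cl)// e0// ltxx.
  have ex : exists n, v n != 0 by exists n.
  exists (ex_minn ex); case: ex_minnP => k vk mk; split => // j jk.
  by apply/eqP; apply: contraLR jk => /mk; rewrite -leqNgt.
have [l1p cl1] := H t1 t10 (lexx _).
have cv : cvgn (series (fun n => v n * yy t1 ^+ n)) by apply/cvg_ex; eexists; exact: cl1.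
have [C C0 [y2 y20 HC]] := ln_power_series (y0 t1) cv v0 vN.
have [B B0 HB] := @expr_expRN_bounded R K 3 K0.
have [B1 B10 HB1] := @expr_expRN_bounded R K 1 K0.
exists ((m%:R - n0%:R) * K), (ln `|v n0|), (C * B); first by nneg.
exists (Num.min t1 (y2 / (1 + B1))).
  by rewrite lt_min t10 divr_gt0//; lra.
move=> t /andP[tp]; rewrite le_min => /andP[tt1 ty2].
have tN : t != 0 by rewrite gt_eqF.
have ti : 0 <= t^-1 by rewrite invr_ge0 ltW.
have yB : yy t <= B * t ^+ 3.
  rewrite -ler_pdivrMr ?exprn_gt0// mulrC -exprVn; exact: HB.
have yB1 : yy t <= y2.
  apply: le_trans (_ : B1 * t <= _).
    by rewrite -ler_pdivrMr// mulrC; have := HB1 _ ti; rewrite expr1.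
  apply: le_trans (_ : t * (1 + B1) <= _); first by rewrite mulrC ler_wpM2l ?(ltW tp)//; lra.
  by rewrite -ler_pdivlMr//; lra.
have [lp cl] := H t tp tt1.
have yb : 0 < yy t <= y2 by rewrite y0.
have := HC _ _ yb lp cl.
have Zt : 0 < Z t by apply: Zp; rewrite tp.
rewrite lnM ?posrE ?mulr_gt0 ?expR_gt0 ?exprn_gt0// lnM ?posrE ?expR_gt0// lnXn//.
rewrite /yy !expRK -/(yy t) => HCt.
apply: le_trans (_ : C * yy t <= _); last by rewrite -mulrA ler_wpM2l.
apply: le_trans HCt; apply/eqW; congr `|_|; rewrite -mulr_natl; ring.
Qed.
End PuiseuxLogarithm.

(** * Restriction to the imaginary axis *)

Section ImaginaryAxis.
Variable R : realType.
Implicit Types (a b c : rat) (t x y : R).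
Local Open Scope classical_set_scope.
Local Open Scope complex_scope.

Lemma ratr_complex c : ratr c = (ratr c : R)%:C :> R[i].
Proof. by rewrite -(fmorph_rat (real_complex R)). Qed.

Lemma qpow_imaginary c t : qpow c (0 +i* t) = (expR (- (2 * pi * ratr c * t)))%:C :> R[i].
Proof.
rewrite /qpow /cexp ratr_complex.
have -> : 2%:R * pi%:C * 'i * (ratr c)%:C * (0 +i* t) = (- (2 * pi * ratr c * t))%:C :> R[i].
  rewrite -[2%:R](rmorph_nat (real_complex R)) /=.
  by apply/eqP; rewrite eq_complex /=; apply/andP; split; apply/eqP; ring.
by rewrite /= cos0 sin0 mulr1.
Qed.

Lemma qpow1_imaginary t : qpow 1 (0 +i* (t / (2 * pi))) = (expR (- t))%:C :> R[i].
Proof.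
rewrite qpow_imaginary rmorph1; congr (expR (- _))%:C.
by have := lt0r_neq0 (pi_gt0 R); move: pi => p p0; field.
Qed.

Lemma qpochhammer_expR t n : 0 < t ->
  qpochhammer (expR (- t))%:C (expR (- t))%:C n = (expR (ln_qpoch t n))%:C :> R[i].
Proof.
move=> t0; rewrite /qpochhammer /ln_qpoch expR_sum rmorph_prod; apply: eq_bigr => j _.
rewrite /lnq lnK ?posrE; last by apply: lnq_arg_gt0; rewrite mulr_gt0.
rewrite mul1r rmorphB rmorph1 -rmorphXn -rmorphM; congr (1 - _%:C).
by rewrite -exprS -expRM_natl mulrN mulrC.
Qed.

Lemma ratr_F_exponent a b r s : ratr (F_exponent a b r s) =
  3 * r%:R ^+ 2 + 31 * r%:R * s%:R + 93 * s%:R ^+ 2 + ratr a * r%:R + ratr b * s%:R :> R.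
Proof.
have H (k l m : nat) : ratr (k%:R * r%:R ^+ 2 + l%:R * r%:R * s%:R + m%:R * s%:R ^+ 2 +
    a * r%:R + b * s%:R) = k%:R * r%:R ^+ 2 + l%:R * r%:R * s%:R + m%:R * s%:R ^+ 2 +
    ratr a * r%:R + ratr b * s%:R :> R.
  by rewrite !expr2 !rmorphD !rmorphM /= !ratr_nat.
exact: H.
Qed.

Lemma F_term_imaginary a b t r s : 0 < t ->
  F_term a b (0 +i* (t / (2 * pi))) r s =
  (expR (log_weight (ratr a) (ratr b) t r s))%:C :> R[i].
Proof.
move=> t0; rewrite /F_term qpow1_imaginary -rmorphXn /=.
have -> : expR (- t) ^+ 31 = expR (- (31 * t)) :> R.
  by rewrite -expRM_natl mulrN.
rewrite !qpochhammer_expR ?mulr_gt0// qpow_imaginary -rmorphM -fmorphV -rmorphM.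
congr _%:C; rewrite -expRD -expRN -expRD; congr expR.
rewrite ratr_F_exponent /log_weight.
by have := lt0r_neq0 (pi_gt0 R); move: pi => p p0; field.
Qed.

Lemma cvg_complex (u : nat -> R) (l : R) :
  u @ \oo --> l -> ((fun n => (u n)%:C) : complex_seq R) @ \oo --> (l%:C : R[i]^o).
Proof.
move=> /cvgrPdist_lt H; apply/cvgrPdist_lt => e e0.
have [k ke] : exists k : R, e = k%:C by apply/complex_realP; exact: gtr0_real.
have k0 : 0 < k by rewrite -ltcR -ke.
have := H k k0; apply: filterS => n Hn.
by rewrite ke -rmorphB normc_def /= expr0n addr0 sqrtr_sqr ltcR.
Qed.

Lemma cvg_Re (u : complex_seq R) (l : R[i]) :
  u @ \oo --> (l : R[i]^o) -> (fun n => complex.Re (u n)) @ \oo --> complex.Re l.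
Proof.
move=> /cvgrPdist_lt H; apply/cvgrPdist_lt => e e0.
have /H : 0 < e%:C :> R[i] by rewrite ltcR.
apply: filterS => n Hn; rewrite -ltcR; apply: le_lt_trans Hn.
by rewrite -raddfB; exact: normc_ge_Re.
Qed.

Lemma F_imaginary a b t : 0 < t ->
  Zsum (ratr a) (ratr b) t @ \oo --> Zlim (ratr a) (ratr b) t ->
  F a b (0 +i* (t / (2 * pi))) = (Zlim (ratr a) (ratr b) t)%:C :> R[i].
Proof.
move=> t0 /cvg_complex cv; rewrite /F.
rewrite (_ : (fun n => _) = (fun n => (Zsum (ratr a) (ratr b) t n)%:C)).
  exact: (cvg_lim (@norm_hausdorff _ _) cv).
apply/funext => n; rewrite /Zsum rmorph_sum; apply: eq_bigr => r _.
by rewrite rmorph_sum; apply: eq_bigr => s _; rewrite F_term_imaginary.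
Qed.

Definition Smx : 'M[int]_2 := \matrix_(i, j)
  if i == 0 then (if j == 0 then 0 else -1) else if j == 0 then 1 else 0.

Lemma Smx_SL2Z : SL2Z Smx.
Proof. rewrite /SL2Z /= (expand_det_row _ 0) !big_ord_recl big_ord0 /cofactor !det_mx11 !mxE /=.
by rewrite mul0r add0r addr0. Qed.

Lemma mobius_Smx t : 0 < t ->
  mobius Smx (0 +i* (2 * pi / t)) = 0 +i* (t / (2 * pi)) :> R[i].
Proof.
move=> t0; have p0 := pi_gt0 R.
rewrite /mobius !mxE /= mul0r add0r addr0 mul1r.
have cN : (0 +i* (2 * pi / t) : R[i]) != 0.
  by rewrite eq_complex /= eqxx /= gt_eqF// divr_gt0// mulr_gt0.
apply: (mulIf cN); rewrite divfK//.
apply/eqP; rewrite eq_complex /=; apply/andP; split; apply/eqP.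
  by move: pi p0 => p p0; field; rewrite !gt_eqF.
by ring.
Qed.

Lemma modular_asymptotics a b c h0 : 0 < h0 ->
  (forall t, 0 < t <= h0 -> 0 < Zlim (ratr a) (ratr b) t /\
     Zsum (ratr a) (ratr b) t @ \oo --> Zlim (ratr a) (ratr b) t) ->
  meromorphic_at_cusps (fun tau : R[i] => qpow c tau * F a b tau) ->
  exists al c0 : R, exists2 C, 0 <= C & exists2 t0, 0 < t0 & forall t, 0 < t <= t0 ->
    `|ln (Zlim (ratr a) (ratr b) t) - (al / t + c0 + ratr c * t)| <= C * t ^+ 3.
Proof.
move=> h00 HZ /(_ _ Smx_SL2Z) [N [m [u [Y [N0 Y0 H]]]]].
have pi0 := pi_gt0 R.
pose t1 := Num.min h0 (2 * pi / (Y + 1)).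
have t10 : 0 < t1 by rewrite lt_min h00 divr_gt0 ?mulr_gt0//; lra.
(* On the imaginary axis the powers of [q] and the function itself are real, so the real parts of
   the coefficients already represent it; multiplication by [y^m] clears the negative exponents. *)
apply: (@puiseux_asymptotics R N m (fun n => complex.Re (u n)) (ratr c) _ t1) => //.
  by move=> t /andP[t0]; rewrite le_min => /andP[th _]; apply HZ; rewrite t0.
move=> t y /andP[tp]; rewrite le_min => /andP[th tY] yE.
have [Zp cZ] : 0 < Zlim (ratr a) (ratr b) t /\
     Zsum (ratr a) (ratr b) t @ \oo --> Zlim (ratr a) (ratr b) t.
  by apply: HZ; rewrite tp.
have Yt : Y < complex.Im (0 +i* (2 * pi / t) : R[i]).
  rewrite /= ltr_pdivlMr//; apply: lt_le_trans (_ : (Y + 1) * t <= _).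
    by rewrite ltr_pM2r//; lra.
  by rewrite mulrC -ler_pdivlMr//; lra.
have y0 : 0 < y by rewrite yE expR_gt0.
have := H _ Yt; rewrite mobius_Smx// F_imaginary// qpow_imaginary.
rewrite (_ : 2 * pi * ratr c * (t / (2 * pi)) = ratr c * t); last first.
  by move: pi pi0 => p p0; field; rewrite gt_eqF.
rewrite -rmorphM => /cvg_Re /= cv.
have {}cv := cvgM cv (cvg_cst (y ^+ m)).
set g := (X in X @ \oo --> _) in cv; rewrite (_ : series _ = g); first exact: cv.
apply/funext => n; rewrite /g /series /= raddf_sum mulr_suml; apply: eq_bigr => k _.
have -> : qpow ((k%:R - m%:R) / N%:R) (0 +i* (2 * pi / t)) = (y ^+ k / y ^+ m)%:C :> R[i].
  rewrite qpow_imaginary; congr _%:C; rewrite yE -!expRM_natl -expRN -expRD; congr expR.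
  have -> : ratr ((k%:R - m%:R) / N%:R) = (k%:R - m%:R) / N%:R :> R.
    by rewrite rmorphM /= fmorphV rmorphB /= !ratr_nat.
  have NN : N%:R != 0 :> R by rewrite pnatr_eq0 -lt0n.
  have tN := lt0r_neq0 tp.
  by move: pi => p; field; rewrite NN tN.
case: (u k) => ur ui; rewrite /= mulr0 subr0 -mulrA divfK// gt_eqF// exprn_gt0//.
Qed.
End ImaginaryAxis.

Lemma double_difference (R : realType) (t t2 l1 l2 al be c0 c q r B1 B2 B3 : R) : t != 0 ->
  `|l1 - (al / t + c0 + c * t)| <= B1 ->
  `|l2 - (al / (2 * t) + c0 + c * (2 * t))| <= B2 ->
  `|l2 - l1 - (be / t + q * t + r * t2)| <= B3 ->
  `|(be + al / 2) / t + (q - c) * t + r * t2| <= B3 + B2 + B1.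
Proof.
move=> tN; set f1 := (X in `|X| <= B1); set f2 := (X in `|X| <= B2).
set f3 := (X in `|X| <= B3) => H1 H2 H3.
rewrite [X in `|X|](_ : _ = - f3 + f2 - f1); last by rewrite /f1 /f2 /f3; field.
by apply: normD_le; rewrite ?normrN//; apply: normD_le; rewrite ?normrN.
Qed.

Lemma modular_obstruction (R : realType) (a b c : rat) (u w : R) : saddle u w ->
  meromorphic_at_cusps (fun tau : R[i] => qpow c tau * F a b tau) ->
  let g k := gcoef (ratr a) (ratr b) u w k in
  g 2%N = 4 / 3 + ratr c /\ g 4%N = g 2%N ^+ 2 / 2.
Proof.
move=> sad mer g.
have [be [C C0 [h0 h00 H]]] := ln_Zlim_double (ratr a) (ratr b) sad.
move: H; rewrite -/(g 2%N) -/(g 4%N); move: (g 2%N) (g 4%N) => g2 g4 H {g}.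
have sq0 : 0 < h0 ^+ 2 by rewrite exprn_gt0.
have [|al [c0 [C' C'0 [t0 t00 H']]]] := modular_asymptotics sq0 _ mer.
  move=> t /andP[tp th]; have [] := H (Num.sqrt t).
    by rewrite sqrtr_gt0 tp -(ger0_norm (ltW h00)) -sqrtr_sqr ler_wsqrtr.
  by rewrite sqr_sqrtr ?(ltW tp).
pose h1 := Num.min (Num.min 1 h0) (t0 / 2).
have h10 : 0 < h1 by rewrite !lt_min ltr01 h00 divr_gt0.
have [||p0 q0] := @coefficients_eq0 R (be + al / 2) (g2 - 4 / 3 - ratr c)
  (3 * (g4 - g2 ^+ 2 / 2)) (C + C' * 8 + C') h1 h10.
- by nneg.
- move=> h /andP[hp]; rewrite !le_min => /andP[/andP[hle hh0] ht0].
  have h20 : 0 < h ^+ 2 by rewrite exprn_gt0.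
  have h2h : h ^+ 2 <= h by rewrite expr2 ler_piMl// ltW.
  have /H[_ _ HH] : 0 < h <= h0 by rewrite hp.
  have /H' H1 : 0 < h ^+ 2 <= t0 by rewrite h20; lra.
  have /H' H2 : 0 < 2 * h ^+ 2 <= t0 by rewrite mulr_gt0//; lra.
  rewrite ![in leRHS](mulrDl _ _ (h ^+ 5)).
  have h65 : (h ^+ 2) ^+ 3 <= h ^+ 5 by rewrite -exprM -[(2 * 3)%N]/(5.+1)%N exprSr ler_piMr//; nneg.
  have {}H1 := le_trans H1 (ler_wpM2l C'0 h65).
  have B2 : C' * (2 * h ^+ 2) ^+ 3 <= C' * 8 * h ^+ 5.
    by rewrite exprMn -natrX mulrA ler_wpM2l//; nneg.
  have {B2}H2 := le_trans H2 B2.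
  have hN : h ^+ 2 != 0 by rewrite gt_eqF.
  move: H1 H2 HH hN; move: (h ^+ 4) (h ^+ 5); move: (h ^+ 2) => t t2 h5.
  by move=> H1 H2 HH tN; exact: double_difference H1 H2 HH.
split; first by lra.
by move: q0; lra.
Qed.

(** * Arithmetic of the coefficients *)

(* Imported only here: [BinInt] rebinds the scope keys [%N] and [%Z]. *)
From mathcomp Require Import ssrZ.
From Stdlib Require Import BinInt.
Local Open Scope ring_scope.

Section OperationMorphisms.
Variables (T U : Type) (o : rops T) (p : rops U) (f : T -> U).
Hypothesis fD : forall x y, f (oadd o x y) = oadd p (f x) (f y).
Hypothesis fM : forall x y, f (omul o x y) = omul p (f x) (f y).
Hypothesis fN : forall x, f (oopp o x) = oopp p (f x).
Hypothesis fnat : forall n, f (onat o n) = onat p n.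
Hypothesis finv : forall n, f (oinv o n) = oinv p n.

Definition bmap (P : bpoly T) : bpoly U := [seq (f m.1, m.2) | m <- P].

Lemma opow_map x n : f (opow o x n) = opow p (f x) n.
Proof. by elim: n => [|n IH]; rewrite ?fnat// /opow !iterS fM -/(opow o x n) IH. Qed.

Lemma osum_map s : f (osum o s) = osum p [seq f x | x <- s].
Proof. by elim: s => [|x s IH]; rewrite ?fnat//= fD IH. Qed.

Lemma ogmom_map v n : f (ogmom o v n) = ogmom p (f v) n.
Proof.
suff : f (ogmom o v n) = ogmom p (f v) n /\ f (ogmom o v n.+1) = ogmom p (f v) n.+1 by case.
by elim: n => [|n [IH1 IH2]]; rewrite /= ?fnat//; split=> //; rewrite !fM fnat IH1.
Qed.

Lemma bgauss_map ka v P : f (bgauss o ka v P) = bgauss p (f ka) (f v) (bmap P).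
Proof.
rewrite /bgauss osum_map /bmap -!map_comp; congr osum; apply: eq_map => m /=.
rewrite fM /ogmom2 osum_map -!map_comp; congr (omul p _ (osum p _)).
by apply: eq_map => k /=; rewrite !fM fnat opow_map fN !ogmom_map.
Qed.

Lemma bmap_cat P Q : bmap (P ++ Q) = bmap P ++ bmap Q.
Proof. exact: map_cat. Qed.

Lemma bmap_bmul P Q : bmap (bmul o P Q) = bmul p (bmap P) (bmap Q).
Proof.
rewrite /bmap /bmul map_flatten -!map_comp; congr flatten; apply: eq_map => m /=.
by rewrite -!map_comp; apply: eq_map => n /=; rewrite fM.
Qed.

Lemma bmap_bscale c P : bmap (bscale o c P) = bscale p (f c) (bmap P).
Proof. by rewrite /bmap /bscale -!map_comp; apply: eq_map => m /=; rewrite fM. Qed.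

Lemma dcoef_map A k : f (dcoef o A k) = dcoef p (f A) k.
Proof.
by case: k => [|[|[|[|[|[|[|k]]]]]]] /=; rewrite ?(fnat, fD, fM, fN, opow_map).
Qed.

Lemma theta_map A l j : [seq (f m.1, m.2) | m <- theta o A l j] = theta p (f A) l j.
Proof.
rewrite /theta; move: (dcoef_map A); move: (dcoef o A) (dcoef p (f A)) => d d' dd'.
by rewrite map_cat /=; case: ifP => _ /=; rewrite !(fN, fM, finv, fnat, dd').
Qed.

Lemma cpoly_map A B a b j : bmap (cpoly o A B a b j) = cpoly p (f A) (f B) (f a) (f b) j.
Proof.
rewrite /cpoly !bmap_cat -!theta_map /bmap -!map_comp; congr (_ ++ (_ ++ _)).
by case: ifP => _ //=; rewrite !(fN, fM, finv).
Qed.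

Lemma epoly2_map c1 c2 : bmap (epoly2 o c1 c2) = epoly2 p (bmap c1) (bmap c2).
Proof. by rewrite /epoly2 bmap_cat bmap_bscale bmap_bmul finv. Qed.

Lemma epoly4_map c1 c2 c3 c4 :
  bmap (epoly4 o c1 c2 c3 c4) = epoly4 p (bmap c1) (bmap c2) (bmap c3) (bmap c4).
Proof. by rewrite /epoly4 !(bmap_cat, bmap_bscale, bmap_bmul, finv). Qed.
End OperationMorphisms.

Definition Q := QArith_base.Q.
(** Reducing after every operation keeps the fractions small and makes results comparable
    syntactically after [vm_compute]. *)
Definition q_add (p q : Q) : Q := Qreduction.Qred (QArith_base.Qplus p q).
Definition q_mul (p q : Q) : Q := Qreduction.Qred (QArith_base.Qmult p q).
Definition q_opp : Q -> Q := QArith_base.Qopp.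
Definition q_nat (n : nat) : Q := QArith_base.Qmake (Z.of_nat n) xH.
Definition q_inv (n : nat) : Q :=
  if n is 0%N then QArith_base.Qmake Z0 xH else QArith_base.Qmake (Zpos xH) (Pos.of_nat n).

(* [(c0, c1, c2)] stands for [c0 + c1 x + c2 x^2], where [x^3 - 5 x^2 + 2 x + 1 = 0]. *)
Definition k3 := (Q * Q * Q)%type.
Definition k3_of (p : Q) : k3 := (p, q_nat 0, q_nat 0).
Definition k3_add (c d : k3) : k3 :=
  (q_add c.1.1 d.1.1, q_add c.1.2 d.1.2, q_add c.2 d.2).
Definition k3_opp (c : k3) : k3 := (q_opp c.1.1, q_opp c.1.2, q_opp c.2).

(* Reduction modulo [x^3 = 5 x^2 - 2 x - 1], so [x^4 = 23 x^2 - 11 x - 5]. *)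
Definition k3_mul (c d : k3) : k3 :=
  let: (c0, c1, c2) := c in let: (d0, d1, d2) := d in
  let e3 := q_add (q_mul c1 d2) (q_mul c2 d1) in let e4 := q_mul c2 d2 in
  let n k := q_nat k in
  (q_add (q_mul c0 d0) (q_opp (q_add e3 (q_mul (n 5%N) e4))),
   q_add (q_add (q_mul c0 d1) (q_mul c1 d0))
     (q_opp (q_add (q_mul (n 2%N) e3) (q_mul (n 11%N) e4))),
   q_add (q_add (q_mul c0 d2) (q_add (q_mul c1 d1) (q_mul c2 d0)))
     (q_add (q_mul (n 5%N) e3) (q_mul (n 23%N) e4))).
Definition k3ops : rops k3 := ROps k3_add k3_mul k3_opp (fun n => k3_of (q_nat n))
  (fun n => k3_of (q_inv n)).
Definition k3_lit (c0 c1 c2 : Z) (d : positive) : k3 :=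
  (QArith_base.Qmake c0 d, QArith_base.Qmake c1 d, QArith_base.Qmake c2 d).

(** * Binary cubic forms without rational zeros *)

Section BinaryCubics.
Local Open Scope Z_scope.
Implicit Types (P Q : Z).

Lemma infinite_descent (f : Z -> Z -> Prop) :
  (forall P Q, f P Q -> exists P' Q', [/\ f P' Q', 2 * Z.abs P' <= Z.abs P,
     2 * Z.abs Q' <= Z.abs Q & (P' = 0 -> P = 0) /\ (Q' = 0 -> Q = 0)]) ->
  forall P Q, f P Q -> P = 0 /\ Q = 0.
Proof.
move=> H P Q fPQ; suff : forall n : nat, forall P Q, Z.abs P + Z.abs Q <= Z.of_nat n ->
    f P Q -> P = 0 /\ Q = 0.
  by move=> /(_ (Z.to_nat (Z.abs P + Z.abs Q))); apply => //; lia.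
move: P Q {fPQ} => _ _; elim=> [|n IH] P Q le /H[P' [Q' [f' lP lQ [P0 Q0]]]]; first by lia.
have [e|ne] : (P = 0 /\ Q = 0) \/ ~ (P = 0 /\ Q = 0) by lia.
  by [].
have [||/P0 -> /Q0 ->] // := IH P' Q'; lia.
Qed.

Lemma Z_residue (k P : Z) : 0 < k -> exists P' e, P = k * P' + e /\ 0 <= e < k.
Proof.
move=> k0; exists (Z.div P k), (Z.modulo P k); split; first by apply: Z.div_mod; lia.
exact: Z.mod_pos_bound.
Qed.

(* There is no nontrivial zero modulo 2. *)
Lemma field_cubic_anisotropic P Q :
  P * P * P - 5 * (P * P * Q) + 2 * (P * Q * Q) + Q * Q * Q = 0 -> P = 0 /\ Q = 0.
Proof.
move: P Q; apply: infinite_descent => P Q.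
have [P' [e [-> he]]] := @Z_residue 2 P erefl; have [Q' [f [-> hf]]] := @Z_residue 2 Q erefl.
have [->|->] : e = 0 \/ e = 1 by lia.
all: have [->|->] : f = 0 \/ f = 1 by lia.
all: move=> E; try by exfalso; lia.
by exists P', Q'; split; lia.
Qed.

(* There is no nontrivial zero modulo 5. The form is [q1 l2 - q2 l1], where
   [q1 + l1 = 0] and [q2 + l2 = 0] are the two conics that [(a, b)] lies on, with the
   origin moved to [(19/3, 124/3)]. *)
Lemma conic_cubic_anisotropic P Q :
  (31 * 949 * (P * P) - 31 * 362 * (P * Q) + 1042 * (Q * Q)) * (233 * Q - 1058 * P) +
  3 * (31 * 222 * (P * P) - 31 * 82 * (P * Q) + 229 * (Q * Q)) * (2055 * P - 424 * Q) = 0 ->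
  P = 0 /\ Q = 0.
Proof.
move: P Q; apply: infinite_descent => P Q.
have [P' [e [-> he]]] := @Z_residue 5 P erefl; have [Q' [f [-> hf]]] := @Z_residue 5 Q erefl.
have [->|[->|[->|[->|->]]]] : e = 0 \/ e = 1 \/ e = 2 \/ e = 3 \/ e = 4 by lia.
all: have [->|[->|[->|[->|->]]]] : f = 0 \/ f = 1 \/ f = 2 \/ f = 3 \/ f = 4 by lia.
all: move=> E; try by exfalso; lia.
by exists P', Q'; split; lia.
Qed.
End BinaryCubics.

Section IntegerEmbedding.
Variable K : nzRingType.

Definition zring (n : Z) : K := (int_of_Z n)%:~R.

Lemma zringD m n : zring (Z.add m n) = zring m + zring n.
Proof. by rewrite /zring (rmorphD int_of_Z m n) rmorphD. Qed.

Lemma zringM m n : zring (Z.mul m n) = zring m * zring n.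
Proof. by rewrite /zring (rmorphM int_of_Z m n) rmorphM. Qed.

Lemma zringN m : zring (Z.opp m) = - zring m.
Proof. by rewrite /zring (rmorphN int_of_Z m) rmorphN. Qed.

Lemma zring_nat (n : nat) : zring (Z.of_nat n) = n%:R.
Proof. by rewrite /zring -[Z.of_nat n]/(Z_of_int (Posz n)) Z_of_intK. Qed.

Lemma zring_num (n : nat) (z : Z) : Z.of_nat n = z -> zring z = n%:R.
Proof. by move=> <-; exact: zring_nat. Qed.

Lemma zring0 : zring Z0 = 0. Proof. by []. Qed.
End IntegerEmbedding.

Section RationalNumbers.
Variable R : realType.
Local Notation zr := (@zring R).

Lemma zr_inj : injective zr.
Proof. by move=> m n /intr_inj /(can_inj int_of_ZK). Qed.

Lemma zr_eq0 m : (zr m == 0) = (m == Z0).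
Proof. by rewrite -(zring0 R); exact: (inj_eq zr_inj). Qed.

Lemma zr_pos p : zr (Zpos p) != 0.
Proof. by rewrite zr_eq0. Qed.

Definition rational (y : R) := exists P D : Z, zr D != 0 /\ y = zr P / zr D.

Lemma rational_zr n : rational (zr n).
Proof. by exists n, (Zpos xH); rewrite zr_pos (@zring_num R 1 (Zpos xH) erefl) divr1. Qed.

Lemma rational_nat n : rational n%:R.
Proof. by rewrite -zring_nat; exact: rational_zr. Qed.

Lemma rationalD y z : rational y -> rational z -> rational (y + z).
Proof.
move=> [P [D [D0 ->]]] [P' [D' [D0' ->]]].
exists (Z.add (Z.mul P D') (Z.mul P' D)), (Z.mul D D').
by rewrite zringD !zringM mulf_neq0//; split => //; field; rewrite D0 D0'.
Qed.

Lemma rationalM y z : rational y -> rational z -> rational (y * z).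
Proof.
move=> [P [D [D0 ->]]] [P' [D' [D0' ->]]]; exists (Z.mul P P'), (Z.mul D D').
by rewrite !zringM mulf_neq0//; split => //; field; rewrite D0 D0'.
Qed.

Lemma rationalN y : rational y -> rational (- y).
Proof.
by move=> [P [D [D0 ->]]]; exists (Z.opp P), D; rewrite zringN mulNr.
Qed.

Lemma rationalV y : rational y -> rational y^-1.
Proof.
move=> [P [D [D0 ->]]]; have [/eqP e|P0] := boolP (zr P == 0); last first.
  by exists D, P; rewrite invf_div.
by rewrite e mul0r invr0; exact: (rational_nat 0).
Qed.

Lemma rational_ratr (a : rat) : rational (ratr a).
Proof.
exists (Z_of_int (numq a)), (Z_of_int (denq a)).
by rewrite /zring !Z_of_intK intr_eq0 denq_neq0.
Qed.

End RationalNumbers.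

Ltac rational_closed := repeat first [assumption | exact: (@rational_nat _ 1)
  | exact: rational_nat | exact: rational_ratr | apply: rationalD | apply: rationalN
  | apply: rationalM | apply: rationalV].

Section CubicIrrationality.
Variable R : realType.
Local Notation zr := (@zring R).
Local Notation rational := (@rational R).

Lemma no_rational_root (s : R) : rational s -> s ^+ 3 - 5 * s ^+ 2 + 2 * s + 1 != 0.
Proof.
move=> [P [D [D0 ->]]]; apply/eqP => e; move/eqP: (D0); apply; apply/eqP.
have [|_ ->] := @field_cubic_anisotropic P D; last by rewrite zring0.
apply: (@zr_inj R); rewrite zring0 -Z.add_opp_r !(zringD, zringM, zringN).
rewrite (@zring_num R 5 5)// (@zring_num R 2 2)//.
apply: (mulIf (expf_neq0 3 (invr_neq0 D0))); rewrite mul0r -[RHS]e.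
by field.
Qed.

Lemma rational_cubic_form (y z : R) : rational y -> rational z ->
  (31 * 949 * y ^+ 2 - 31 * 362 * (y * z) + 1042 * z ^+ 2) * (233 * z - 1058 * y) +
  3 * (31 * 222 * y ^+ 2 - 31 * 82 * (y * z) + 229 * z ^+ 2) * (2055 * y - 424 * z) = 0 ->
  y = 0 /\ z = 0.
Proof.
move=> [P [D [D0 ->]]] [P' [D' [D0' ->]]] e.
have [|] := @conic_cubic_anisotropic (Z.mul P D') (Z.mul P' D).
  apply: (@zr_inj R); rewrite zring0 -!Z.add_opp_r !(zringD, zringM, zringN).
  rewrite (@zring_num R 31 31)// (@zring_num R 949 949)// (@zring_num R 362 362)// (@zring_num R 1042 1042)//.
  rewrite (@zring_num R 233 233)// (@zring_num R 1058 1058)// (@zring_num R 3 3)// (@zring_num R 222 222)//.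
  rewrite (@zring_num R 82 82)// (@zring_num R 229 229)// (@zring_num R 2055 2055)// (@zring_num R 424 424)//.
  apply: (mulIf (expf_neq0 3 (mulf_neq0 (invr_neq0 D0) (invr_neq0 D0')))).
  by rewrite mul0r -[RHS]e; field; rewrite D0 D0'.
move=> /(congr1 zr) + /(congr1 zr); rewrite !zringM zring0 => /eqP + /eqP.
by rewrite !mulf_eq0 (negPf D0) (negPf D0') !orbF => /eqP -> /eqP ->; rewrite !mul0r.
Qed.

Section CubicField.
Variable x : R.
Hypothesis cubic_x : x ^+ 3 - 5 * x ^+ 2 + 2 * x + 1 = 0.

Lemma cubic_free p q r : rational p -> rational q -> rational r ->
  p + q * x + r * x ^+ 2 = 0 -> [/\ p = 0, q = 0 & r = 0].
Proof.
have free1 p' q' : rational p' -> rational q' -> p' + q' * x = 0 -> p' = 0 /\ q' = 0.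
  move=> rp rq e; have [q0|qN] := eqVneq q' 0.
    by move: e; rewrite q0 mul0r addr0.
  have xE : x = - p' / q' by apply: (mulIf qN); rewrite divfK// -[- p']add0r -e; ring.
  have := @no_rational_root x; rewrite cubic_x eqxx => /(_ _)/negP[]//.
  by rewrite xE; apply: rationalM; [exact: rationalN | exact: rationalV].
move=> rp rq rr e; have [r0|rN] := eqVneq r 0.
  by move: e; rewrite r0 mul0r addr0 => /free1[].
(* If [x^2 = al x + be], dividing the cubic by this quadratic leaves a linear remainder, which
   vanishes at the irrational [x] and hence identically. The remaining linear factor then has the
   rational root [5 - al]. *)
pose al := - q / r; pose be := - p / r.
have ral : rational al by apply: rationalM; [exact: rationalN | exact: rationalV].
have rbe : rational be by apply: rationalM; [exact: rationalN | exact: rationalV].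
have x2 : x ^+ 2 = al * x + be.
  apply: (mulfI rN).
  have -> : r * x ^+ 2 = (p + q * x + r * x ^+ 2) - p - q * x by ring.
  by rewrite e /al /be; field.
have [|||] := @free1 (al * be - 5 * be + 1) (al ^+ 2 + be - 5 * al + 2).
- by rational_closed.
- rewrite expr2.
  by rational_closed.
- rewrite (_ : _ + _ * x = (x ^+ 3 - 5 * x ^+ 2 + 2 * x + 1) -
    (x ^+ 2 - (al * x + be)) * (x + al - 5)); last by ring.
  by rewrite cubic_x x2 subrr mul0r subr0.
move=> e1 e2; have := @no_rational_root (5 - al); case/(_ _)/negP.
  by apply: rationalD; [exact: rational_nat | exact: rationalN].
apply/eqP.
have sbe : (5 - al) * be = 1 by move: e1; clear; lra.
rewrite (_ : _ + 1 = (5 - al) * (al ^+ 2 + be - 5 * al + 2) - ((5 - al) * be - 1)); last by ring.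
by rewrite e2 sbe mulr0 subrr subr0.
Qed.
End CubicField.
End CubicIrrationality.

(* [None] stands for an expression whose denominators are not prime to 11. *)
Definition fp_lift2 (f : Z -> Z -> Z) (x y : option Z) : option Z :=
  if x is Some m then if y is Some n then Some (Z.modulo (f m n) 11) else None else None.
(** Fermat's inverse: [m^10 = 1] modulo 11 for [m] prime to 11. *)
Definition fp_inv (n : nat) : option Z :=
  let m := Z.modulo (Z.of_nat n) 11 in
  if Z.eqb m 0 then None else Some (Z.modulo (Z.pow m 9) 11).
Definition fpops : rops (option Z) := ROps (fp_lift2 Z.add) (fp_lift2 Z.mul)
  (fp_lift2 (fun _ m => Z.opp m) (Some Z0)) (fun n => Some (Z.modulo (Z.of_nat n) 11)) fp_inv.

Section SpecialPoint.
Variables (T : Type) (o : rops T) (x : T).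
Local Notation "a +' b" := (oadd o a b) (at level 50, left associativity).
Local Notation "a *' b" := (omul o a b) (at level 40, left associativity).
Local Notation "-' a" := (oopp o a) (at level 35).
Local Notation "n %:o" := (onat o n) (at level 2).

(* With [x = e^(-u)], these are [1/(e^u - 1)], [1/(e^w - 1)], and the two variances that
   enter the Gaussian moments, in the basis [1, x, x^2] of the cubic field. *)
Definition nahm_A := 1%:o +' 4%:o *' x +' -' (x *' x).
Definition nahm_B := 774%:o +' 2546%:o *' x +' -' (603%:o *' (x *' x)).
Definition nahm_ka := oinv o 259 *' (39%:o +' -' (19%:o *' x) +' 5%:o *' (x *' x)).
Definition nahm_v := oinv o 361 *'
  (-' (20832%:o) +' 32302%:o *' x +' -' (7099%:o *' (x *' x))).
(* At [(a, b) = (19/3, 124/3)]. *)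
Definition nahm_c := cpoly o nahm_A nahm_B (oinv o 3 *' 19%:o) (oinv o 3 *' 124%:o).
Definition nahm_g2 := bgauss o nahm_ka nahm_v (epoly2 o (nahm_c 1) (nahm_c 2)).
Definition nahm_g4 :=
  bgauss o nahm_ka nahm_v (epoly4 o (nahm_c 1) (nahm_c 2) (nahm_c 3) (nahm_c 4)).
Definition nahm_defect := nahm_g4 +' -' (oinv o 2 *' (nahm_g2 *' nahm_g2)).
End SpecialPoint.

Section SpecialPointMap.
Variables (T U : Type) (o : rops T) (p : rops U) (f : T -> U) (x : T).
Hypothesis fD : forall y z, f (oadd o y z) = oadd p (f y) (f z).
Hypothesis fM : forall y z, f (omul o y z) = omul p (f y) (f z).
Hypothesis fN : forall y, f (oopp o y) = oopp p (f y).
Hypothesis fnat : forall n, f (onat o n) = onat p n.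
Hypothesis finv : forall n, f (oinv o n) = oinv p n.

Lemma nahm_A_map : f (nahm_A o x) = nahm_A p (f x).
Proof. by rewrite /nahm_A !(fD, fN, fM, fnat). Qed.

Lemma nahm_B_map : f (nahm_B o x) = nahm_B p (f x).
Proof. by rewrite /nahm_B !(fD, fN, fM, fnat). Qed.

Lemma nahm_ka_map : f (nahm_ka o x) = nahm_ka p (f x).
Proof. by rewrite /nahm_ka !(fD, fN, fM, fnat, finv). Qed.

Lemma nahm_v_map : f (nahm_v o x) = nahm_v p (f x).
Proof. by rewrite /nahm_v !(fD, fN, fM, fnat, finv). Qed.

Lemma nahm_c_map j : bmap f (nahm_c o x j) = nahm_c p (f x) j.
Proof.
rewrite /nahm_c (cpoly_map fD fM fN fnat finv) nahm_A_map nahm_B_map.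
by rewrite !(fM, fnat, finv).
Qed.

Lemma nahm_defect_map : f (nahm_defect o x) = nahm_defect p (f x).
Proof.
have bg := bgauss_map fD fM fN fnat.
rewrite /nahm_defect fD fN !fM finv /nahm_g4 /nahm_g2 !bg.
by rewrite (epoly2_map fM finv) (epoly4_map fM finv) !nahm_c_map nahm_ka_map nahm_v_map.
Qed.
End SpecialPointMap.

(* Formal expressions, evaluated both in the reals and modulo 11. *)
Inductive rexp := RX | RNat of nat | RInv of nat | RAdd of rexp & rexp
  | RMul of rexp & rexp | ROpp of rexp.

Definition rexpops := ROps RAdd RMul ROpp RNat RInv.

Fixpoint reval T (o : rops T) (x : T) (e : rexp) : T :=
  match e with
  | RX => x | RNat n => onat o n | RInv n => oinv o n
  | RAdd e1 e2 => oadd o (reval o x e1) (reval o x e2)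
  | RMul e1 e2 => omul o (reval o x e1) (reval o x e2)
  | ROpp e1 => oopp o (reval o x e1)
  end.

Lemma fp_inv_mul (n : nat) f : fp_inv n = Some f ->
  exists k, Z.mul (Z.of_nat n) f = Z.add 1 (Z.mul 11 k).
Proof.
rewrite /fp_inv; move: (Z.of_nat n) => z; have [q [m [-> hm]]] := @Z_residue 11 z erefl.
have -> : Z.modulo (Z.add (Z.mul 11 q) m) 11 = m.
  by rewrite Z.add_comm Z.mul_comm Z.mod_add// Z.mod_small.
have : m = 0%Z \/ m = 1%Z \/ m = 2%Z \/ m = 3%Z \/ m = 4%Z \/ m = 5%Z \/ m = 6%Z \/
  m = 7%Z \/ m = 8%Z \/ m = 9%Z \/ m = 10%Z by lia.
move=> hm'; have E : Z.eqb m 0 = false ->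
    Z.modulo (Z.mul m (Z.modulo (Z.pow m 9) 11)) 11 = 1%Z.
  by move: hm'; do 10 (case=> [->//|]); move=> ->.
case: ifP => // /E {}E [<-]; move: E; move: (Z.modulo (Z.pow _ _) _) => F E.
exists (Z.add (Z.mul q F) (Z.div (Z.mul m F) 11)).
by have := Z.div_mod (Z.mul m F) 11; rewrite E; lia.
Qed.

(** * Reduction at a prime over 11 *)

Section ModEleven.
Variable R : realType.
Variable x : R.
Hypothesis cubic_x : x ^+ 3 - 5 * x ^+ 2 + 2 * x + 1 = 0.
Local Notation zr := (@zring R).
Local Notation zp := (@zring 'F_11).

(* Reduction at the prime over 11 that contains [x - 3]. *)
Definition reduces (r : R) (f : Z) := exists z0 z1 z2 d : Z, [/\ zp d != 0,
  zr d * r = zr z0 + zr z1 * x + zr z2 * x ^+ 2 &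
  zp d * zp f = zp z0 + zp z1 * 3 + zp z2 * 9].

Lemma zp_modulo z : zp (Z.modulo z 11) = zp z.
Proof.
have e : (11 != 0)%Z by [].
rewrite [in RHS](Z.div_mod z 11)// zringD zringM.
have -> : zp 11 = 0 by rewrite (@zring_num _ 11 11)//; apply/eqP.
by rewrite mul0r add0r.
Qed.

(** This is the consistency of the reduction: by linear independence of [1], [x], [x^2] over the
    rationals, the only representation of 0 has zero numerators, and the denominator is invertible
    modulo 11. *)
Lemma reduces_eq0 f : reduces 0 f -> zp f = 0.
Proof.
move=> [z0 [z1 [z2 [d [d0 e e']]]]].
have rz n : rational (zr n) by exact: rational_zr.
have [|e0 e1 e2] := cubic_free cubic_x (rz z0) (rz z1) (rz z2).
  by rewrite -e mulr0.
have zE z : zr z = 0 -> z = 0%Z by move=> /eqP; rewrite zr_eq0 => /eqP.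
move: e'; rewrite (zE _ e0) (zE _ e1) (zE _ e2) zring0 !mul0r !addr0.
by move=> /eqP; rewrite mulf_eq0 (negPf d0) => /eqP.
Qed.

Lemma reval_reduces e f : reval fpops (Some 3%Z) e = Some f -> reduces (reval Rops x e) f.
Proof.
elim: e f => [|n|n|e1 IH1 e2 IH2|e1 IH1 e2 IH2|e1 IH1] f /=.
- move=> [<-]; exists 0%Z, 1%Z, 0%Z, 1%Z; split => //; by rewrite ?zring0 ?zring1; ring.
- move=> [<-]; exists (Z.of_nat n), 0%Z, 0%Z, 1%Z; rewrite zp_modulo !zring_nat; split => //; ring.
- move=> /fp_inv_mul[k e].
  have E : zp (Z.of_nat n) * zp f = 1.
    rewrite -zringM e zringD zringM.
    have -> : zp 11 = 0 by rewrite (@zring_num _ 11 11)//; apply/eqP.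
    by rewrite mul0r addr0.
  have nN : zp (Z.of_nat n) != 0.
    by apply: contra_eq_neq E => ->; rewrite mul0r eq_sym oner_eq0.
  have n0 : n%:R != 0 :> R.
    by apply: contraNneq nN => /eqP; rewrite pnatr_eq0 => /eqP ->.
  exists 1%Z, 0%Z, 0%Z, (Z.of_nat n); rewrite E (zring_nat R) mulfV//.
  by split => //; rewrite ?zring0 ?(@zring_num _ 1 1)//; ring.
- move: IH1 IH2; case: (reval fpops _ e1) => // f1; case: (reval fpops _ e2) => // f2.
  move=> /(_ _ erefl)[z0 [z1 [z2 [d [d0 e e']]]]] /(_ _ erefl)[y0 [y1 [y2 [c [c0 g g']]]]] [<-].
  exists (Z.add (Z.mul c z0) (Z.mul d y0)), (Z.add (Z.mul c z1) (Z.mul d y1)),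
    (Z.add (Z.mul c z2) (Z.mul d y2)), (Z.mul d c).
  rewrite zp_modulo !zringD !zringM mulf_neq0//; split => //.
    rewrite [LHS](_ : _ = zr c * (zr d * reval Rops x e1) + zr d * (zr c * reval Rops x e2)).
      by rewrite e g; ring.
    by ring.
  rewrite [LHS](_ : _ = zp c * (zp d * zp f1) + zp d * (zp c * zp f2)); last by ring.
  by rewrite e' g'; ring.
- move: IH1 IH2; case: (reval fpops _ e1) => // f1; case: (reval fpops _ e2) => // f2.
  move=> /(_ _ erefl)[z0 [z1 [z2 [d [d0 e e']]]]] /(_ _ erefl)[y0 [y1 [y2 [c [c0 g g']]]]] [<-].
  pose t3 := Z.add (Z.mul z1 y2) (Z.mul z2 y1); pose t4 := Z.mul z2 y2.
  exists (Z.sub (Z.mul z0 y0) (Z.add t3 (Z.mul 5 t4))),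
    (Z.sub (Z.add (Z.mul z0 y1) (Z.mul z1 y0)) (Z.add (Z.mul 2 t3) (Z.mul 11 t4))),
    (Z.add (Z.add (Z.mul z0 y2) (Z.add (Z.mul z1 y1) (Z.mul z2 y0)))
       (Z.add (Z.mul 5 t3) (Z.mul 23 t4))), (Z.mul d c).
  rewrite zp_modulo -!Z.add_opp_r /t3 /t4 !(zringD, zringN, zringM) mulf_neq0//.
  have N (K : nzRingType) : (zring K 5 = 5) * (zring K 2 = 2) * (zring K 11 = 11) * (zring K 23 = 23).
    by rewrite (@zring_num K 5 5) ?(@zring_num K 2 2) ?(@zring_num K 11 11) ?(@zring_num K 23 23).
  rewrite !N; split => //.
    rewrite [LHS](_ : _ = (zr d * reval Rops x e1) * (zr c * reval Rops x e2)); last by rewrite /=; ring.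
    have x3 : x ^+ 3 = 5 * x ^+ 2 - 2 * x - 1 by move: cubic_x; clear; lra.
    have x4 : x ^+ 4 = 23 * x ^+ 2 - 11 * x - 5 by rewrite exprS x3; move: x3; clear; lra.
    rewrite e g [LHS](_ : _ = zr z0 * zr y0 + (zr z0 * zr y1 + zr z1 * zr y0) * x +
      (zr z0 * zr y2 + (zr z1 * zr y1 + zr z2 * zr y0)) * x ^+ 2 +
      (zr z1 * zr y2 + zr z2 * zr y1) * x ^+ 3 + zr z2 * zr y2 * x ^+ 4); last by ring.
    by rewrite x3 x4; ring.
  rewrite [LHS](_ : _ = (zp d * zp f1) * (zp c * zp f2)); last by ring.
  rewrite e' g'.
  (* 27 and 81 are [3^3] and [3^4]: modulo 11 they obey the reduction rules of [x^3] and [x^4],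
     because the cubic takes the value -11 at 3. *)
  have e27 : 27 = 5 * 9 - 2 * 3 - 1 :> 'F_11 by apply/eqP.
  have e81 : 81 = 23 * 9 - 11 * 3 - 5 :> 'F_11 by apply/eqP.
  rewrite [LHS](_ : _ = zp z0 * zp y0 + (zp z0 * zp y1 + zp z1 * zp y0) * 3 +
      (zp z0 * zp y2 + (zp z1 * zp y1 + zp z2 * zp y0)) * 9 +
      (zp z1 * zp y2 + zp z2 * zp y1) * 27 + zp z2 * zp y2 * 81); last by ring.
  by rewrite e27 e81; ring.
- move: IH1; case: (reval fpops _ e1) => // f1.
  move=> /(_ _ erefl)[z0 [z1 [z2 [d [d0 e e']]]]] [<-].
  exists (Z.opp z0), (Z.opp z1), (Z.opp z2), d; rewrite zp_modulo !zringN; split => //.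
    by rewrite mulrN e; ring.
  by rewrite mulrN e'; ring.
Qed.
End ModEleven.

(** One formal expression serves both sides: its residue at [x = 3] is 10, and a result of the form
    [Some] certifies that every denominator met on the way is prime to 11. *)
Lemma nahm_defect_neq0 (R : realType) (x : R) : x ^+ 3 - 5 * x ^+ 2 + 2 * x + 1 = 0 ->
  nahm_defect Rops x != 0.
Proof.
move=> cx; pose e := nahm_defect rexpops RX.
have E T (o : rops T) y : reval o y e = nahm_defect o y by exact: nahm_defect_map.
apply/eqP => d0.
have /(reval_reduces cx) : reval fpops (Some 3%Z) e = Some 10%Z.
  by rewrite E; vm_compute.
by rewrite E d0 => /(reduces_eq0 cx)/eqP.
Qed.

(** * Exact computation in the cubic field *)

Section CubicFieldEvaluation.
Variable R : realType.
Variable x : R.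
Hypothesis cubic_x : x ^+ 3 - 5 * x ^+ 2 + 2 * x + 1 = 0.
Local Notation zr := (@zring R).

Definition qr (p : Q) : R := zr (QArith_base.Qnum p) / zr (Zpos (QArith_base.Qden p)).

Lemma qr_red p : qr (Qreduction.Qred p) = qr p.
Proof.
have := Qreduction.Qred_correct p; rewrite /QArith_base.Qeq /qr => /(congr1 zr).
rewrite !zringM; move: (zr_pos R (QArith_base.Qden p)).
move: (zr_pos R (QArith_base.Qden (Qreduction.Qred p))) => d1 d2 e.
by apply: (mulIf d1); rewrite divfK//; apply: (mulIf d2); rewrite e mulrAC divfK.
Qed.

Lemma qr_add p q : qr (q_add p q) = qr p + qr q.
Proof.
rewrite /q_add qr_red /qr /= zringD Pos2Z.inj_mul !zringM.
move: (zr_pos R (QArith_base.Qden p)) (zr_pos R (QArith_base.Qden q)) => d1 d2.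
by field; rewrite d1 d2.
Qed.

Lemma qr_mul p q : qr (q_mul p q) = qr p * qr q.
Proof.
rewrite /q_mul qr_red /qr /= Pos2Z.inj_mul !zringM.
move: (zr_pos R (QArith_base.Qden p)) (zr_pos R (QArith_base.Qden q)) => d1 d2.
by field; rewrite d1 d2.
Qed.

Lemma qr_opp p : qr (q_opp p) = - qr p.
Proof. by rewrite /qr /= zringN mulNr. Qed.

Lemma zr1 : zr (Zpos xH) = 1. Proof. exact: (@zring_num R 1 1). Qed.

Lemma qr_nat n : qr (q_nat n) = n%:R.
Proof. by rewrite /qr /= zring_nat zr1 divr1. Qed.

Lemma qr_inv n : qr (q_inv n) = n%:R^-1.
Proof.
case: n => [|n]; first by rewrite /qr /= zring0 mul0r invr0.
rewrite /qr -(zring_nat R n.+1) zr1 div1r; congr (zr _)^-1.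
by rewrite -[Z.of_nat _]/(Zpos (Pos.of_succ_nat n)) Pos.of_nat_succ.
Qed.

Definition k3_eval (c : k3) : R := qr c.1.1 + qr c.1.2 * x + qr c.2 * x ^+ 2.

Lemma k3_evalD c d : k3_eval (oadd k3ops c d) = k3_eval c + k3_eval d.
Proof. by rewrite /k3_eval /= !qr_add; ring. Qed.

Lemma k3_evalN c : k3_eval (oopp k3ops c) = - k3_eval c.
Proof. by rewrite /k3_eval /= !qr_opp; ring. Qed.

Lemma k3_evalM c d : k3_eval (omul k3ops c d) = k3_eval c * k3_eval d.
Proof.
case: c d => [[c0 c1] c2] [[d0 d1] d2].
have x3 : x ^+ 3 = 5 * x ^+ 2 - 2 * x - 1 by move: cubic_x; clear; lra.
have x4 : x ^+ 4 = 23 * x ^+ 2 - 11 * x - 5 by rewrite exprS x3; move: x3; clear; lra.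
rewrite /k3_eval /= !(qr_add, qr_mul, qr_opp, qr_nat).
rewrite [RHS](_ : _ = qr c0 * qr d0 + (qr c0 * qr d1 + qr c1 * qr d0) * x +
  (qr c0 * qr d2 + (qr c1 * qr d1 + qr c2 * qr d0)) * x ^+ 2 +
  (qr c1 * qr d2 + qr c2 * qr d1) * x ^+ 3 + qr c2 * qr d2 * x ^+ 4); last by ring.
by rewrite x3 x4; ring.
Qed.

Lemma k3_eval_of p : k3_eval (k3_of p) = qr p.
Proof. by rewrite /k3_eval /= qr_nat !mul0r !addr0. Qed.

Lemma k3_eval_nat n : k3_eval (onat k3ops n) = n%:R.
Proof. by rewrite k3_eval_of qr_nat. Qed.

Lemma k3_eval_inv n : k3_eval (oinv k3ops n) = n%:R^-1.
Proof. by rewrite k3_eval_of qr_inv. Qed.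

Definition k3_x : k3 := (q_nat 0, q_nat 1, q_nat 0).

Lemma k3_eval_x : k3_eval k3_x = x.
Proof. by rewrite /k3_eval /= !qr_nat; ring. Qed.

Definition k3_red (c : k3) : k3 :=
  (Qreduction.Qred c.1.1, Qreduction.Qred c.1.2, Qreduction.Qred c.2).

Lemma k3_eval_lit c0 c1 c2 d :
  k3_eval (k3_red (k3_lit c0 c1 c2 d)) = (zr c0 + zr c1 * x + zr c2 * x ^+ 2) / zr (Zpos d).
Proof.
rewrite /k3_eval -[_.1.1]/(Qreduction.Qred (QArith_base.Qmake c0 d)).
rewrite -[_.1.2]/(Qreduction.Qred (QArith_base.Qmake c1 d)).
rewrite -[(k3_red _).2]/(Qreduction.Qred (QArith_base.Qmake c2 d)) !qr_red /qr /=.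
by move: (zr_pos R d) => dN; field.
Qed.
End CubicFieldEvaluation.

Section SecondCoefficient.
Variables (T : Type) (o : rops T) (x : T).

(* The coefficient of [h^2] is quadratic in [(a, b / 31)]; these are, up to sign
   and factors of 2, its coefficients at [1, a, b / 31, a^2, a b / 31, (b / 31)^2]. *)
Definition nahm_lin : bpoly T :=
  [seq (m.1, (m.2, 0%N)) | m <- theta o (nahm_A o x) 1 1] ++
  [seq (m.1, (0%N, m.2)) | m <- theta o (nahm_B o x) 31 1].

Definition nahm_quad : bpoly T :=
  [seq (m.1, (m.2, 0%N)) | m <- theta o (nahm_A o x) 1 2] ++
  [seq (m.1, (0%N, m.2)) | m <- theta o (nahm_B o x) 31 2].

Definition nahm_coef (k : nat) : T :=
  let X : bpoly T := [:: (onat o 1, (1%N, 0%N))] in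
  let Y : bpoly T := [:: (onat o 1, (0%N, 1%N))] in
  bgauss o (nahm_ka o x) (nahm_v o x) match k with
    | 0 => epoly2 o nahm_lin nahm_quad
    | 1 => bmul o nahm_lin X | 2 => bmul o nahm_lin Y
    | 3 => bmul o X X | 4 => bmul o X Y | _ => bmul o Y Y
  end.
End SecondCoefficient.

Lemma nahm_coef_map (T U : Type) (o : rops T) (p : rops U) (f : T -> U) (x : T) k :
  (forall y z, f (oadd o y z) = oadd p (f y) (f z)) ->
  (forall y z, f (omul o y z) = omul p (f y) (f z)) ->
  (forall y, f (oopp o y) = oopp p (f y)) ->
  (forall n, f (onat o n) = onat p n) -> (forall n, f (oinv o n) = oinv p n) ->
  f (nahm_coef o x k) = nahm_coef p (f x) k.
Proof.
move=> fD fM fN fnat finv; rewrite /nahm_coef (bgauss_map fD fM fN fnat).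
rewrite (nahm_ka_map _ fD fM fN fnat finv) (nahm_v_map _ fD fM fN fnat finv).
congr bgauss.
have quad (g h : nat -> nat * nat) j : bmap f ([seq (m.1, g m.2) | m <- theta o (nahm_A o x) 1 j] ++
    [seq (m.1, h m.2) | m <- theta o (nahm_B o x) 31 j]) =
  [seq (m.1, g m.2) | m <- theta p (nahm_A p (f x)) 1 j] ++
  [seq (m.1, h m.2) | m <- theta p (nahm_B p (f x)) 31 j].
  rewrite bmap_cat -(nahm_A_map _ fD fM fN fnat) -(nahm_B_map _ fD fM fN fnat).
  by rewrite -!(theta_map fD fM fN fnat finv) /bmap -!map_comp.
have ql : bmap f (nahm_lin o x) = nahm_lin p (f x) by exact: (quad (fun i => (i, 0%N)) (fun i => (0%N, i))).
have qq : bmap f (nahm_quad o x) = nahm_quad p (f x) by exact: (quad (fun i => (i, 0%N)) (fun i => (0%N, i))).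
case: k => [|[|[|[|[|k]]]]]; rewrite ?(epoly2_map fM finv) ?(bmap_bmul fM) ?ql ?qq //=.
all: by rewrite /bmap /= ?fM !fnat.
Qed.

Section NahmSolution.
Variable R : realType.
Variable x : R.
Hypothesis cubic_x : x ^+ 3 - 5 * x ^+ 2 + 2 * x + 1 = 0.
Local Notation zr := (@zring R).
Local Notation ev := (k3_eval x).

Lemma nahm_coef_eval k : nahm_coef Rops x k = ev (nahm_coef k3ops k3_x k).
Proof.
rewrite (@nahm_coef_map _ _ k3ops Rops) ?k3_eval_x//.
- exact: k3_evalD.
- exact: (k3_evalM cubic_x).
- exact: k3_evalN.
- exact: k3_eval_nat.
- exact: k3_eval_inv.
Qed.

(** The denominator [361 = 19^2] is the discriminant of the cubic. *)
Lemma nahm_coefE :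
  [/\ nahm_coef Rops x 0 = (- 1251 + 2619 * x - 518 * x ^+ 2) / 361,
      nahm_coef Rops x 1 = (3256 - 4997 * x + 930 * x ^+ 2) / 722,
      nahm_coef Rops x 2 = (- 606 + 910 * x - 169 * x ^+ 2) / 722 * 31 &
  [/\ nahm_coef Rops x 3 = (- 566 + 949 * x - 222 * x ^+ 2) / 361,
      nahm_coef Rops x 4 = (116 - 181 * x + 41 * x ^+ 2) / 361 * 31 &
      nahm_coef Rops x 5 = (- 672 + 1042 * x - 229 * x ^+ 2) / 361 * 31]].
Proof.
rewrite !nahm_coef_eval.
have -> : nahm_coef k3ops k3_x 0 = k3_red (k3_lit (-1251) 2619 (-518) 361) by vm_compute.
have -> : nahm_coef k3ops k3_x 1 = k3_red (k3_lit 3256 (-4997) 930 722) by vm_compute.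
have -> : nahm_coef k3ops k3_x 2 = k3_red (k3_lit (31 * -606) (31 * 910) (31 * -169) 722) by vm_compute.
have -> : nahm_coef k3ops k3_x 3 = k3_red (k3_lit (-566) 949 (-222) 361) by vm_compute.
have -> : nahm_coef k3ops k3_x 4 = k3_red (k3_lit (31 * 116) (31 * -181) (31 * 41) 361) by vm_compute.
have -> : nahm_coef k3ops k3_x 5 = k3_red (k3_lit (31 * -672) (31 * 1042) (31 * -229) 361) by vm_compute.
rewrite !k3_eval_lit !zringM.
have N p : zr (Zneg p) = - zr (Zpos p) by rewrite -zringN.
rewrite !N (@zring_num R 31 31)// (@zring_num R 361 361)// (@zring_num R 722 722)//.
rewrite (@zring_num R 1251 1251)// (@zring_num R 2619 2619)// (@zring_num R 518 518)//.
rewrite (@zring_num R 3256 3256)// (@zring_num R 4997 4997)// (@zring_num R 930 930)//.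
rewrite (@zring_num R 606 606)// (@zring_num R 910 910)// (@zring_num R 169 169)//.
rewrite (@zring_num R 566 566)// (@zring_num R 949 949)// (@zring_num R 222 222)//.
rewrite (@zring_num R 116 116)// (@zring_num R 181 181)// (@zring_num R 41 41)//.
rewrite (@zring_num R 672 672)// (@zring_num R 1042 1042)// (@zring_num R 229 229)//.
by do ! split => //; field.
Qed.

Let evE := (k3_evalD x, k3_evalM cubic_x, k3_evalN x, k3_eval_nat x, k3_eval_inv x, k3_eval_x x).

(* Each of the following identities holds in the cubic field, where it is checked by
   computation. *)
Lemma k3_identity (c : k3) (r : R) (n : nat) : c = onat k3ops n -> ev c = r -> r = n%:R.
Proof. by move=> -> <-; exact: k3_eval_nat. Qed.

Lemma k3_eval_opow c k : ev (opow k3ops c k) = ev c ^+ k.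
Proof. by rewrite (@opow_map _ _ k3ops Rops _ (k3_evalM cubic_x) (k3_eval_nat x)) opowE. Qed.

Lemma nahm_A_eval : nahm_A Rops x = ev (nahm_A k3ops k3_x).
Proof.
by rewrite (@nahm_A_map _ _ k3ops Rops ev) ?k3_eval_x//; move=> *; rewrite evE.
Qed.

Lemma nahm_B_eval : nahm_B Rops x = ev (nahm_B k3ops k3_x).
Proof.
by rewrite (@nahm_B_map _ _ k3ops Rops ev) ?k3_eval_x//; move=> *; rewrite evE.
Qed.

Lemma nahm_ka_eval : nahm_ka Rops x = ev (nahm_ka k3ops k3_x).
Proof.
by rewrite (@nahm_ka_map _ _ k3ops Rops ev) ?k3_eval_x//; move=> *; rewrite evE.
Qed.

Lemma nahm_v_eval : nahm_v Rops x = ev (nahm_v k3ops k3_x).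
Proof.
by rewrite (@nahm_v_map _ _ k3ops Rops ev) ?k3_eval_x//; move=> *; rewrite evE.
Qed.

Lemma nahm_A_spec : nahm_A Rops x * (1 - x) - x = 0.
Proof.
have H (c d : k3) : ev (oadd k3ops (omul k3ops c (oadd k3ops (onat k3ops 1) (oopp k3ops d)))
    (oopp k3ops d)) = ev c * (1 - ev d) - ev d.
  by rewrite !(k3_evalD, k3_evalN, k3_evalM cubic_x, k3_eval_nat).
rewrite nahm_A_eval; have := H (nahm_A k3ops k3_x) k3_x; rewrite [ev k3_x]k3_eval_x => <-.
by apply: (@k3_identity _ _ 0 _ erefl); vm_compute.
Qed.

(** By Nahm's equations [y = (1 - x)/x^6] and [1 - y = (1 - x)^6/x^5], so [y/(1 - y)] is the inverse
    of [x (1 - x)^5]. *)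
Lemma nahm_B_spec : nahm_B Rops x * (x * (1 - x) ^+ 5) = 1.
Proof.
have H (c d : k3) : ev (omul k3ops c (omul k3ops d (opow k3ops
    (oadd k3ops (onat k3ops 1) (oopp k3ops d)) 5))) = ev c * (ev d * (1 - ev d) ^+ 5).
  by rewrite !(k3_evalD, k3_evalN, k3_evalM cubic_x, k3_eval_nat, k3_eval_opow).
rewrite nahm_B_eval; have := H (nahm_B k3ops k3_x) k3_x; rewrite [ev k3_x]k3_eval_x => <-.
by apply: (@k3_identity _ _ 1 _ erefl); vm_compute.
Qed.

(** The second Nahm equation after elimination of [y]: for [y = (1 - x)/x^6] its right-hand side
    [x^31 y^6] is [(1 - x)^6/x^5], and the equation is multiplied by [x^6]. *)
Lemma nahm_y_spec : x ^+ 6 - (1 - x) - x * (1 - x) ^+ 6 = 0.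
Proof.
have H (c y : k3) : ev c = x -> ev y = 1 - x ->
    ev (oadd k3ops (oadd k3ops (opow k3ops c 6) (oopp k3ops y))
    (oopp k3ops (omul k3ops c (opow k3ops y 6)))) = x ^+ 6 - (1 - x) - x * (1 - x) ^+ 6.
  by move=> cE yE; rewrite !(k3_evalD, k3_evalN, k3_evalM cubic_x, k3_eval_opow) cE yE.
have yE : ev (oadd k3ops (onat k3ops 1) (oopp k3ops k3_x)) = 1 - x by rewrite !evE.
by apply: (@k3_identity _ _ 0 _ (H _ _ (k3_eval_x x) yE)); vm_compute.
Qed.

Lemma nahm_ka_spec : nahm_ka Rops x * (6 + nahm_A Rops x) = 1.
Proof.
have H (c d : k3) : ev (omul k3ops c (oadd k3ops (onat k3ops 6) d)) = ev c * (6 + ev d).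
  by rewrite (k3_evalM cubic_x) k3_evalD k3_eval_nat.
rewrite nahm_A_eval nahm_ka_eval -H.
by apply: (@k3_identity _ _ 1 _ erefl); vm_compute.
Qed.

Lemma nahm_v_spec : nahm_v Rops x * ((6 + nahm_B Rops x) / 31 - nahm_ka Rops x) = 1.
Proof.
have H (c d k : k3) : ev (omul k3ops c (oadd k3ops (omul k3ops (oadd k3ops (onat k3ops 6) d)
    (oinv k3ops 31)) (oopp k3ops k))) = ev c * ((6 + ev d) / 31 - ev k).
  rewrite (k3_evalM cubic_x) k3_evalD k3_evalN (k3_evalM cubic_x) k3_evalD.
  by rewrite k3_eval_nat k3_eval_inv.
rewrite nahm_B_eval nahm_ka_eval nahm_v_eval -H.
by apply: (@k3_identity _ _ 1 _ erefl); vm_compute.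
Qed.
End NahmSolution.

(** * The saddle point and the coefficients there *)

Lemma cubic_root (R : realType) :
  exists2 x : R, 0 < x < 1 & x ^+ 3 - 5 * x ^+ 2 + 2 * x + 1 = 0.
Proof.
pose p : {poly R} := - ('X^3 - 5%:P * 'X^2 + 2%:P * 'X + 1).
have pE y : p.[y] = - (y ^+ 3 - 5 * y ^+ 2 + 2 * y + 1) by rewrite /p !hornerE.
have [||x] := @poly_ivt R p 0 1; first exact: ler01.
  by rewrite !pE; apply/andP; split; lra.
move=> /andP[x0 x1]; rewrite /root pE oppr_eq0 => /eqP e.
exists x => //; rewrite !lt_neqAle x0 x1 !andbT; apply/andP; split; apply/eqP => xE.
  by move: e; rewrite -xE; lra.
by move: e; rewrite xE; lra.
Qed.

Lemma nahm_saddle (R : realType) (x : R) : 0 < x < 1 ->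
  x ^+ 3 - 5 * x ^+ 2 + 2 * x + 1 = 0 ->
  exists u w : R, [/\ saddle u w, dlnq 1 u = nahm_A Rops x & dlnq 1 w = nahm_B Rops x].
Proof.
move=> /andP[x0 x1] cx; have z0 : 0 < 1 - x by lra.
pose y := (1 - x) / x ^+ 6.
have xk k : 0 < x ^+ k by rewrite exprn_gt0.
have zk k : 0 < (1 - x) ^+ k by rewrite exprn_gt0.
have y0 : 0 < y by rewrite divr_gt0.
have ys := nahm_y_spec cx.
have yE : 1 - y = (1 - x) ^+ 6 / x ^+ 5.
  apply: (mulIf (lt0r_neq0 (xk 6%N))); rewrite mulrBl /y divfK ?gt_eqF//.
  rewrite mul1r [X in _ = _ * X](exprSr x 5) mulrA divfK ?gt_eqF//.
  by move: ys => /subr0_eq ->; rewrite mulrC.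
have y1 : y < 1 by rewrite -subr_gt0 yE divr_gt0.
have eu : expR (- - ln x) = x by rewrite opprK lnK.
have ew : expR (- - ln y) = y by rewrite opprK lnK.
have lny : ln y = ln (1 - x) - 6 * ln x by rewrite ln_div ?posrE// lnXn// mulr_natl.
have lny1 : ln (1 - y) = 6 * ln (1 - x) - 5 * ln x.
  by rewrite yE ln_div ?posrE// !lnXn// !mulr_natl.
exists (- ln x), (- ln y); split.
- split; rewrite ?oppr_gt0 ?ln_lt0 ?x0 ?y0//.
    by rewrite /lnq eu mul1r lny; ring.
  by rewrite /lnq ew mul1r lny1 lny; ring.
- rewrite /dlnq eu !mul1r; apply: (mulIf (lt0r_neq0 z0)); rewrite divfK ?gt_eqF//.
  by have := nahm_A_spec cx; lra.
rewrite /dlnq ew !mul1r yE; have := nahm_B_spec cx => e.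
apply: (mulIf (lt0r_neq0 (mulr_gt0 x0 (zk 5%N)))); rewrite e /y.
by field; rewrite !gt_eqF.
Qed.

Section GaussianFunctional.
Variable R : realType.
Implicit Types (p q : bpoly R) (ka v : R).

Lemma bgauss_cat ka v p q :
  bgauss Rops ka v (p ++ q) = bgauss Rops ka v p + bgauss Rops ka v q.
Proof. by rewrite !bgaussE big_cat. Qed.

Lemma bgauss_scale ka v c p : bgauss Rops ka v (bscale Rops c p) = c * bgauss Rops ka v p.
Proof.
by rewrite !bgaussE big_map mulr_sumr; apply: eq_bigr => m _; rewrite /= mulrA.
Qed.

Lemma bgauss_mul ka v p q : bgauss Rops ka v (bmul Rops p q) =
  \sum_(m <- p) \sum_(n <- q) m.1 * n.1 * gmom2 ka v (m.2.1 + n.2.1) (m.2.2 + n.2.2).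
Proof.
rewrite bgaussE /bmul big_flatten big_map; apply: eq_bigr => m _.
by rewrite big_map.
Qed.

(** Isolates the dependence on the parameters, which enter the order-[h] polynomial through a linear
    form in [X] and [Y]. *)
Lemma bgauss_epoly2_shift ka v p q (al be : R) :
  let X : bpoly R := [:: (1, (1%N, 0%N))] in let Y : bpoly R := [:: (1, (0%N, 1%N))] in
  let L := bgauss Rops ka v in let M p q := L (bmul Rops p q) in
  L (epoly2 Rops (p ++ [:: (al, (1%N, 0%N)); (be, (0%N, 1%N))]) q) =
  L (epoly2 Rops p q) + al * M p X + be * M p Y +
    al ^+ 2 / 2 * M X X + al * be * M X Y + be ^+ 2 / 2 * M Y Y.
Proof.
move=> X Y L M; rewrite /L /epoly2 !bgauss_cat !bgauss_scale /M /L !bgauss_mul.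
have E (c : R) i j : \sum_(m <- p) m.1 * c * gmom2 ka v (m.2.1 + i) (m.2.2 + j) =
    c * \sum_(m <- p) m.1 * gmom2 ka v (m.2.1 + i) (m.2.2 + j).
  by rewrite mulr_sumr; apply: eq_bigr => m _; ring.
have E' (c : R) i j : \sum_(m <- p) c * m.1 * gmom2 ka v (i + m.2.1) (j + m.2.2) =
    c * \sum_(m <- p) m.1 * gmom2 ka v (m.2.1 + i) (m.2.2 + j).
  by rewrite mulr_sumr; apply: eq_bigr => m _; rewrite addnC (addnC j); ring.
have F i j : \sum_(m <- p) \sum_(n <- [:: (1 : R, (i, j))])
    m.1 * n.1 * gmom2 ka v (m.2.1 + n.2.1) (m.2.2 + n.2.2) =
    \sum_(m <- p) m.1 * gmom2 ka v (m.2.1 + i) (m.2.2 + j).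
  by apply: eq_bigr => m _; rewrite big_seq1 /= mulr1.
rewrite /X /Y !F !big_seq1 !big_cat /= !big_cons !big_nil /= !addr0.
under eq_bigr do rewrite big_cat !big_cons !big_nil /= addr0 addrA.
rewrite !big_split /= !big_cat !big_cons !big_nil /= !addr0 (E al) (E be) (E' al) (E' be).
rewrite !add0n !addn0 !mul1r.
move: (bgauss _ _ _ _) (\sum_(m <- p) _) (\sum_(m <- p) _) (\sum_(m <- p) _) => B S1 S2 S3.
move: (gmom2 _ _ _ _) (gmom2 _ _ _ _) (gmom2 _ _ _ _) => G1 G2 G3.
by field.
Qed.
End GaussianFunctional.

Section NahmCoefficients.
Variable R : realType.
Implicit Types (a b u w x : R).

Lemma gcoef_nahm x a b u w k : x ^+ 3 - 5 * x ^+ 2 + 2 * x + 1 = 0 ->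
  dlnq 1 u = nahm_A Rops x -> dlnq 1 w = nahm_B Rops x ->
  gcoef a b u w k = bgauss Rops (nahm_ka Rops x) (nahm_v Rops x) (exp_coef a b u w k).
Proof.
move=> cx Au Bw; have inv_eq (y z : R) : y * z = 1 -> z^-1 = y.
  by move=> e; have zN : z != 0 by [apply: contra_eq_neq e => ->; rewrite mulr0 eq_sym oner_eq0];
    apply: (mulIf zN); rewrite mulVf.
rewrite /gcoef Au Bw (inv_eq _ _ (nahm_ka_spec cx)).
by rewrite (inv_eq _ _ (nahm_v_spec cx)).
Qed.

Lemma gcoef2E x a b u w : x ^+ 3 - 5 * x ^+ 2 + 2 * x + 1 = 0 ->
  dlnq 1 u = nahm_A Rops x -> dlnq 1 w = nahm_B Rops x ->
  let n := nahm_coef Rops x in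
  gcoef a b u w 2 = n 0%N - a * n 1%N - b / 31 * n 2%N + a ^+ 2 / 2 * n 3%N +
    a * (b / 31) * n 4%N + (b / 31) ^+ 2 / 2 * n 5%N.
Proof.
move=> cx Au Bw n; rewrite (gcoef_nahm _ _ _ cx Au Bw) /exp_coef /log_coef.
have -> : cpoly Rops (dlnq 1 u) (dlnq 1 w) a b 1 =
    nahm_lin Rops x ++ [:: (- a, (1%N, 0%N)); (- (b / 31), (0%N, 1%N))].
  by rewrite /cpoly Au Bw /nahm_lin -catA.
have -> : cpoly Rops (dlnq 1 u) (dlnq 1 w) a b 2 = nahm_quad Rops x.
  by rewrite /cpoly Au Bw [X in _ ++ (_ ++ X)]/= cats0.
rewrite bgauss_epoly2_shift /n /nahm_coef.
move: (bgauss _ _ _ _) (bgauss _ _ _ _) (bgauss _ _ _ _) => c1 c2 c3.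
move: (bgauss _ _ _ _) (bgauss _ _ _ _) (bgauss _ _ _ _) => c4 c5 c6.
by ring.
Qed.

Lemma gcoef_special x u w : x ^+ 3 - 5 * x ^+ 2 + 2 * x + 1 = 0 ->
  dlnq 1 u = nahm_A Rops x -> dlnq 1 w = nahm_B Rops x ->
  gcoef (19 / 3) (124 / 3) u w 4 <> gcoef (19 / 3) (124 / 3) u w 2 ^+ 2 / 2.
Proof.
move=> cx Au Bw; rewrite !(gcoef_nahm _ _ _ cx Au Bw) /exp_coef => e.
have := nahm_defect_neq0 cx; rewrite /nahm_defect.
have cE j : log_coef (19 / 3) (124 / 3) u w j = nahm_c Rops x j.
  by rewrite /log_coef Au Bw /nahm_c /= (mulrC 19) (mulrC 124).
rewrite /nahm_g4 /nahm_g2 -!cE.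
move: e; move: (bgauss _ _ _ _) (bgauss _ _ _ _) => G4 G2 -> /=.
by rewrite (_ : _ - _ = 0) ?eqxx//; field.
Qed.
End NahmCoefficients.

Theorem theorem1p1 (R : realType) (a b c : rat) (G : set 'M[int]_2) :
  finite_index_subgroup G ->
  ~ modular_function G (fun tau : R[i] => qpow c tau * F a b tau).
Proof.
move=> _ [_ mer]; have [x x01 cx] := cubic_root R.
have [u [w [sad Au Bw]]] := nahm_saddle x01 cx.
have [e2 e4] := modular_obstruction sad mer.
pose a' : R := ratr a; pose b' : R := ratr b.
have ra : rational a' by exact: rational_ratr.
have rb : rational b' by exact: rational_ratr.
have rc : rational (ratr c : R) by exact: rational_ratr.
(* [k0], [k1], [k2] are the components of [g_2 - 4/3 - c] in the basis [1], [x], [x^2]; all three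
   are rational, so all three vanish. *)
pose k0 := - 1251 / 361 - a' * (3256 / 722) - b' / 31 * (- 606 / 722 * 31) +
  a' * a' / 2 * (- 566 / 361) + a' * (b' / 31) * (116 / 361 * 31) +
  b' / 31 * (b' / 31) / 2 * (- 672 / 361 * 31) - 4 / 3 - ratr c.
pose k1 := 2619 / 361 - a' * (- 4997 / 722) - b' / 31 * (910 / 722 * 31) +
  a' * a' / 2 * (949 / 361) + a' * (b' / 31) * (- 181 / 361 * 31) +
  b' / 31 * (b' / 31) / 2 * (1042 / 361 * 31).
pose k2 := - 518 / 361 - a' * (930 / 722) - b' / 31 * (- 169 / 722 * 31) +
  a' * a' / 2 * (- 222 / 361) + a' * (b' / 31) * (41 / 361 * 31) +
  b' / 31 * (b' / 31) / 2 * (- 229 / 361 * 31).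
have [||| |_ K1 K2] := cubic_free cx (p := k0) (q := k1) (r := k2).
- by rewrite /k0; rational_closed.
- by rewrite /k1; rational_closed.
- by rewrite /k2; rational_closed.
- move: e2; rewrite (gcoef2E _ _ cx Au Bw); have [-> -> -> [-> -> ->]] := nahm_coefE cx.
  move=> /eqP; rewrite -subr_eq0 => /eqP <-; rewrite /k0 /k1 /k2 -/a' -/b'.
  by move: (ratr c) => c'; field.
(* Both conics pass through (19/3, 124/3); in coordinates centred there each equation says that a
   quadratic form equals a linear form. *)
pose y := a' - 19 / 3; pose z := b' - 124 / 3.
have [|||y0 z0] := @rational_cubic_form R y z.
- by rewrite /y; rational_closed.
- by rewrite /z; rational_closed.
(* Cross-multiplying the two equations eliminates the inhomogeneity: each quadratic form times the
   linear form of the other conic gives the binary cubic of [rational_cubic_form]. *)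
- have l1 : 31 * 949 * y ^+ 2 - 31 * 362 * (y * z) + 1042 * z ^+ 2 = - (31 * (2055 * y - 424 * z)).
    apply/eqP; rewrite -subr_eq0; apply/eqP.
    rewrite (_ : _ - _ = 31 * 722 * k1); first by rewrite K1 mulr0.
    by rewrite /y /z /k1; field.
  have l2 : 3 * (31 * 222 * y ^+ 2 - 31 * 82 * (y * z) + 229 * z ^+ 2) =
      31 * (233 * z - 1058 * y).
    apply/eqP; rewrite -subr_eq0; apply/eqP.
    rewrite (_ : _ - _ = - (3 * 31 * 722) * k2); first by rewrite K2 mulr0.
    by rewrite /y /z /k2; field.
  by rewrite l1 l2; ring.
have aE : ratr a = 19 / 3 :> R by move/eqP: y0; rewrite subr_eq0 => /eqP.
have bE : ratr b = 124 / 3 :> R by move/eqP: z0; rewrite subr_eq0 => /eqP.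
by apply: (gcoef_special cx Au Bw); rewrite -aE -bE.
Qed.
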